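(* Let $\Delta\in S(2,4)$, i.e. $\Delta$ is a $\mathbb{Z}/2\mathbb{Z}$-homology $4$-sphere all of whose missing faces have dimension at most $2$. Then $$g_2(\Delta)\;\geq\;\tfrac{2}{5}f_0(\Delta)-\tfrac{6}{5}\;=\;\tfrac25 g_1(\Delta)+\tfrac65 g_0(\Delta).$$
   Context: All simplicial complexes are finite. A simplicial complex $\Delta$ with vertex set $V(\Delta)$ is a nonempty collection of subsets (faces) of $V(\Delta)$ closed under inclusion and containing all singletons; a face $\tau$ has dimension $|\tau|-1$. A missing face of $\Delta$ is a set $\tau\subseteq V(\Delta)$ that is not a face but all of whose proper subsets are faces; its dimension is $|\tau|-1$. The link of a face $\tau$ is $\mathrm{lk}(\tau)=\{\sigma\in\Delta:\sigma\cup\tau\in\Delta,\ \sigma\cap\tau=\emptyset\}$. A $(d-1)$-sphere means a $\mathbb{Z}/2\mathbb{Z}$-homology sphere: a pure $(d-1)$-dimensional simplicial complex such that for every face $\sigma$ (including $\emptyset$), $\mathrm{lk}(\sigma)$ has the $\mathbb{Z}/2\mathbb{Z}$-homology of a $(d-1-|\sigma|)$-dimensional sphere. $S(j,d-1)$ denotes the set of $(d-1)$-spheres all of whose missing faces have dimension at most $j$. For a $(d-1)$-dimensional complex, $f_i$ is the number of $i$-faces ($f_{-1}=1$); the $h$-numbers are defined by $\sum_{i=0}^d f_{i-1}(t-1)^{d-i}=\sum_{i=0}^d h_i t^{d-i}$; and $g_0=1$, $g_j=h_j-h_{j-1}$ for $1\le j\le\lceil d/2\rceil$. *)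

(* Defs.v *)
From mathcomp Require Import all_boot all_order all_algebra.

Set Implicit Arguments.
Unset Strict Implicit.
Unset Printing Implicit Defensive.

Import Order.TTheory GRing.Theory Num.Theory.
Local Open Scope ring_scope.

(* The vertex set is the whole finite type V; a complex is its set of faces. *)
Definition simplicial_complex (V : finType) (D : {set {set V}}) : Prop :=
  [/\ D != set0,
      (forall s t : {set V}, s \in D -> t \subset s -> t \in D)
    & (forall v : V, [set v] \in D)].

(* Dimensions are integers, so that the empty face has dimension -1. *)
Definition fdim (V : finType) (s : {set V}) : int := #|s|%:Z - 1.

Definition faces (V : finType) (D : {set {set V}}) (i : int) : {set {set V}} :=
  [set s in D | fdim s == i].

Definition missing_face (V : finType) (D : {set {set V}}) (t : {set V}) : Prop :=
  t \notin D /\ (forall s : {set V}, s \proper t -> s \in D).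

Definition link (V : finType) (D : {set {set V}}) (t : {set V}) :
    {set {set V}} :=
  [set s in D | (s :|: t \in D) && (s :&: t == set0)].

Definition pure_dim (V : finType) (D : {set {set V}}) (n : int) : Prop :=
  forall s : {set V}, maxset [pred t | t \in D] s -> fdim s = n.

(* Matrix of the map from i-chains to j-chains with Z/2Z coefficients given by
   incidence of faces, chains being row vectors in the basis of faces. It is
   the simplicial boundary operator when j = i - 1; keeping j free makes
   incidence D (i + 1) i and incidence D i (i - 1) composable. *)
Definition incidence (V : finType) (D : {set {set V}}) (i j : int) :
    'M['F_2]_(#|faces D i|, #|faces D j|) :=
  \matrix_(a < #|faces D i|, b < #|faces D j|)
    ((enum_val b : {set V}) \subset (enum_val a : {set V}))%:R.

Definition cycles (V : finType) (D : {set {set V}}) (i : int) :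
    'M['F_2]_(#|faces D i|) :=
  kermx (incidence D i (i - 1)).

Definition boundaries (V : finType) (D : {set {set V}}) (i : int) :
    'M['F_2]_(#|faces D (i + 1)|, #|faces D i|) :=
  incidence D (i + 1) i.

(* Dimension over Z/2Z of the i-th homology, cycles modulo boundaries; the
   subtraction is exact since boundaries are cycles in a simplicial complex.
   The empty face makes the homology reduced. *)
Definition betti (V : finType) (D : {set {set V}}) (i : int) : nat :=
  (\rank (cycles D i) - \rank (boundaries D i))%N.

(* In reduced homology an n-sphere, including the (-1)-sphere {set0}, has a
   single one-dimensional group, in degree n. *)
Definition sphere_homology (V : finType) (D : {set {set V}}) (n : int) : Prop :=
  forall i : int, betti D i = (i == n).

Definition homology_sphere (V : finType) (D : {set {set V}}) (n : int) : Prop :=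
  [/\ simplicial_complex D,
      pure_dim D n
    & (forall s : {set V}, s \in D -> sphere_homology (link D s) (n - #|s|%:Z))].

Definition sphere_class (V : finType) (j n : int) (D : {set {set V}}) : Prop :=
  homology_sphere D n /\
  (forall t : {set V}, missing_face D t -> fdim t <= j).

Definition fnum (V : finType) (D : {set {set V}}) (i : int) : nat :=
  #|faces D i|.

(* The number d such that D is (d - 1)-dimensional. *)
Definition complex_rank (V : finType) (D : {set {set V}}) : nat :=
  \max_(s in D) #|s|.

Definition hpoly (V : finType) (D : {set {set V}}) : {poly int} :=
  let d := complex_rank D in
  \sum_(i < d.+1) (fnum D (i%:Z - 1))%:Z *: ('X - 1) ^+ (d - i).

(* Meaningful for i <= d only: the subtraction of indices is truncated. *)
Definition hnum (V : finType) (D : {set {set V}}) (i : nat) : int :=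
  (hpoly D)`_(complex_rank D - i).

(* Meaningful for j <= (d + 1) / 2 only. *)
Definition gnum (V : finType) (D : {set {set V}}) (j : nat) : int :=
  if j is k.+1 then hnum D k.+1 - hnum D k else 1.

(* Main.v *)
(* In terms of f_0 and f_1 the claim is 27 f_0 <= 5 f_1 + 81. The tool is generic
   infinitesimal rigidity for velocities m with <f_y, m_x> = <f_x, m_y> along the
   edges xy, where the trivial velocities are f_x S with S symmetric: the graph of a
   minimal (d-1)-cycle over Z/2Z is rigid in dimension d >= 3. The proof contracts an
   edge uv, splits the contracted cycle into minimal cycles, lifts each of them back
   to Z and glues the lifts.

   Rigidity of the link of a vertex v, whose vertices and edges are counted by
   n = #|nb D [set v]| and m = #|up D [set v] 2|, gives m - 4n + 10 >= 0. As D has no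
   missing face of dimension above 2, this number is at least 1, and equals 1 only if
   the link is the join of a circle with the boundary of a triangle T; such v is called
   light. Summing over v and using the Euler relations, 4 g_2 >= 2 f_0 - L where L is
   the number of light vertices.

   If f_0 > 8 then the triangles T of the light vertices can be chosen to contain no
   light vertex. Fix a vertex c in each of these triangles {a, b, c}, and delete the
   edge vc for every light v with this triangle. The remaining graph is still rigid in
   dimension 5: in the 2-sphere link of ab take the triangles meeting the light vertices
   of {a, b, c}, cone their boundary from c, and suspend the resulting 2-cycle from a
   and b. Hence g_2 >= L, and 5 g_2 >= 2 f_0. If those triangles fill the link of ab,
   then T and that link contain all vertices, and the edges can be counted directly. *)

Require Import Defs.
From mathcomp Require Import all_boot all_order all_algebra.
From mathcomp Require Import ring lra zify.
From Stdlib Require Import Classical.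

Set Implicit Arguments.
Unset Strict Implicit.
Unset Printing Implicit Defensive.

Import Order.TTheory GRing.Theory Num.Theory.
Local Open Scope ring_scope.

(** * Generic infinitesimal rigidity for symmetric motions *)

(** The condition on an edge involves no difference of positions (it describes the kernel of Kalai's
    hyperconnectivity matrix). Two coincident vertices therefore still constrain each other, so a
    vertex split is a mere specialization, and coning to the next dimension is a block matrix.
    Trivial velocities have the dimension [d(d+1)/2] of the symmetric matrices, so the edge counts
    are those of Euclidean rigidity. The obstacle in the contraction is that a lift need not lie in
    Z, and that two lifts may share too few vertices to be glued directly. Gluing is therefore
    phrased through saturated sets R, which absorb every rigid set meeting them in d vertices: the
    support of a lift either lies in R or contains no facet inside R, so cutting Z down to R leaves
    a cycle. The constant 6/5 is forced by the join of the boundaries of two triangles with two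
    points: 8 vertices, 27 edges, g_2 = 2. The same join appears when two light vertices lie in each
    other's triangles, whence the threshold 8. *)

Lemma mxrank_pencil (F : fieldType) m n (A B : 'M[F]_(m, n)) :
  exists2 p : {poly F}, p.[0] != 0 &
    forall t, p.[t] != 0 -> (\rank A <= \rank (A + t *: B)%R)%N.
Proof.
pose r : nat := \rank A.
pose P : 'M_(r, m) := pinvmx (col_base A).
pose Q : 'M_(n, r) := pinvmx (row_base A).
(* Compressing A to an invertible block selects a maximal minor without choosing rows and columns;
   its determinant along the pencil is the required polynomial. *)
have PAQ : P *m A *m Q = 1%:M.
  have -> : P *m A = row_base A.
    by rewrite -[X in P *m X](mulmx_base A) mulmxA mulVpmx ?col_base_full // mul1mx.
  by rewrite mulmxVp // row_base_free.
pose p := \det (map_mx polyC (P *m A *m Q) + 'X *: map_mx polyC (P *m B *m Q)).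
have pE t : p.[t] = \det (P *m (A + t *: B) *m Q).
  rewrite /p -[LHS]/(horner_eval t _) -det_map_mx; congr (\det _).
  rewrite mulmxDr mulmxDl -scalemxAr -scalemxAl.
  apply/matrixP=> i j; do 3!rewrite mxE.
  rewrite [X in _ + X]mxE [X in 'X * X]mxE [RHS]mxE [X in _ = _ + X]mxE.
  by rewrite /= horner_evalE hornerD hornerM hornerX !hornerC.
exists p.
  by rewrite pE scale0r addr0 PAQ det1 oner_neq0.
move=> t; rewrite pE => detN0.
have : P *m (A + t *: B) *m Q \in unitmx by rewrite unitmxE unitfE.
rewrite -row_free_unit /row_free => /eqP rk.
rewrite -/r; apply: (@leq_trans (\rank (P *m (A + t *: B))%R)); last exact: mxrankM_maxr.
by apply: leq_trans (mxrankM_maxl _ Q); rewrite rk.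
Qed.

Lemma mxrank_nonzero_cols (F : fieldType) m n (A : 'M[F]_(m, n)) (C : {set 'I_n}) :
  (forall i j, j \notin C -> A i j = 0) -> (\rank A <= #|C|)%N.
Proof.
move=> A0.
have -> : A = \sum_(j in C) (col j A *m delta_mx 0 j).
  apply/matrixP=> i k; rewrite summxE.
  case: (boolP (k \in C)) => kC.
    rewrite (bigD1 k) //= big1 ?addr0 => [|j /andP[_ jk]].
      by rewrite mxE big_ord1 !mxE !eqxx mulr1.
    by rewrite mxE big_ord1 !mxE (eq_sym k) (negPf jk) andbF mulr0.
  rewrite A0 // big1 // => j jC; rewrite mxE big_ord1 !mxE.
  by rewrite (_ : k == j = false) ?andbF ?mulr0 //; apply: contraNF kC => /eqP->.
rewrite -sum1_card.
elim/big_ind2: _ => [|x1 x2 y1 y2 h1 h2|j _].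
- by rewrite mxrank0.
- by rewrite (leq_trans (mxrank_add _ _)) // leq_add.
- by rewrite (leq_trans (mxrankM_maxr _ _)) // rank_leq_row.
Qed.

Section Rigidity.
Variables (V : finType) (d : nat).
Implicit Types (f m : V -> 'rV[rat]_d) (A : {set V * V}) (E : {set {set V}}) (U : {set V}).

Definition dot (x y : 'rV[rat]_d) : rat := \sum_k x 0 k * y 0 k.

Lemma dotE x y : dot x y = (x *m y^T) 0 0.
Proof. by rewrite mxE; apply: eq_bigr => k _; rewrite mxE. Qed.

Lemma dotC x y : dot x y = dot y x.
Proof. by apply: eq_bigr => k _; rewrite mulrC. Qed.

Lemma dotBr x y z : dot x (y - z) = dot x y - dot x z.
Proof. by rewrite !dotE linearB /= mulmxBr mxE [X in _ + X]mxE. Qed.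

Lemma dot_sym S x y : S^T = S -> dot x (y *m S) = dot y (x *m S).
Proof. by move=> hS; rewrite dotC !dotE trmx_mul hS mulmxA. Qed.

Definition motion f E m :=
  forall x y, x != y -> [set x; y] \in E -> dot (f y) (m x) = dot (f x) (m y).

(** Edges of E may leave U, and nothing is claimed about velocities outside U. So rigidity passes to
    subsets of U and to larger E, which gluing and saturation rely on. *)
Definition rigid f E U := forall m, motion f E m ->
  exists2 S : 'M_d, S^T = S & forall u, u \in U -> m u = f u *m S.

Definition spanning f U :=
  forall x : 'rV_d, (forall u, u \in U -> dot (f u) x = 0) -> x = 0.

Lemma spanning_mx f U (S : 'M_d) : spanning f U ->
  (forall u, u \in U -> f u *m S = 0) -> S = 0.
Proof.
move=> sp h; apply/matrixP=> k i; rewrite mxE.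
suff /rowP/(_ k) : \row_k S k i = 0 by rewrite !mxE.
apply: sp => u uU; have /rowP/(_ i) := h u uU; rewrite !mxE => <-.
by apply: eq_bigr => l _; rewrite mxE.
Qed.

Local Notation J := #|{: V * 'I_d}|.
Local Notation I := #|{: (V * V) + (V * 'I_d)}|.

(** Velocities are row vectors multiplied from the left. The size is the same for all A and U: pairs
    outside A give zero columns, and the [inr] columns make the velocity vanish outside U. *)
Definition rmx f A U : 'M[rat]_(J, I) := \matrix_(i, j)
  let: (u, k) := enum_val i in
  match enum_val j with
  | inl (x, y) => if (x, y) \in A then
       (u == x)%:R * f y 0 k - (u == y)%:R * f x 0 k else 0
  | inr (w, l) => ((w \notin U) && ((u, k) == (w, l)))%:R
  end.

Definition vec m : 'rV[rat]_J := \row_i m (enum_val i).1 0 (enum_val i).2.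
Definition unvec (w : 'rV[rat]_J) : V -> 'rV[rat]_d :=
  fun u => \row_k w 0 (enum_rank (u, k)).

Lemma vecK m u : unvec (vec m) u = m u.
Proof. by apply/rowP=> k; rewrite !mxE enum_rankK. Qed.

Lemma unvecK w : vec (unvec w) = w.
Proof. by apply/rowP=> i; rewrite !mxE -surjective_pairing enum_valK. Qed.

Lemma sum_vec (w : 'rV[rat]_J) (g : V * 'I_d -> rat) :
  \sum_i w 0 i * g (enum_val i) = \sum_u \sum_k unvec w u 0 k * g (u, k).
Proof.
rewrite pair_big /= (reindex (fun p : V * 'I_d => enum_rank p)) /=.
  by apply: eq_bigr => -[u k] _; rewrite enum_rankK mxE.
by exists enum_val => x _; rewrite ?enum_rankK ?enum_valK.
Qed.

Lemma mul_rmxP f A U (w : 'rV[rat]_J) :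
  w *m rmx f A U = 0 <->
  (forall x y, (x, y) \in A -> dot (f y) (unvec w x) = dot (f x) (unvec w y)) /\
  (forall u, u \notin U -> unvec w u = 0).
Proof.
have E1 x y : (x, y) \in A -> (w *m rmx f A U) 0 (enum_rank (inl (x, y))) =
    dot (f y) (unvec w x) - dot (f x) (unvec w y).
  move=> xyA; rewrite mxE.
  under eq_bigr do rewrite mxE enum_rankK xyA.
  pose g (p : V * 'I_d) := (p.1 == x)%:R * f y 0 p.2 - (p.1 == y)%:R * f x 0 p.2.
  rewrite (eq_bigr (fun i => w 0 i * g (enum_val i))); last first.
    by move=> i _; rewrite /g; case: (enum_val i).
  rewrite (sum_vec w g) /g /=.
  under eq_bigr do under eq_bigr do rewrite mulrBr.
  under eq_bigr do rewrite sumrB.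
  rewrite sumrB; congr (_ - _).
    rewrite (bigD1 x) //= [X in _ + X]big1 ?addr0 => [|u ux].
      by apply: eq_bigr => k _; rewrite eqxx mul1r mulrC.
    by rewrite big1 // => k _; rewrite (negPf ux) mul0r mulr0.
  rewrite (bigD1 y) //= [X in _ + X]big1 ?addr0 => [|u ux].
    by apply: eq_bigr => k _; rewrite eqxx mul1r mulrC.
  by rewrite big1 // => k _; rewrite (negPf ux) mul0r mulr0.
have E2 u k : u \notin U -> (w *m rmx f A U) 0 (enum_rank (inr (u, k))) =
    unvec w u 0 k.
  move=> uU; rewrite !mxE.
  rewrite (bigD1 (enum_rank (u, k))) //= big1 ?addr0 => [|i ik].
    by rewrite mxE !enum_rankK uU eqxx mulr1.
  rewrite mxE enum_rankK.
  case Ei : (enum_val i) => [u' k'].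
  rewrite (_ : _ == _ = false) ?andbF ?mulr0 //.
  by apply: contraNF ik => /eqP <-; rewrite -Ei enum_valK.
split=> [w0|[h1 h2]].
  split=> [x y xyA|u uU].
    by apply/eqP; rewrite -subr_eq0 -E1 // w0 mxE.
  by apply/rowP=> k; rewrite -E2 // w0 !mxE.
apply/rowP=> j; rewrite [RHS]mxE.
case Ej : (enum_val j) => [[x y]|[u k]]; rewrite -(enum_valK j) Ej.
  case: (boolP ((x, y) \in A)) => xyA; first by rewrite E1 // h1 // subrr.
  rewrite mxE big1 // => i _; rewrite mxE enum_rankK (negPf xyA).
  by case: (enum_val i) => ??; rewrite mulr0.
case: (boolP (u \in U)) => uU; last by rewrite E2 // h2 // mxE.
rewrite mxE big1 // => i _; rewrite mxE enum_rankK uU.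
by case: (enum_val i) => ??; rewrite mulr0.
Qed.

Lemma rmx_line f g A U t :
  rmx (fun v => f v + t *: (g v - f v)) A U = rmx f A U + t *: (rmx g A U - rmx f A U).
Proof.
apply/matrixP=> i j; rewrite !mxE; case: (enum_val i) => u k.
case: (enum_val j) => [[x y]|[w l]]; last by rewrite subrr mulr0 addr0.
case: ifP => _; last by rewrite subrr mulr0 addr0.
by rewrite !mxE; ring.
Qed.

(** Maximality of finitely many ranks replaces algebraic independence of the coordinates and can be
    attained over the rationals. *)
Definition generic f := forall A U g, (\rank (rmx g A U) <= \rank (rmx f A U))%N.

Lemma ex_max_rank A U : exists f, forall g, (\rank (rmx g A U) <= \rank (rmx f A U))%N.
Proof.
pose b g := (J - \rank (rmx g A U))%N.
suff: forall n f, (b f <= n)%N -> exists f', forall g, (\rank (rmx g A U) <= \rank (rmx f' A U))%N.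
  by move=> /(_ _ (fun _ => 0) (leqnn _)).
elim=> [|n IHn] f hf.
  exists f => g; move: hf; rewrite /b leqn0 subn_eq0 => h.
  exact: leq_trans (rank_leq_row _) h.
case: (classic (forall g, (\rank (rmx g A U) <= \rank (rmx f A U))%N)).
  by exists f.
move=> /not_all_ex_not[g /negP]; rewrite -ltnNge => hg.
apply: (IHn g); rewrite -ltnS (leq_trans _ hf) // /b.
by have := rank_leq_row (rmx g A U); lia.
Qed.

(** Induction over the pairs (A, U): given f good for the pairs already treated and g good for the
    next one, move along the line from f to g. Each requirement fails at finitely many points of
    that line only. *)
Lemma generic_exists : exists f, generic f.
Proof.
suff [f hf] : exists f, forall p : {set V * V} * {set V}, p \in enum {: {set V * V} * {set V}} ->
    forall g, (\rank (rmx g p.1 p.2) <= \rank (rmx f p.1 p.2))%N.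
  by exists f => A U g; apply: (hf (A, U)); rewrite mem_enum.
elim: (enum _) => [|[A U] s [f hf]]; first by exists (fun _ => 0).
have [g hg] := ex_max_rank A U.
pose line t v := f v + t *: (g v - f v).
have [P [P0 P1 Ph]] : exists P : {poly rat}, [/\ P != 0, True & forall t, P.[t] != 0 ->
    forall p, p \in (A, U) :: s ->
    forall g, (\rank (rmx g p.1 p.2) <= \rank (rmx (line t) p.1 p.2))%N]; last first.
  have [t tP] : exists t, P.[t] != 0.
    apply/not_all_not_ex => h.
    pose rs := [seq n%:R : rat | n <- iota 0 (size P).+1].
    suff : (size rs < size P)%N by rewrite size_map size_iota ltnNge leqnSn.
    apply: max_poly_roots => //.
      by apply/allP=> x _; apply/rootP/eqP; apply/negPn/negP/h.
    by rewrite map_inj_uniq ?iota_uniq // => i j /eqP; rewrite eqr_nat => /eqP.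
  by exists (line t) => p; apply: Ph.
have [q q0 qh] := mxrank_pencil (rmx g A U) (rmx f A U - rmx g A U).
have [P0 P00 Ph] : exists2 P : {poly rat}, P.[0] != 0 & forall t, P.[t] != 0 ->
    forall p, p \in s -> forall g, (\rank (rmx g p.1 p.2) <= \rank (rmx (line t) p.1 p.2))%N.
  elim: s hf => [|[A' U'] s IHs] hf; first by exists 1; rewrite ?hornerE ?oner_neq0.
  have [|P P0 Ph] := IHs; first by move=> p ps; apply: hf; rewrite inE ps orbT.
  have [r r0 rh] := mxrank_pencil (rmx f A' U') (rmx g A' U' - rmx f A' U').
  exists (P * r); first by rewrite hornerM mulf_neq0.
  move=> t; rewrite hornerM mulf_eq0 negb_or => /andP[/Ph Pt /rh rt] p.
  rewrite inE => /predU1P[-> g'|]; last exact: Pt.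
  by rewrite rmx_line (leq_trans _ rt) // (hf (A', U')) ?inE ?eqxx.
(* [P0] controls the pencils based at f, that is at t = 0; [q] controls the one based at g, reached
   at t = 1, hence the substitution. *)
exists (P0 * (q \Po (1 - 'X))); split=> //.
  rewrite mulf_neq0 //.
    by apply: contraNneq P00 => ->; rewrite horner0.
  apply: contraNneq q0 => h.
  have : (q \Po (1 - 'X)).[1] = 0 by rewrite h horner0.
  by rewrite horner_comp !hornerE subrr => ->.
move=> t; rewrite hornerM mulf_eq0 negb_or horner_comp => /andP[Pt qt] p.
rewrite inE => /predU1P[-> g'|]; last exact: Ph.
have {qt}/qh : q.[1 - t] != 0 by move: qt; rewrite !hornerE.
rewrite rmx_line => /(leq_trans (hg g')) /=; congr (_ <= \rank _)%N.
by rewrite !scalerBr !scalerBl !scale1r; apply/matrixP=> i j; rewrite !mxE; ring.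
Qed.
End Rigidity.

Lemma sum_enum_val (R : nmodType) (T : finType) (F : T -> R) :
  \sum_(i < #|{: T}|) F (enum_val i) = \sum_t F t.
Proof.
rewrite (reindex (fun t : T => enum_rank t)) /=.
  by apply: eq_bigr => t _; rewrite enum_rankK.
by exists enum_val => x _; rewrite ?enum_rankK ?enum_valK.
Qed.

Lemma row_freeP0 (F : fieldType) m n (A : 'M[F]_(m, n)) :
  (forall w : 'rV_m, w *m A = 0 -> w = 0) -> row_free A.
Proof.
move=> h; rewrite -kermx_eq0; apply/eqP/row_matrixP => i; rewrite row0.
by apply: h; rewrite -row_mul mulmx_ker row0.
Qed.

(** * Trivial motions and rank counts *)

Section Trivial.
Variables (V : finType) (d : nat).
Implicit Types (f m g : V -> 'rV[rat]_d) (A : {set V * V}) (E : {set {set V}}) (U : {set V}).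

Local Notation J := #|{: V * 'I_d}|.
Local Notation W := #|{: 'I_d * 'I_d}|.

Lemma dot0r (x : 'rV[rat]_d) : dot x 0 = 0.
Proof. by rewrite dotE trmx0 mulmx0 mxE. Qed.

Definition mat (w : 'rV[rat]_W) : 'M[rat]_d := \matrix_(i, j) w 0 (enum_rank (i, j)).
Definition unmat (S : 'M[rat]_d) : 'rV[rat]_W :=
  \row_p S (enum_val p).1 (enum_val p).2.

Lemma unmatK S : mat (unmat S) = S.
Proof. by apply/matrixP=> i j; rewrite !mxE enum_rankK. Qed.

Lemma mat_inj w : mat w = 0 -> w = 0.
Proof.
move=> /matrixP w0; apply/rowP=> p.
by have := w0 (enum_val p).1 (enum_val p).2; rewrite !mxE -surjective_pairing enum_valK.
Qed.

(** The map S -> S + S^T in coordinates; its image is the space of symmetric matrices. *)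
Definition symx : 'M[rat]_W := \matrix_(p, q)
  ((enum_val p == enum_val q)%:R +
   (((enum_val p).2, (enum_val p).1) == enum_val q)%:R).

Definition appx f U : 'M[rat]_(W, J) := \matrix_(p, q)
  ((((enum_val q).1 \in U) && ((enum_val p).2 == (enum_val q).2))%:R
    * f (enum_val q).1 0 (enum_val p).1).

Lemma mat_symx w : mat (w *m symx) = mat w + (mat w)^T.
Proof.
apply/matrixP=> i j; rewrite !mxE.
under eq_bigr do rewrite mxE enum_rankK mulrDr.
rewrite big_split /=; congr (_ + _).
  rewrite (bigD1 (enum_rank (i, j))) //= enum_rankK eqxx mulr1 big1 ?addr0 // => p pij.
  rewrite (_ : _ == _ = false) ?mulr0 //.
  by apply: contraNF pij => /eqP <-; rewrite enum_valK.
rewrite (bigD1 (enum_rank (j, i))) //= enum_rankK eqxx mulr1 big1 ?addr0 // => p pij.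
rewrite (_ : _ == _ = false) ?mulr0 //.
apply: contraNF pij => /eqP [<- <-].
by rewrite -surjective_pairing enum_valK.
Qed.

Lemma unvec_appx f U w u :
  unvec (w *m appx f U) u = if u \in U then f u *m mat w else 0.
Proof.
apply/rowP=> k; rewrite !mxE.
pose F (p : 'I_d * 'I_d) := w 0 (enum_rank p) *
  (((u \in U) && (p.2 == k))%:R * f u 0 p.1).
rewrite (eq_bigr (fun i => F (enum_val i))); last first.
  by move=> p _; rewrite mxE /F enum_rankK enum_valK.
rewrite sum_enum_val.
case: ifP => uU; rewrite ?mxE; last first.
  by rewrite big1 // => p _; rewrite /F uU mul0r mulr0.
transitivity (\sum_i \sum_k' F (i, k')).
  by rewrite pair_bigA; apply: eq_bigr => -[].
apply: eq_bigr => i _.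
rewrite (bigD1 k) //= big1 ?addr0 => [|j jk]; last first.
  by rewrite /F /= uU (negPf jk) mul0r mulr0.
by rewrite /F /= uU eqxx mul1r mxE mulrC.
Qed.

(** Left as a rank because it cancels when two graphs are compared; numerically only the upper bound
    [tdim_le] is needed. *)
Definition tdim := \rank symx.

(** The rows of [symx] at (i, j) and (j, i) coincide, so [symx] factors through the sorted pairs. *)
Lemma tdim_le : (tdim <= #|[set p : 'I_d * 'I_d | (p.1 <= p.2)%N]|)%N.
Proof.
pose srt (p : 'I_d * 'I_d) := if (p.1 <= p.2)%N then p else (p.2, p.1).
pose Q : 'M[rat]_W := \matrix_(p, q) (srt (enum_val p) == enum_val q)%:R.
have QE : symx = Q *m symx.
  apply/matrixP=> p q; rewrite [RHS]mxE.
  rewrite (bigD1 (enum_rank (srt (enum_val p)))) //= big1 ?addr0 => [|r rp].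
    rewrite !mxE enum_rankK eqxx mul1r /srt; case: ifP => // _ /=.
    by rewrite addrC -surjective_pairing.
  rewrite mxE (_ : _ == _ = false) ?mul0r //.
  by apply: contraNF rp => /eqP->; rewrite enum_valK.
rewrite /tdim QE (leq_trans (mxrankM_maxl _ _)) //.
pose C := [set q : 'I_W | ((enum_val q).1 <= (enum_val q).2)%N].
apply: (@leq_trans #|C|).
  apply: mxrank_nonzero_cols => p q; rewrite inE => qC.
  rewrite mxE (_ : _ == _ = false) //; apply: contraNF qC => /eqP <-.
  by rewrite /srt; case: ifP => //= /negbT; rewrite -ltnNge => /ltnW.
rewrite -(card_imset _ (@enum_val_inj _ _)); apply/subset_leq_card/subsetP => p.
by case/imsetP=> q; rewrite !inE => qC ->.
Qed.

Lemma appx_free f U : spanning f U -> row_free (appx f U).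
Proof.
move=> sp; apply: row_freeP0 => w w0; apply: mat_inj.
apply: (spanning_mx sp) => u uU.
have := unvec_appx f U w u; rewrite uU w0 => <-.
by apply/rowP=> k; rewrite !mxE.
Qed.

Definition trivx f U := symx *m appx f U.

Lemma trivx_rank f U : spanning f U -> \rank (trivx f U) = tdim.
Proof. by move=> sp; rewrite mxrankMfree // appx_free. Qed.

Lemma unvec_trivx f U w u :
  unvec (w *m trivx f U) u = if u \in U then f u *m (mat w + (mat w)^T) else 0.
Proof. by rewrite mulmxA unvec_appx mat_symx. Qed.

Lemma trivxP f U (S : 'M_d) : S^T = S ->
  exists w, forall u, unvec (w *m trivx f U) u = if u \in U then f u *m S else 0.
Proof.
move=> hS; exists (unmat (2^-1 *: S)) => u; rewrite unvec_trivx unmatK linearZ /= hS.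
by rewrite -scalerDl (_ : 2^-1 + 2^-1 = 1 :> rat) ?scale1r.
Qed.

Lemma unvec_inj (w w' : 'rV[rat]_J) : (forall u, unvec w u = unvec w' u) -> w = w'.
Proof.
move=> h; rewrite -(unvecK w) -(unvecK w'); apply/rowP=> i.
by rewrite !mxE; have /rowP/(_ (enum_val i).2) := h (enum_val i).1; rewrite !mxE.
Qed.

Lemma trivx_mul_rmx f A U U' : U \subset U' ->
  (forall p, p \in A -> (p.1 \in U) && (p.2 \in U)) -> trivx f U *m rmx f A U' = 0.
Proof.
move=> UU' AU; apply/row_matrixP => i; rewrite row0 row_mul rowE.
apply/mul_rmxP; split=> [x y /AU /andP[/= xU yU]|u uU].
  rewrite !unvec_trivx xU yU dot_sym //.
  by rewrite linearD /= trmxK addrC.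
by rewrite unvec_trivx (contraNF (subsetP UU' u) uU).
Qed.

Definition orient E := [set p : V * V |
  (enum_rank p.1 < enum_rank p.2)%N && ([set p.1; p.2] \in E)].

Lemma orientP f E m : motion f E m <->
  forall x y, (x, y) \in orient E -> dot (f y) (m x) = dot (f x) (m y).
Proof.
split=> [h x y|h x y xy xyE].
  by rewrite inE /= => /andP[xy]; apply: h; apply: contraTneq xy => ->; rewrite ltnn.
case: (ltngtP (enum_rank x) (enum_rank y)) => lt.
- by apply: h; rewrite inE /= lt.
- by symmetry; apply: h; rewrite inE /= lt setUC.
- by move: xy; rewrite (enum_rank_inj (val_inj lt)) eqxx.
Qed.

Lemma card_orient E : (#|orient E| <= #|E|)%N.
Proof.
have inj : {in orient E &, injective (fun p : V * V => [set p.1; p.2])}.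
  move=> [x y] [x' y']; rewrite !inE /= => /andP[xy _] /andP[xy' _] /setP e.
  have := e x; have := e y; rewrite !inE !eqxx /= orbT /=.
  move=> /esym/orP[/eqP ey|/eqP ey] /esym/orP[/eqP ex|/eqP ex]; subst => //.
  - by move: xy; rewrite ltnn.
  - by move: (ltn_trans xy xy'); rewrite ltnn.
  - by move: xy; rewrite ltnn.
rewrite -(card_in_imset inj); apply/subset_leq_card/subsetP => e.
by case/imsetP=> -[x y]; rewrite inE /= => /andP[_ ?] ->.
Qed.

Definition inside E U := forall e, e \in E -> e \subset U.

Lemma orient_inside E U : inside E U ->
  forall p, p \in orient E -> (p.1 \in U) && (p.2 \in U).
Proof.
move=> EU p; rewrite inE => /andP[_ /EU/subsetP h].
by rewrite !h // !inE eqxx ?orbT.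
Qed.

Lemma rigid_rank f E U : inside E U -> rigid f E U ->
  (\rank (kermx (rmx f (orient E) U)) <= tdim)%N.
Proof.
move=> EU rg; apply: (@leq_trans (\rank (trivx f U))); last exact: mxrankM_maxl.
apply: mxrankS; apply/row_subP => i.
set w := row i _.
have /mul_rmxP[h1 h2] : w *m rmx f (orient E) U = 0 by rewrite -row_mul mulmx_ker row0.
have [S hS hm] := rg (unvec w) ((orientP _ _ _).2 h1).
have [w' hw'] := trivxP f U hS.
suff -> : w = w' *m trivx f U by apply: submxMl.
apply: unvec_inj => u; rewrite hw'; case: ifP => uU; first exact: hm.
by rewrite h2 // uU.
Qed.

(** The trivial velocities lie in the kernel and, as U spans, already have dimension [tdim]; a
    kernel that is no larger consists of them. *)
Lemma rigid_of_rank f E U : inside E U -> spanning f U ->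
  (\rank (kermx (rmx f (orient E) U)) <= tdim)%N -> rigid f E U.
Proof.
move=> EU sp rk m mE.
have sub : (trivx f U <= kermx (rmx f (orient E) U))%MS.
  by apply/sub_kermxP; apply: trivx_mul_rmx (orient_inside EU).
have ker : (kermx (rmx f (orient E) U) <= trivx f U)%MS.
  rewrite -(geq_leqif (mxrank_leqif_sup sub)).
  by rewrite trivx_rank.
pose m0 u := if u \in U then m u else 0.
have : (vec m0 <= kermx (rmx f (orient E) U))%MS.
  apply/sub_kermxP/mul_rmxP; split=> [x y xyE|u uU].
    rewrite !vecK /m0; have /andP[/= -> ->] := orient_inside EU xyE.
    by move/orientP: mE; apply.
  by rewrite vecK /m0 (negPf uU).
move=> /submx_trans/(_ ker)/submxP[w hw].
exists (mat w + (mat w)^T); first by rewrite linearD /= trmxK addrC.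
move=> u uU; have : m0 u = m u by rewrite /m0 uU.
by rewrite -vecK hw unvec_trivx uU => <-.
Qed.

(** Rigidity is a bound on the corank, so a single placement g, however degenerate, certifies it for
    generic f. Vertex splits and cones use this with special placements. *)
Lemma generic_rigid f g E U : generic f -> inside E U -> spanning f U ->
  rigid g E U -> rigid f E U.
Proof.
move=> gf EU sp rg; apply: rigid_of_rank => //.
apply: leq_trans (rigid_rank EU rg).
rewrite !mxrank_ker; apply: leq_sub2l; exact: gf.
Qed.

(** Let only one vertex w move, joined to d vertices B of U which g places at the standard basis: no
    motion survives. The same full rank for f says that f(B) spans. A vertex w outside B exists
    because [d < #|V|]. *)
Lemma generic_spanning f U : generic f -> (d <= #|U|)%N -> (d < #|V|)%N -> spanning f U.
Proof.
move=> gf dU dV.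
have [B [BU Bd]] : exists B : {set V}, B \subset U /\ #|B| = d.
  exists [set x in take d (enum U)]; split.
    by apply/subsetP=> x; rewrite inE => /mem_take; rewrite mem_enum.
  rewrite cardsE (card_uniqP _) ?take_uniq ?enum_uniq // size_take -cardE.
  by case: ltngtP dU.
suff sp : spanning f B by move=> x h; apply: sp => u uB; apply: h; apply: (subsetP BU).
have /set0Pn[w] : ~: B != set0.
  by rewrite -card_gt0 cardsCs setCK Bd subn_gt0.
rewrite inE => wB.
pose A := [set p : V * V | (p.1 == w) && (p.2 \in B)].
pose g v : 'rV[rat]_d := \row_k (v == nth w (enum B) k)%:R.
have frg : row_free (rmx g A [set w]).
  apply: row_freeP0 => x /mul_rmxP[h1 h2]; apply: unvec_inj => u.
  case: (u =P w) => [->|/eqP uw]; last by rewrite h2 ?inE //; apply/rowP=> k; rewrite !mxE.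
  apply/rowP=> k; rewrite [RHS]mxE mxE.
  have kB : (k < size (enum B))%N by rewrite -cardE Bd.
  have bB : nth w (enum B) k \in B by rewrite -mem_enum mem_nth.
  have := h1 w (nth w (enum B) k); rewrite !inE /= eqxx bB => /(_ isT).
  rewrite [X in _ = dot _ X]h2 ?inE; last by apply: contraNneq wB => <-.
  rewrite dot0r.
  rewrite /dot (bigD1 k) //= big1 => [|l lk].
    by rewrite !mxE eqxx mul1r addr0.
  rewrite mxE nth_uniq ?enum_uniq // -?cardE ?Bd // eq_sym.
  by rewrite (_ : _ == _ = false) ?mul0r //; apply: negPf lk.
have frf : row_free (rmx f A [set w]).
  rewrite /row_free eqn_leq rank_leq_row /=.
  by move/eqP: frg => {1}<-; apply: gf.
move=> x hx.
pose m u := if u == w then x else 0.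
have : vec m = 0.
  apply/eqP; rewrite -(inj_eq (row_free_inj frf)) mul0mx; apply/eqP/mul_rmxP; split.
    move=> a b; rewrite inE /= => /andP[/eqP-> bB].
    rewrite !vecK /m eqxx hx // (negPf (_ : b != w)); last by apply: contraNneq wB => <-.
    by rewrite dot0r.
  by move=> u; rewrite inE => uw; rewrite vecK /m (negPf uw).
move=> v0; have := vecK m w; rewrite v0 /m eqxx => <-.
by apply/rowP=> k; rewrite !mxE.
Qed.

Lemma rmx_rank_add f A A' U U' : A \subset A' ->
  (\rank (rmx f A' U) <= \rank (rmx f A setT) + #|A' :\: A| + (#|V| - #|U|) * d)%N.
Proof.
move=> AA'.
have -> : rmx f A' U = rmx f A setT + (rmx f A' U - rmx f A setT) by rewrite addrC subrK.
apply: leq_trans (mxrank_add _ _) _; rewrite -addnA leq_add2l.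
pose C1 := [set inl p | p in A' :\: A] : {set (V * V) + (V * 'I_d)}.
pose C2 := [set inr q | q in setX (~: U) [set: 'I_d]] : {set (V * V) + (V * 'I_d)}.
have -> : (#|A' :\: A| + (#|V| - #|U|) * d = #|C1| + #|C2|)%N.
  rewrite !card_imset; [|by move=> ?? [] | by move=> ?? []].
  by rewrite cardsX cardsT card_ord [#|~: U|]cardsCs setCK.
apply: leq_trans (leq_trans (leq_card_setU C1 C2) (leqnn _)).
rewrite -(card_imset (C1 :|: C2) (@enum_rank_inj _)).
apply: mxrank_nonzero_cols => i j jC; rewrite !mxE.
have {}jC : enum_val j \notin C1 :|: C2.
  by apply: contra jC => h; apply/imsetP; exists (enum_val j); rewrite ?enum_valK.
case: (enum_val i) => u k; move: jC; case: (enum_val j) => [[x y]|[w l]]; rewrite !inE.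
  move=> /norP[h1 _].
  have /negbTE : (x, y) \notin A' :\: A.
    by apply: contra h1 => h; apply/imsetP; exists (x, y).
  rewrite inE; case: (boolP ((x, y) \in A)) => [/(subsetP AA')->|_ /= ->]; last by rewrite subrr.
  by rewrite subrr.
move=> /norP[_ h2].
have : (w, l) \notin setX (~: U) [set: 'I_d].
  by apply: contra h2 => h; apply/imsetP; exists (w, l).
by rewrite !inE andbT negbK => ->; rewrite subrr.
Qed.

(** The kernel contains, independently of each other, the trivial velocities on U and all velocities
    supported off U, the latter being the image of [D]. *)
Lemma rmx_rank_le f A U : spanning f U ->
  (forall p, p \in A -> (p.1 \in U) && (p.2 \in U)) ->
  (\rank (rmx f A setT) + tdim <= #|U| * d)%N.
Proof.
move=> sp AU.
pose D : 'M[rat]_J := \matrix_(i, j) ((i == j) && ((enum_val i).1 \notin U))%:R.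
have unD w u : unvec (w *m D) u = if u \in U then 0 else unvec w u.
  apply/rowP=> k; rewrite !mxE (bigD1 (enum_rank (u, k))) //= big1 ?addr0 => [|i iu].
    by rewrite mxE eqxx enum_rankK /=; case: ifP => _; rewrite !mxE ?mulr0 ?mulr1.
  by rewrite mxE (negPf iu) mulr0.
have rD : (\rank D >= (#|V| - #|U|) * d)%N.
  have : (\rank (1%:M - D)%R <= #|U| * d)%N.
    have -> : (#|U| * d = #|[set j : 'I_J | (enum_val j).1 \in U]|)%N.
      rewrite -{1}(card_ord d) -cardsT -cardsX -(card_imset _ (@enum_rank_inj _)).
      apply: eq_card => j; rewrite inE; apply/imsetP/idP => [[[u k]]|h].
        by rewrite !inE andbT => uU ->; rewrite enum_rankK.
      exists (enum_val j); rewrite ?enum_valK //.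
      by move: h; case: (enum_val j) => u k; rewrite !inE andbT.
    apply: mxrank_nonzero_cols => i j; rewrite inE => jU; rewrite !mxE.
    by case: eqP => [->|_]; rewrite /= ?jU subrr.
  have := mxrank_add (1%:M - D) D; rewrite subrK mxrank1.
  have : J = (#|V| * d)%N by rewrite card_prod card_ord.
  move: (\rank _) (\rank _) => r1 r2 -> rk1 rk2.
  by rewrite mulnBl leq_subLR (leq_trans rk1) // leq_add2r.
have dis : (trivx f U :&: D = 0)%MS.
  apply/eqP; rewrite -submx0; apply/row_subP => i.
  set w := row i _; have : (w <= trivx f U :&: D)%MS by apply: row_sub.
  rewrite sub_capmx => /andP[/submxP[a ha] /submxP[b hb]].
  suff -> : w = 0 by apply: sub0mx.
  apply: unvec_inj => u; rewrite (_ : unvec 0 u = 0); last by apply/rowP=> k; rewrite !mxE.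
  by case: (boolP (u \in U)) => uU; [rewrite hb unD uU | rewrite ha unvec_trivx (negPf uU)].
have sub : (trivx f U + D <= kermx (rmx f A setT))%MS.
  rewrite addsmx_sub; apply/andP; split; apply/sub_kermxP.
    by apply: trivx_mul_rmx AU; apply: subsetT.
  apply/row_matrixP => i; rewrite row0 row_mul rowE; apply/mul_rmxP; split.
    by move=> x y /AU/andP[/= xU yU]; rewrite !unD xU yU !dot0r.
  by move=> u; rewrite inE.
have := mxrankS sub; rewrite mxrank_ker mxrank_disjoint_sum // trivx_rank //.
have := rank_leq_row (rmx f A setT).
have : (#|U| * d <= #|V| * d)%N by rewrite leq_mul2r max_card orbT.
have : J = (#|V| * d)%N by rewrite card_prod card_ord.
by move: rD; rewrite mulnBl; lia.
Qed.

Lemma rigid_count f E U : inside E U -> rigid f E U ->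
  (#|U| * d <= #|E| + tdim)%N.
Proof.
move=> EU /(rigid_rank EU); rewrite mxrank_ker => rk.
have := rmx_rank_add f U U (sub0set (orient E)).
have -> : rmx f set0 setT = 0.
  apply/matrixP=> i j; rewrite !mxE; case: (enum_val i) => u k.
  by case: (enum_val j) => [[x y]|[w l]]; rewrite ?inE.
rewrite mxrank0 setD0; have := card_orient E.
have : (#|U| * d <= #|V| * d)%N by rewrite leq_mul2r max_card orbT.
have : J = (#|V| * d)%N by rewrite card_prod card_ord.
move: rk; rewrite mulnBl.
have key (a b r o e t j : nat) : (j - r <= t -> j = b -> a <= b -> o <= e ->
  r <= 0 + o + (b - a) -> a <= e + t)%N by lia.
exact: key.
Qed.

(** The number |E| - d|U| + [tdim] is the dimension of the space of stresses of a rigid graph, and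
    at most that dimension for any graph with spanning vertices; stresses of a subgraph extend by
    zero. The term [tdim] cancels. *)
Lemma rigid_count_sub f E U E' U' : inside E U -> rigid f E U ->
  E' \subset E -> inside E' U' -> spanning f U' ->
  (#|U| * d + #|E'| <= #|E| + #|U'| * d)%N.
Proof.
move=> EU /(rigid_rank EU); rewrite mxrank_ker => rk E'E E'U' sp.
have oE : orient E' \subset orient E.
  by apply/subsetP=> p; rewrite !inE => /andP[-> /(subsetP E'E)].
have := rmx_rank_add f U U oE.
have := rmx_rank_le sp (orient_inside E'U').
have : (#|orient E :\: orient E'| <= #|E :\: E'|)%N.
  apply: leq_trans (card_orient _); apply/subset_leq_card/subsetP => p.
  by rewrite !inE; case: (_ < _)%N; rewrite ?andbF //= => /andP[-> ->].
rewrite (cardsD E) (setIidPr E'E); have := subset_leq_card E'E.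
have : (#|U| * d <= #|V| * d)%N by rewrite leq_mul2r max_card orbT.
have : J = (#|V| * d)%N by rewrite card_prod card_ord.
move: rk; rewrite mulnBl.
have key (a b c r r' o e e' t j : nat) : (j - r <= t -> j = b -> a <= b -> e' <= e ->
  o <= e - e' -> r' + t <= c -> r <= r' + o + (b - a) -> a + e' <= e + c)%N by lia.
exact: key.
Qed.
End Trivial.

(** * Gluing, vertex splits and cones *)

Section RigidSets.
Variables (V : finType) (d : nat).
Implicit Types (f m g : V -> 'rV[rat]_d) (E : {set {set V}}) (U A : {set V}).

Lemma spanningS f U U' : U \subset U' -> spanning f U -> spanning f U'.
Proof. by move=> UU' sp x h; apply: sp => u uU; apply/h/(subsetP UU'). Qed.

Lemma rigidS f E E' U U' : E \subset E' -> U' \subset U -> rigid f E U -> rigid f E' U'.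
Proof.
move=> EE' UU' rg m mE; have [|S hS hm] := rg m.
  by move=> x y xy xyE; apply: mE => //; apply: (subsetP EE').
by exists S => // u uU; apply/hm/(subsetP UU').
Qed.

Lemma spanning_eq f A (S S' : 'M_d) : spanning f A ->
  (forall u, u \in A -> f u *m S = f u *m S') -> S = S'.
Proof.
move=> sp h; apply/eqP; rewrite -subr_eq0; apply/eqP; apply: (spanning_mx sp) => u uA.
by rewrite mulmxBr h // subrr.
Qed.

Lemma rigidU f E U U' : spanning f (U :&: U') -> rigid f E U -> rigid f E U' ->
  rigid f E (U :|: U').
Proof.
move=> sp rg rg' m mE; have [S hS hm] := rg m mE; have [S' hS' hm'] := rg' m mE.
have SS' : S = S'.
  by apply: (spanning_eq sp) => u; rewrite inE => /andP[uU uU']; rewrite -hm // hm'.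
by exists S => // u; rewrite inE => /orP[/hm|/hm']; rewrite ?SS'.
Qed.

Lemma rigid_add f E U A v : spanning f A -> A \subset U -> v \notin U ->
  (forall u, u \in A -> [set u; v] \in E) -> rigid f E U -> rigid f E (v |: U).
Proof.
move=> sp AU vU vE rg m mE; have [S hS hm] := rg m mE; exists S => // u.
rewrite !inE => /predU1P[->|/hm//].
apply/eqP; rewrite -subr_eq0; apply/eqP; apply: sp => x xA.
have xU := subsetP AU _ xA.
have xv : x != v by apply: contraNneq vU => <-.
rewrite dotBr (mE v x) 1?eq_sym // 1?setUC ?vE // hm //.
by rewrite dot_sym // subrr.
Qed.

(** With positions F and velocities M as rows, the edge conditions say that M F^T is symmetric,
    which is equivalent to the symmetry of S = F^-1 M. *)
Lemma rigid_basis f E U : spanning f U -> #|U| = d ->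
  (forall u v, u \in U -> v \in U -> u != v -> [set u; v] \in E) -> rigid f E U.
Proof.
move=> sp Ud UE m mE.
case: (set_0Vmem U) => [U0|[u0 u0U]].
  by exists 0; rewrite ?trmx0 // => u; rewrite U0 inE.
pose e (i : 'I_d) := nth u0 (enum U) i.
have eU i : e i \in U by rewrite -mem_enum mem_nth // -cardE Ud.
have eP u : u \in U -> exists i, u = e i.
  move=> uU; have ui : (index u (enum U) < d)%N by rewrite -Ud cardE index_mem mem_enum.
  by exists (Ordinal ui); rewrite /e nth_index // mem_enum.
pose Fm := \matrix_(i < d) f (e i); pose Mm := \matrix_(i < d) m (e i).
have Fu : Fm \in unitmx.
  rewrite -unitmx_tr -row_free_unit; apply: row_freeP0 => w w0; apply: sp => u /eP[i ->].
  have /rowP/(_ i) := w0; rewrite !mxE => <-; rewrite dotC.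
  by apply: eq_bigr => k _; rewrite !mxE.
have symFM : Mm *m Fm^T = Fm *m Mm^T.
  have entry (P Q : 'I_d -> 'rV[rat]_d) i j :
      ((\matrix_a P a) *m (\matrix_a Q a)^T) i j = dot (P i) (Q j).
    by rewrite mxE; apply: eq_bigr => k _; rewrite !mxE.
  apply/matrixP=> i j; rewrite !entry dotC.
  case: (eqVneq (e i) (e j)) => [->|eij]; first by rewrite dotC.
  by rewrite mE // UE.
pose S := invmx Fm *m Mm.
exists S.
  apply: (can_inj (mulKmx Fu)); rewrite mulKVmx //.
  rewrite /S trmx_mul trmx_inv mulmxA -symFM mulmxK //.
  by rewrite unitmx_tr.
move=> u /eP[i ->].
have : row i (Fm *m S) = row i Mm by rewrite mulKVmx.
by rewrite row_mul !rowK => <-.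
Qed.

Lemma generic_rigid_clique f E U : generic f -> (d < #|V|)%N -> (d <= #|U|)%N ->
  (forall u v, u \in U -> v \in U -> u != v -> [set u; v] \in E) -> rigid f E U.
Proof.
move=> gf dV.
move: {2}(#|U| - d)%N (erefl (#|U| - d)%N) => n; elim: n U => [|n IHn] U Un dU UE.
  apply: rigid_basis UE; last by apply/eqP; rewrite eqn_leq dU -subn_eq0 Un.
  exact: generic_spanning.
have /card_gt0P[v vU] : (0 < #|U|)%N by lia.
have Uv : #|U :\ v| = #|U|.-1 by rewrite (cardsD1 v U) vU.
rewrite -(setD1K vU); apply: (rigid_add (A := U :\ v)) => //.
- by apply: generic_spanning => //; lia.
- by rewrite !inE eqxx.
- by move=> u; rewrite !inE => /andP[uv uU]; apply: UE.
apply: IHn; [lia|lia|].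
by move=> u w; rewrite !inE => /andP[_ uU] /andP[_ wU]; apply: UE.
Qed.

(* Placing the new vertex v on top of u makes the common neighbours and the edge
   uv force equal velocities at u and v; no limit p_v -> p_u is needed. *)
Lemma rigid_split f E E' U u v (C : {set V}) : generic f -> (d < #|V|)%N ->
  (d <= #|U|)%N -> inside E U -> inside E' (v |: U) -> rigid f E U ->
  u \in U -> v \notin U -> [set u; v] \in E' ->
  u \notin C -> v \notin C -> (d <= #|C|.+1)%N ->
  (forall c, c \in C -> ([set c; u] \in E') /\ ([set c; v] \in E')) ->
  (forall x y, x \in U -> y \in U -> x != u -> y != u -> [set x; y] \in E ->
     [set x; y] \in E') ->
  (forall x, x \in U -> x != u -> [set x; u] \in E ->
     ([set x; u] \in E') || ([set x; v] \in E')) ->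
  rigid f E' (v |: U).
Proof.
move=> gf dV dU EU EU' rg uU vU uvE uC vC dC CE E1 E2.
pose g w := if w == v then f u else f w.
have gU w : w \in U -> g w = f w.
  by rewrite /g; case: eqP => // ->; rewrite (negPf vU).
have spU := generic_spanning gf dU dV.
have sp : spanning f (v |: U) by apply: spanningS spU; apply: subsetUr.
apply: (generic_rigid (g := g)) => //.
have uv : u != v by apply: contraNneq vU => <-.
move=> m mE.
have gu : g u = f u by rewrite gU.
have gv : g v = f u by rewrite /g eqxx.
have gC c : c \in C -> g c = f c.
  by rewrite /g; case: eqP => // ->; rewrite (negPf vC).
have muv : m u = m v.
  apply/eqP; rewrite -subr_eq0; apply/eqP.
  apply: (generic_spanning (U := u |: C) gf) => //; first by rewrite cardsU1 uC.
  move=> c; rewrite !inE => /predU1P[->|cC].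
    by rewrite dotBr -{1}gv (mE u v) // gu subrr.
  have [cu cv] := CE c cC.
  have cNu : c != u by apply: contraNneq uC => <-.
  have cNv : c != v by apply: contraNneq vC => <-.
  rewrite dotBr -(gC c cC) -(mE c u) // -(mE c v) //.
  by rewrite gu gv subrr.
have mV x y : x != u -> y != u -> x \in U -> y \in U -> x != y ->
    [set x; y] \in E -> dot (f y) (m x) = dot (f x) (m y).
  by move=> xu yu xU yU xy xyE; rewrite -!gU // mE // E1.
have mu x : x != u -> x \in U -> [set x; u] \in E -> dot (f u) (m x) = dot (f x) (m u).
  move=> xu xU xuE; have xv : x != v by apply: contraNneq vU => <-.
  have [h|h] := orP (E2 x xU xu xuE).
    by rewrite -(gU x) // -gu mE.
  by rewrite -(gU x) // -gv mE // muv.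
have [|S hS hm] := rg m.
  move=> x y xy xyE; have /subsetP sub := EU _ xyE.
  have xU : x \in U by apply: sub; rewrite !inE eqxx.
  have yU : y \in U by apply: sub; rewrite !inE eqxx orbT.
  case: (eqVneq x u) xy xyE xU yU => [->|xu] xy xyE xU yU.
    by rewrite mu 1?eq_sym // setUC.
  case: (eqVneq y u) xy xyE => [->|yu] xy xyE; first exact: mu.
  exact: mV.
exists S => // w; rewrite !inE => /predU1P[->|wU]; last by rewrite gU // hm.
by rewrite gv -muv hm.
Qed.
End RigidSets.

(** Place the apex at the first basis vector and the base in the complementary coordinates. The
    edges at the apex express the first coordinate of each velocity through the velocity of the
    apex; the other coordinates form a motion of the base. Together they assemble a symmetric block
    matrix. *)
Lemma rigid_cone (V : finType) d (f : V -> 'rV[rat]_d) (f' : V -> 'rV[rat]_(1 + d))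
  (E : {set {set V}}) (U : {set V}) (a : V) :
  generic f' -> (d.+1 < #|V|)%N -> (d < #|U|.+1)%N -> a \notin U -> inside E U ->
  spanning f U -> rigid f E U ->
  rigid f' (E :|: [set [set x; a] | x in U]) (a |: U).
Proof.
move=> gf dV dU aU EU sp rg.
have Ua : #|a |: U| = #|U|.+1 by rewrite cardsU1 aU.
pose g x : 'rV[rat]_(1 + d) := if x == a then row_mx 1%:M 0 else row_mx 0 (f x).
have ga : g a = row_mx 1%:M 0 by rewrite /g eqxx.
have gU x : x \in U -> g x = row_mx 0 (f x).
  by move=> xU; rewrite /g (negPf (_ : x != a)) //; apply: contraNneq aU => <-.
have dotrow (x y : 'rV[rat]_(1 + d)) : dot x y = dot (lsubmx x) (lsubmx y) + dot (rsubmx x) (rsubmx y).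
  by rewrite /dot big_split_ord /=; congr (_ + _); apply: eq_bigr => k _; rewrite !mxE.
apply: (generic_rigid (g := g)) => //.
- move=> e; rewrite inE => /orP[/EU/subset_trans->//|]; first by rewrite subsetUr.
  case/imsetP=> x xU ->; apply/subsetP=> y; rewrite !inE => /orP[/eqP->|/eqP->].
    by rewrite xU orbT.
  by rewrite eqxx.
- by apply: generic_spanning => //; rewrite Ua.
move=> m mE.
have [|S hS hm] := rg (fun x => rsubmx (m x)).
  move=> x y xy xyE; have /subsetP sub := EU _ xyE.
  have xU : x \in U by apply: sub; rewrite !inE eqxx.
  have yU : y \in U by apply: sub; rewrite !inE eqxx orbT.
  have := mE x y xy; rewrite inE xyE => /(_ isT).
  rewrite !gU // !dotrow !row_mxKl !row_mxKr.
  by rewrite ![dot 0 _]dotC !dot0r !add0r.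
pose s := lsubmx (m a); pose w := rsubmx (m a).
have la x : x \in U -> lsubmx (m x) = f x *m w^T.
  move=> xU; have xa : x != a by apply: contraNneq aU => <-.
  have := mE x a xa; rewrite inE (imset_f (fun x => [set x; a])) ?orbT // => /(_ isT).
  rewrite ga gU // !dotrow !row_mxKl !row_mxKr ![dot 0 _]dotC !dot0r addr0 add0r.
  rewrite !dotE mul1mx => h; apply/matrixP=> i j; rewrite !ord1 -h.
  by rewrite [RHS]mxE.
exists (block_mx s w w^T S).
  rewrite tr_block_mx hS trmxK; congr (block_mx _ _ _ _).
  by apply/matrixP=> i j; rewrite mxE !ord1.
move=> x; rewrite !inE => /predU1P[->|xU].
  rewrite ga mul_row_block !mul1mx !mul0mx !addr0 /s /w hsubmxK //.
rewrite gU // mul_row_block !mul0mx !add0r -la // -hm //.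
by rewrite hsubmxK.
Qed.

(** * Rigidity of minimal cycles *)

Local Close Scope ring_scope.

Lemma big_addb_ex (I : finType) (P : pred I) (F : pred I) :
  \big[addb/false]_(i | P i) F i -> exists2 i, P i & F i.
Proof.
case: (pickP [pred i | P i && F i]) => [i /andP[Pi Fi] _|h]; first by exists i.
by rewrite big1 // => i Pi; have := h i; rewrite /= Pi.
Qed.

Lemma big_addb_card (I : finType) (P : pred I) (F : pred I) :
  \big[addb/false]_(i | P i) F i = odd #|[pred i | P i && F i]|.
Proof.
rewrite -sum1_card big_mkcondr /= (big_morph odd oddD (erefl _)).
by apply: eq_bigr => i _; case: (F i).
Qed.

(** Each unordered pair is counted twice and cancels mod 2. This is the reason why the boundary of a
    boundary vanishes. *)
Lemma big_addb_sym (I : finType) (P : pred I) (G : I -> I -> bool) :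
  (forall x y, G x y = G y x) ->
  \big[addb/false]_(x | P x) \big[addb/false]_(y | P y && (y != x)) G x y = false.
Proof.
move=> Gsym.
pose L := \big[addb/false]_(x | P x) \big[addb/false]_(y | P y && (enum_rank y < enum_rank x)) G x y.
transitivity (L (+) L); last exact: addbb.
rewrite {2}/L [X in _ = _ (+) X](exchange_big_dep P) /=; last by move=> ? ? _ /andP[].
rewrite -big_split /=; apply: eq_bigr => x Px.
rewrite (bigID (fun y => enum_rank y < enum_rank x)) /=; congr (_ (+) _).
  apply: eq_bigl => y; case: (P y) => //=; apply: andb_idl.
  by apply: contraTneq => ->; rewrite ltnn.
apply: eq_big => [y|y _]; last exact: Gsym.
have E : (enum_rank x == enum_rank y :> nat) = (y == x).
  by rewrite (inj_eq val_inj) (inj_eq enum_rank_inj) eq_sym.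
by rewrite Px /= -leqNgt ltn_neqAle E; case: (P y).
Qed.

Section Cycles.
Variables (V : finType) (d : nat).
Implicit Types (w : {set V} -> bool) (r s t A B : {set V}) (Y Z : {set {set V}}).

(** Boundary coefficient mod 2. Chains are boolean functions on all vertex sets rather than on the
    faces of a complex, since lifts may use sets outside the given cycle. *)
Definition bd w r := \big[addb/false]_(x | x \notin r) w (x |: r).

Definition cyclic w := forall r, #|r|.+1 = d -> bd w r = false.

Definition cyc Z := (forall t, t \in Z -> #|t| = d) /\ cyclic (fun t => t \in Z).

Definition min_cyc Z := [/\ cyc Z, Z != set0 &
  forall Y, Y \subset Z -> cyc Y -> Y != set0 -> Y = Z].

Definition edges Z : {set {set V}} :=
  [set e : {set V} | (#|e| == 2) && [exists t in Z, e \subset t]].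

Lemma in_edges Z x y : x != y ->
  ([set x; y] \in edges Z) = [exists t in Z, (x \in t) && (y \in t)].
Proof.
move=> xy; rewrite inE cards2 xy; apply: eq_existsb => t.
by rewrite subUset !sub1set.
Qed.

Lemma edge_in Z t x y : t \in Z -> x \in t -> y \in t -> x != y ->
  [set x; y] \in edges Z.
Proof. by move=> tZ xt yt xy; rewrite in_edges //; apply/existsP; exists t; rewrite tZ xt. Qed.

Lemma edge_ex Z x y : x != y -> [set x; y] \in edges Z ->
  exists2 t, t \in Z & (x \in t) && (y \in t).
Proof. by move=> xy; rewrite in_edges // => /existsP[t /andP[]]; exists t. Qed.

Lemma edges_inside Z : inside (edges Z) (cover Z).
Proof.
move=> e; rewrite inE => /andP[_ /existsP[t /andP[tZ et]]].
by apply: subset_trans et (bigcup_sup _ tZ).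
Qed.

Lemma eq_bd w w' r : (forall t, w t = w' t) -> bd w r = bd w' r.
Proof. by move=> h; apply: eq_bigr => x _; rewrite h. Qed.

Lemma bdD w w' r : bd (fun t => w t (+) w' t) r = bd w r (+) bd w' r.
Proof. by rewrite /bd big_split. Qed.

Lemma bd_sum (I : finType) (P : pred I) (F : I -> {set V} -> bool) r :
  bd (fun t => \big[addb/false]_(i | P i) F i t) r = \big[addb/false]_(i | P i) bd (F i) r.
Proof. by rewrite /bd exchange_big. Qed.

Lemma bdF w r : (forall t, ~~ w t) -> bd w r = false.
Proof. by move=> h; rewrite /bd big1 // => x _; apply/negbTE. Qed.

Lemma bdP w r : bd w r -> exists2 x, x \notin r & w (x |: r).
Proof. exact: big_addb_ex. Qed.

Lemma bd1 w r x : x \notin r -> bd w r = w (x |: r) (+) \big[addb/false]_(y | (y \notin r) && (y != x)) w (y |: r).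
Proof. by move=> xr; rewrite /bd (bigD1 x). Qed.

Lemma cyc_setD Y Z : Y \subset Z -> cyc Y -> cyc Z -> cyc (Z :\: Y).
Proof.
move=> YZ [Y1 Y2] [Z1 Z2]; split=> [t|r rd]; first by rewrite inE => /andP[_ /Z1].
transitivity (bd (fun t => (t \in Z) (+) (t \in Y)) r); last first.
  by rewrite bdD; move: (Z2 r rd) (Y2 r rd) => -> ->.
apply: eq_bd => t; rewrite inE; case: (boolP (t \in Y)) => [/(subsetP YZ)->//|_].
by rewrite addbF.
Qed.

Lemma min_cyc_ex Z t : cyc Z -> t \in Z -> exists Y, [/\ min_cyc Y, Y \subset Z & t \in Y].
Proof.
have [n] := ubnP #|Z|; elim: n Z => // n IHn Z /ltnSE leZ cZ tZ.
have Z0 : Z != set0 by apply/set0Pn; exists t.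
case: (classic (exists Y, [/\ Y \subset Z, cyc Y, Y != set0 & Y <> Z])); last first.
  move=> h; exists Z; split=> //; split=> // Y YZ cY Y0.
  by apply: NNPP => YZ'; apply: h; exists Y.
case=> Y [YZ cY Y0 YnZ].
have cYZ := subset_leq_card YZ.
have ltYZ : #|Y| < #|Z|.
  by rewrite proper_card // properEneq YZ andbT; apply/eqP.
case: (boolP (t \in Y)) => tY.
  have [|W [mW WY tW]] := IHn Y _ cY tY; first by lia.
  by exists W; split=> //; apply: subset_trans YZ.
have ltZY : #|Z :\: Y| < n.
  by rewrite cardsD (setIidPr YZ); move: Y0; rewrite -card_gt0; lia.
have tZY : t \in Z :\: Y by rewrite inE tY.
have [W [mW WZ tW]] := IHn _ ltZY (cyc_setD YZ cY cZ) tZY.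
by exists W; split=> //; apply: subset_trans WZ (subsetDl _ _).
Qed.

Variable (f : V -> 'rV[rat]_d).
Hypotheses (gf : generic f) (dV : d < #|V|).

Definition saturated Z R := forall W, rigid f (edges Z) W -> d <= #|W :&: R| -> W \subset R.

(** Grow a rigid set R from one facet. If R is not saturated, gluing enlarges it. If it is, the
    facets inside R form a nonempty subcycle, which is Z by minimality. *)
Lemma saturated_min_rigid Z : min_cyc Z ->
  (forall R, saturated Z R -> cyclic (fun t => (t \in Z) && (t \subset R))) ->
  rigid f (edges Z) (cover Z).
Proof.
move=> [[Zd cZ] Z0 Zmin] sat.
have [t0 t0Z] := set0Pn _ Z0.
have rt0 : rigid f (edges Z) t0.
  apply: generic_rigid_clique => //; first by rewrite Zd.
  by move=> u v; apply: edge_in.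
suff: forall n (R : {set V}), #|V| - #|R| <= n -> t0 \subset R -> rigid f (edges Z) R ->
    rigid f (edges Z) (cover Z).
  by move=> /(_ _ t0 (leqnn _) (subxx _) rt0).
elim=> [|n IHn] R Rn t0R rR.
  have -> : cover Z = cover Z :&: R.
    suff -> : R = setT by rewrite setIT.
    by apply/eqP; rewrite eqEcard subsetT cardsT; lia.
  by apply: rigidS rR => //; apply: subsetIr.
case: (classic (saturated Z R)) => [sR|/not_all_ex_not[W]].
  apply: rigidS rR => //; apply/bigcupsP => t.
  suff <- : [set t in Z | t \subset R] = Z by rewrite inE => /andP[].
  apply: Zmin.
  - by apply/subsetP=> s; rewrite inE => /andP[].
  - split=> [s|r rd]; first by rewrite inE => /andP[/Zd].
    by rewrite -(sat _ sR _ rd); apply: eq_bd => s; rewrite inE.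
  - by apply/set0Pn; exists t0; rewrite inE t0Z.
move=> h; have [rW h2] := imply_to_and _ _ h; have [dW /negP WR] := imply_to_and _ _ h2.
have RW : #|R| < #|R :|: W|.
  rewrite proper_card // properE subsetUl /=; apply: contra WR.
  by apply: subset_trans; apply: subsetUr.
apply: (IHn (R :|: W)).
- by have := max_card (mem (R :|: W)); lia.
- by apply: subset_trans t0R (subsetUl _ _).
- by apply: rigidU => //; apply: generic_spanning => //; rewrite setIC.
Qed.

(** * Contraction of an edge and lifting of cycles *)

Section Contraction.
Variables (Z : {set {set V}}) (u v : V).
Hypotheses (mZ : min_cyc Z) (uv : u != v) (uvZ : [set u; v] \in edges Z).

Let Zd t : t \in Z -> #|t| = d. Proof. by have [[h _] _ _] := mZ; apply: h. Qed.
Let Zc : cyclic (fun t => t \in Z). Proof. by have [[_ h] _ _] := mZ. Qed.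

Definition apart t := ~~ ((u \in t) && (v \in t)).
Definition contr t := if v \in t then u |: (t :\ v) else t.
(** Image of the chain Z under the simplicial map v -> u: facets through both u and v degenerate to
    0, and two facets with the same image cancel mod 2. *)
Definition contracted : {set {set V}} := [set s : {set V} | (v \notin s) &&
  (if u \in s then (s \in Z) (+) (v |: (s :\ u) \in Z) else s \in Z)].

Lemma swap_vertex r x : u \in r -> v \notin r -> x != u -> x != v ->
  v |: ((x |: r) :\ u) = x |: (v |: (r :\ u)).
Proof.
move=> ur vr xu xv; apply/setP=> y; rewrite !inE.
by case: (eqVneq y v) => //= [->|yv]; rewrite ?orbT //; case: (eqVneq y x) => [->|//]; rewrite xu.
Qed.

Lemma contracted_cyc : cyc contracted.
Proof.
split=> [s|r rd].
  rewrite inE => /andP[vs]; case: ifP => us; last exact: Zd.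
  case: (boolP (s \in Z)) => [/Zd//|_ /= /Zd].
  rewrite cardsU1 !inE (negPf vs) andbF => <-.
  by rewrite (cardsD1 u s) us.
case: (boolP (v \in r)) => vr.
  by rewrite /bd big1 // => x _; rewrite inE !inE vr orbT.
case: (boolP (u \in r)) => ur.
  pose r' := v |: (r :\ u).
  have ur' : u \notin r' by rewrite !inE eqxx (negPf uv).
  have e1 := Zc rd; rewrite (bd1 _ vr) in e1.
  have r'd : #|r'|.+1 = d.
    by rewrite cardsU1 !inE (negPf vr) andbF -rd (cardsD1 u r) ur.
  have e2 := Zc r'd; rewrite (bd1 _ ur') in e2.
  have ur'E : u |: r' = v |: r.
    by rewrite /r' setUCA setD1K.
  rewrite (bd1 _ vr) /=.
  have -> /= : (v |: r \in contracted) = false by rewrite inE !inE eqxx.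
  transitivity (\big[addb/false]_(y | (y \notin r) && (y != v))
      ((y |: r \in Z) (+) (y |: r' \in Z))).
    apply: eq_bigr => x /andP[xr xv].
    have xu : x != u by apply: contraNneq xr => ->.
    by rewrite inE !inE (negPf vr) eq_sym (negPf xv) ur orbT /= swap_vertex.
  rewrite big_split /=; move: e1 e2; rewrite ur'E.
  have E F : \big[addb/false]_(y | (y \notin r') && (y != u)) F y =
             \big[addb/false]_(y | (y \notin r) && (y != v)) F y.
    apply: eq_bigl => y; rewrite !inE; case: (eqVneq y v) => [->|yv]; rewrite ?andbF //=.
    by case: (eqVneq y u) => [->|]; rewrite ?ur ?andbT.
  rewrite E.
  by case: (_ \in Z) => /=; do 2!case: (\big[_/_]_(_ | _) _).
transitivity (bd (fun t => t \in Z) r); last exact: Zc.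
have uP : (u \notin r) && (u != v) by rewrite ur.
rewrite (bd1 _ vr) [RHS](bd1 _ vr) !(bigD1 u uP) /=.
have -> : (v |: r \in contracted) = false by rewrite inE !inE eqxx.
have -> : (u |: r \in contracted) = (u |: r \in Z) (+) (v |: r \in Z).
  by rewrite inE !inE eqxx (negPf vr) eq_sym (negPf uv) /= setU1K.
rewrite (eq_bigr (fun x => x |: r \in Z)); last first.
  move=> x /andP[/andP[xr xv] xu].
  by rewrite inE !inE (negPf vr) (negPf ur) ![_ == x]eq_sym (negPf xv) (negPf xu).
by case: (u |: r \in Z); case: (v |: r \in Z); case: (\big[_/_]_(_ | _) _).
Qed.

Definition lift0 y t := [&& t \in Z, apart t & contr t \in (y : {set {set V}})].
(** The facets of Z over y, completed by sets through both u and v. Their coefficients are forced: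
    they cancel the boundary of [lift0 y] at ridges through exactly one of u and v. Such a set need
    not be a facet of Z. *)
Definition lift (y : {set {set V}}) t :=
  if apart t then lift0 y t else bd (lift0 y) (t :\ v).

Section Lift.
Variable y : {set {set V}}.
Hypotheses (ysub : y \subset contracted) (cy : cyc y).

Let y_v s : s \in y -> v \notin s.
Proof. by move/(subsetP ysub); rewrite inE => /andP[]. Qed.

Let y_vr r : (v |: r \in y) = false.
Proof. by apply/negP=> /y_v; rewrite !inE eqxx. Qed.

Lemma lift0_vu t : u \in t -> v \in t -> lift0 y t = false.
Proof. by move=> ut vt; rewrite /lift0 /apart ut vt andbF. Qed.

Lemma lift0_u t : v \notin t -> lift0 y t = (t \in Z) && (t \in y).
Proof. by move=> vt; rewrite /lift0 /apart /contr (negPf vt) andbF. Qed.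

Lemma lift0_none t : v \notin t -> u \notin t -> lift0 y t = (t \in y).
Proof.
move=> vt ut; rewrite lift0_u // andb_idl // => /(subsetP ysub).
by rewrite inE vt (negPf ut).
Qed.

Lemma lift0_v t : v \in t -> u \notin t -> lift0 y t = (t \in Z) && (u |: (t :\ v) \in y).
Proof. by move=> vt ut; rewrite /lift0 /apart /contr vt (negPf ut). Qed.

Lemma lift0_pair r : u \notin r -> v \notin r ->
  lift0 y (u |: r) (+) lift0 y (v |: r) = (u |: r \in y).
Proof.
move=> ur vr; have vur : v \notin u |: r by rewrite !inE eq_sym negb_or uv.
rewrite lift0_u // lift0_v ?inE ?eqxx ?(negPf ur) ?orbF //.
rewrite setU1K // -andb_addl andb_idl // => /(subsetP ysub).
by rewrite inE vur !inE eqxx /= setU1K.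
Qed.

(** The two coefficients add up to the boundary of y at u + r, which is 0. Hence the same filling
    coefficient serves u + r and v + r. *)
Lemma bd_lift0_uv r : #|r|.+2 = d -> u \notin r -> v \notin r ->
  bd (lift0 y) (u |: r) = bd (lift0 y) (v |: r).
Proof.
move=> rd ur vr.
have vur : v \notin u |: r by rewrite !inE eq_sym negb_or uv.
have uvr : u \notin v |: r by rewrite !inE negb_or uv.
suff: bd (lift0 y) (u |: r) (+) bd (lift0 y) (v |: r) = false.
  by case: (bd _ _); case: (bd _ _).
rewrite (bd1 _ vur) (bd1 _ uvr) !lift0_vu ?inE ?eqxx ?orbT //=.
have E F : \big[addb/false]_(x | (x \notin v |: r) && (x != u)) F x =
           \big[addb/false]_(x | (x \notin u |: r) && (x != v)) F x.
  by apply: eq_bigl => x; rewrite !inE; case: (x == u); case: (x == v); rewrite ?andbF ?andbT.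
rewrite E -big_split /= (eq_bigr (fun x => x |: (u |: r) \in y)); last first.
  move=> x /andP[]; rewrite !inE negb_or => /andP[xu xr] xv.
  by rewrite !(setUCA [set x]) lift0_pair // !inE negb_or eq_sym ?xu ?xv.
have := cy.2 (u |: r); rewrite cardsU1 ur rd => /(_ (erefl _)); rewrite (bd1 _ vur).
by rewrite y_vr.
Qed.

Lemma lift_size t : lift y t -> #|t| = d.
Proof.
rewrite /lift; case: ifP => [_ /and3P[/Zd]//|/negbFE/andP[ut vt]].
move=> /bdP[x]; rewrite !inE => xtv /and3P[/Zd + _ _].
by rewrite cardsU1 !inE xtv (cardsD1 v t) vt.
Qed.

Lemma bd_lift0_none r : #|r|.+1 = d -> u \notin r -> v \notin r -> bd (lift0 y) r = false.
Proof.
move=> rd ur vr; transitivity (bd (fun t => t \in y) r); last exact: cy.2.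
have uP : (u \notin r) && (u != v) by rewrite ur.
rewrite (bd1 (lift0 y) vr) (bd1 (fun t => t \in y) vr) !(bigD1 u uP) /=.
rewrite addbA (addbC (lift0 y _)) lift0_pair //.
rewrite y_vr /=; congr (_ (+) _).
apply: eq_bigr => x /andP[/andP[xr xv] xu].
by rewrite lift0_none // !inE negb_or eq_sym ?xu ?xv.
Qed.

Lemma lift_cyclic : cyclic (lift y).
Proof.
move=> r rd; case: (boolP (u \in r)) => ur; case: (boolP (v \in r)) => vr.
- pose G x z := lift0 y (z |: (x |: (r :\ v))).
  rewrite /bd -[RHS](@big_addb_sym V (fun x => x \notin r) G); last first.
    by move=> x z; rewrite /G setUCA.
  apply: eq_bigr => x xr.
  have xv : x != v by apply: contraNneq xr => ->.
  rewrite /lift /apart !inE ur vr !orbT /=.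
  have -> : (x |: r) :\ v = x |: (r :\ v).
    by apply/setP=> z; rewrite !inE; case: (eqVneq z x) => [->|]; rewrite ?xv ?orbF.
  have vP : v \notin x |: (r :\ v) by rewrite !inE eqxx eq_sym (negPf xv).
  rewrite (bd1 _ vP) lift0_vu ?inE ?eqxx ?ur ?uv ?orbT //=.
  apply: eq_bigl => z; rewrite !inE; case: (eqVneq z v) => [->|]; rewrite ?vr ?andbF //=.
  by move=> _; rewrite negb_or andbT andbC.
- rewrite (bd1 _ vr) {1}/lift /apart !inE eqxx ur orbT /= setU1K //.
  rewrite [bd _ _](bd1 _ vr) lift0_vu ?inE ?eqxx ?ur ?orbT //=.
  rewrite [X in _ (+) X](eq_bigr (fun x => lift0 y (x |: r))) ?addbb //.
  move=> x /andP[xr xv]; rewrite /lift /apart !inE (negPf vr) (eq_sym v) (negPf xv) andbF //.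
- rewrite (bd1 _ ur) {1}/lift /apart !inE eqxx vr orbT /=.
  have -> : (u |: r) :\ v = u |: (r :\ v).
    by apply/setP=> z; rewrite !inE; case: (eqVneq z u) => [->|]; rewrite ?uv ?orbF.
  rewrite bd_lift0_uv ?inE ?(negPf ur) ?eqxx ?andbF //; last first.
    by rewrite -rd (cardsD1 v r) vr.
  rewrite setD1K // [bd _ _](bd1 _ ur) lift0_vu ?inE ?eqxx ?vr ?orbT //=.
  rewrite [X in _ (+) X](eq_bigr (fun x => lift0 y (x |: r))) ?addbb //.
  move=> x /andP[xr xu]; rewrite /lift /apart !inE (negPf ur) (eq_sym u) (negPf xu) //.
rewrite -[RHS](bd_lift0_none rd ur vr); apply: eq_bigr => x xr.
rewrite /lift /apart !inE (negPf ur) (negPf vr) !orbF.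
case: (eqVneq u x) => //= <-; by rewrite (eq_sym v) (negPf uv).
Qed.

Definition liftset := [set t | lift y t].

Lemma liftset_cyc : cyc liftset.
Proof.
split=> [t|r rd]; first by rewrite inE; apply: lift_size.
by rewrite -(lift_cyclic rd); apply: eq_bd => t; rewrite inE.
Qed.

(** Even when t is not a facet of Z, both t - u and t - v are ridges where [lift0 y] has nonzero
    boundary, so they lie in facets of Z. Hence every edge of t other than uv is an edge of Z. *)
Lemma lift_uv t : lift y t -> u \in t -> v \in t ->
  (exists2 s, s \in y & t :\ v \subset s) /\
  forall x, x \in [set u; v] -> exists2 s, s \in Z & t :\ x \subset s.
Proof.
move=> tl ut vt; have td := lift_size tl.
move: (tl); rewrite /lift /apart ut vt /= => b.
have [x xt x0] := bdP b.
have xv : x != v.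
  by apply: contraTneq x0 => ->; rewrite setD1K // lift0_vu.
have vx : v \notin x |: t :\ v by rewrite !inE eqxx eq_sym (negPf xv).
have := x0; rewrite lift0_u // => /andP[xZ xy].
split; first by exists (x |: t :\ v) => //; apply: subsetUr.
move=> z; rewrite !inE => /orP[]/eqP->; last by exists (x |: t :\ v) => //; apply: subsetUr.
pose F := t :\ v :\ u.
have tv : t :\ v = u |: F by rewrite /F setD1K // !inE uv.
have tu : t :\ u = v |: F.
  by rewrite /F; apply/setP=> w; rewrite !inE; case: (eqVneq w v) => [->|]; rewrite ?vt // eq_sym uv.
have dF : #|F|.+2 = d.
  by rewrite -td (cardsD1 v t) vt (cardsD1 u (t :\ v)) !inE uv ut.
move: b; rewrite tv bd_lift0_uv //; [|by rewrite !inE eqxx|by rewrite !inE eqxx andbF].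
rewrite tu => /bdP[w wF /and3P[wZ _ _]].
by exists (w |: (v |: F)) => //; apply: subsetUr.
Qed.

Lemma liftset_edges : edges liftset \subset edges Z.
Proof.
apply/subsetP=> e; rewrite inE => /andP[e2 /existsP[t /andP[]]].
rewrite inE => tl et; case: (boolP (apart t)) => [ap|].
  rewrite inE e2; apply/existsP; exists t; rewrite et andbT.
  by move: tl; rewrite /lift ap => /and3P[].
rewrite negbK => /andP[ut vt]; have [_ h] := lift_uv tl ut vt.
have inZ x : x \in [set u; v] -> x \notin e -> e \in edges Z.
  move=> /h[s sZ ts] xe; rewrite inE e2; apply/existsP; exists s; rewrite sZ.
  apply: subset_trans ts; apply/subsetP=> z ze; rewrite !inE (subsetP et) // andbT.
  by apply: contraNneq xe => <-.
case: (boolP (u \in e)) => ue; last by apply: inZ ue; rewrite !inE eqxx.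
case: (boolP (v \in e)) => ve; last by apply: inZ ve; rewrite !inE eqxx orbT.
suff -> : e = [set u; v] by [].
apply/esym/eqP; rewrite eqEcard (eqP e2) cards2 uv andbT.
by apply/subsetP=> z; rewrite !inE => /orP[]/eqP->.
Qed.

Lemma liftset_contr t : t \in liftset -> exists2 s, s \in y & t \subset v |: s.
Proof.
rewrite inE => tl; case: (boolP (apart t)) => [ap|].
  move: tl; rewrite /lift ap => /and3P[_ _]; rewrite /contr; case: ifP => vt ty.
    exists (u |: t :\ v) => //; apply/subsetP=> z zt; rewrite !inE zt andbT.
    by case: (z == v); rewrite ?orbT.
  by exists t => //; apply: subsetUr.
rewrite negbK => /andP[ut vt]; have [[s sy ts] _] := lift_uv tl ut vt.
by exists s => //; rewrite -(setD1K vt); apply: setUS.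
Qed.

Lemma liftset_lift s : s \in y ->
  (s \in liftset) || ((u \in s) && (v |: s :\ u \in liftset)).
Proof.
move=> sy; have vs := y_v sy; have := subsetP ysub _ sy; rewrite inE vs /=.
have ap : apart s by rewrite /apart (negPf vs) andbF.
case: ifP => us; last by rewrite inE /lift ap lift0_u // sy => ->.
rewrite !inE {1}/lift ap lift0_u // sy andbT; case: (s \in Z) => //= sZ.
have us' : u \notin v |: s :\ u by rewrite !inE eqxx (negPf uv).
have vv : v \in v |: s :\ u by rewrite !inE eqxx.
rewrite /lift /apart (negPf us') /= (lift0_v vv us') sZ /=.
by rewrite setU1K ?setD1K // !inE (negPf vs) andbF.
Qed.

End Lift.
(** Otherwise the lift is a nonzero cycle inside Z, hence Z itself; but Z has a facet through the
    edge uv. *)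
Lemma exists_lift_uv (y : {set {set V}}) : y \subset contracted -> cyc y -> y != set0 ->
  exists t, [/\ lift y t, u \in t & v \in t].
Proof.
move=> ysub cy /set0Pn[s sy]; apply: NNPP => h.
have [cl1 cl2] := liftset_cyc ysub cy.
have lZ : liftset y \subset Z.
  apply/subsetP=> t; rewrite inE => tl; move: (tl); rewrite /lift.
  case: (boolP (apart t)) => [_ /and3P[]//|]; rewrite negbK => /andP[ut vt] _.
  by case: h; exists t.
have l0 : liftset y != set0.
  apply/set0Pn; have /orP[sl|/andP[_ sl]] := liftset_lift ysub sy.
    by exists s.
  by exists (v |: s :\ u).
have [_ _ Zmin] := mZ.
have lE := Zmin _ lZ (conj cl1 cl2) l0.
have [t tZ /andP[ut vt]] := edge_ex uv uvZ.
by case: h; exists t; split=> //; move: tZ; rewrite -lE inE.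
Qed.

(** The lift arises from y by splitting u into u and v, which needs d - 1 common neighbours. A
    lifted facet t through uv provides d - 2 of them, and its neighbour across a ridge through uv
    one more; such a ridge exists because d > 2. *)
Lemma liftset_rigid (y : {set {set V}}) : 2 < d -> y \subset contracted -> min_cyc y ->
  rigid f (edges y) (cover y) -> rigid f (edges Z) (cover (liftset y)).
Proof.
move=> d3 ysub [cy y0 _] ry.
have y_v s : s \in y -> v \notin s.
  by move/(subsetP ysub); rewrite inE => /andP[].
have cov : cover (liftset y) \subset v |: cover y.
  apply/bigcupsP=> t /(liftset_contr ysub cy)[s sy ts].
  by apply: subset_trans ts _; apply/setUS/bigcup_sup.
apply: (rigidS (liftset_edges ysub cy) cov).
have [t [tl ut vt]] := exists_lift_uv ysub cy y0.
have td := lift_size tl.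
pose F := t :\ v :\ u.
have vF : v \notin F by rewrite !inE eqxx andbF.
have uF : u \notin F by rewrite !inE eqxx.
have tE : t = v |: (u |: F) by rewrite /F !setD1K // !inE uv.
have vuF : v \notin u |: F by rewrite in_setU1 negb_or eq_sym uv vF.
have dF : #|F|.+2 = d by rewrite -td tE cardsU1 vuF cardsU1 uF.
have /card_gt0P[x xF] : 0 < #|F| by lia.
have xu : x != u by apply: contraNneq uF => <-.
have xv : x != v by apply: contraNneq vF => <-.
have xt : x \in t by rewrite tE !in_setU1 xF !orbT.
pose r := t :\ x.
have rd : #|r|.+1 = d by rewrite -td (cardsD1 x t) xt.
have xr : x \notin r by rewrite !inE eqxx.
have /big_addb_ex[x' /andP[x'r x'x] x'l] :
    \big[addb/false]_(z | (z \notin r) && (z != x)) lift y (z |: r).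
  by have := lift_cyclic ysub cy rd; rewrite (bd1 _ xr) setD1K // tl; case: (\big[_/_]_(_ | _) _).
have ur : u \in r by rewrite !inE eq_sym xu.
have vr : v \in r by rewrite !inE eq_sym xv.
have x'u : x' != u by apply: contraNneq x'r => ->.
have x'v : x' != v by apply: contraNneq x'r => ->.
have x'F : x' \notin F.
  by apply: contra x'r; rewrite !inE x'x => /and3P[].
have [s0 s0y] := set0Pn _ y0.
have s0d : #|s0| = d by apply: cy.1.
have coverP s : s \in y -> s \subset cover y by move=> sy; apply: bigcup_sup.
have vU : v \notin cover y.
  by apply/bigcupP => -[s /y_v/negP].
apply: (@rigid_split V d f (edges y) _ (cover y) u v (x' |: F)) => //.
- by rewrite -s0d; apply/subset_leq_card/coverP.
- exact: edges_inside.
- by move=> e /(edges_inside)/subset_trans; apply.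
- have [[s sy ts] _] := lift_uv ysub cy tl ut vt.
  by apply: (subsetP (coverP _ sy)); apply: (subsetP ts); rewrite !inE uv.
- by apply: (edge_in (t := t)); rewrite ?inE.
- by rewrite in_setU1 negb_or eq_sym x'u uF.
- by rewrite in_setU1 negb_or eq_sym x'v vF.
- by rewrite cardsU1 x'F add1n dF.
- have lr : x' |: r \in liftset y by rewrite inE.
  have lt : t \in liftset y by rewrite inE.
  move=> c; rewrite in_setU1 => /predU1P[->|].
    by split; apply: edge_in lr _ _ _; rewrite // ?in_setU1 ?eqxx ?ur ?vr ?orbT.
  rewrite !in_setD1 => /and3P[cu cv ct].
  by split; apply: edge_in lt _ _ _.
- move=> a b aU bU au bu /[dup] ab; rewrite {1}inE cards2 => /andP[abn _].
  have {}abn : a != b by case: (a != b) abn.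
  have [s sy /andP[as_ bs]] := edge_ex abn ab.
  have /orP[sl|/andP[_ sl]] := liftset_lift ysub sy; apply: edge_in sl _ _ _ => //.
    by rewrite !inE au as_ orbT.
  by rewrite !inE bu bs orbT.
move=> a aU au aE; have [s sy /andP[as_ us]] := edge_ex au aE.
have av : a != v by apply: contraNneq (y_v _ sy) => <-.
have /orP[sl|/andP[_ sl]] := liftset_lift ysub sy; apply/orP; [left|right].
  exact: edge_in sl _ _ _.
by apply: edge_in sl _ _ _; rewrite // !inE ?eqxx // au as_ orbT.
Qed.

Section Restriction.
Variable R : {set V}.
Hypothesis (sR : saturated Z R).

Definition restr w t := w t && (t \subset R).

(** All or nothing: one facet of w inside R gives d common vertices of B and R, so B, and with it
    the whole chain, lies in R. *)
Lemma restr_rigid w B : (forall t, w t -> #|t| = d) -> cyclic w ->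
  (forall t, w t -> t \subset B) -> rigid f (edges Z) B -> cyclic (restr w).
Proof.
move=> wd cw wB rB r rd.
case: (classic (exists2 t, w t & t \subset R)) => [[t wt tR]|h]; last first.
  by apply: bdF => t; apply/negP=> /andP[wt tR]; apply: h; exists t.
have BR : B \subset R.
  apply: sR => //; rewrite -(wd t wt); apply/subset_leq_card.
  by rewrite subsetI wB.
rewrite -(cw r rd); apply: eq_bd => s; rewrite /restr andb_idr // => /wB/subset_trans; exact.
Qed.

(** Lifting is additive, so y may be split into minimal cycles; the lift of each has rigid support
    and [restr_rigid] applies to it. *)
Lemma liftset_restr (y : {set {set V}}) : 2 < d -> y \subset contracted -> cyc y ->
  (forall y' : {set {set V}}, y' \subset contracted -> min_cyc y' -> rigid f (edges y') (cover y')) ->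
  cyclic (restr (lift y)).
Proof.
move=> d3 + + IH; have [n] := ubnP #|y|; elim: n y => // n IHn y /ltnSE yn ysub cy.
case: (set_0Vmem y) => [y0|[s sy]].
  move=> r rd; apply: bdF => t; rewrite /restr negb_and /lift; apply/orP; left.
  have l0 t' : ~~ lift0 y t' by rewrite /lift0 y0 inE !andbF.
  by case: ifP => _; rewrite ?bdF.
have [y1 [my1 y1y sy1]] := min_cyc_ex cy sy.
have y1sub := subset_trans y1y ysub.
have cy1 : cyc y1 by case: my1.
have c1 : cyclic (restr (lift y1)).
  apply: (@restr_rigid _ (cover (liftset y1))).
  - by move=> t; apply: lift_size.
  - exact: lift_cyclic.
  - by move=> t tl; apply: bigcup_sup; rewrite inE.
  - by apply: liftset_rigid => //; apply: IH.
have c2 : cyclic (restr (lift (y :\: y1))).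
  apply: IHn.
  - rewrite (leq_trans _ yn) // proper_card // properEneq subsetDl andbT.
    by apply: contraTneq sy => <-; rewrite inE sy1.
  - exact: subset_trans (subsetDl _ _) ysub.
  - exact: cyc_setD.
have L0 t : lift0 y t = lift0 y1 t (+) lift0 (y :\: y1) t.
  rewrite /lift0; case: (t \in Z) => //; case: (apart t) => //=; rewrite inE.
  case: (boolP (contr t \in y1)) => [h|_]; last by [].
  by rewrite (subsetP y1y _ h).
move=> r rd; transitivity (bd (fun t => restr (lift y1) t (+) restr (lift (y :\: y1)) t) r).
  apply: eq_bd => t; rewrite /restr -andb_addl; congr (_ && _).
  rewrite /lift; case: ifP => _; first exact: L0.
  by rewrite -bdD; apply: eq_bd.
by rewrite bdD c1 // c2.
Qed.

Lemma simplex_bd B r : #|B| = d.+1 -> #|r|.+1 = d ->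
  bd (fun t => (t \subset B) && (#|t| == d)) r = false.
Proof.
move=> dB rd; rewrite /bd big_addb_card.
case: (boolP (r \subset B)) => rB.
  rewrite (_ : #|_| = #|B :\: r|); first by rewrite cardsD (setIidPr rB) dB -rd subSn // subSnn.
  apply: eq_card => x; rewrite !inE subUset sub1set rB andbT.
  case: (boolP (x \in r)) => //= xr.
  by rewrite cardsU1 xr add1n rd eqxx andbT.
rewrite (_ : #|_| = 0) //; apply: eq_card0 => x; rewrite !inE subUset (negPf rB).
by rewrite !andbF.
Qed.

Lemma simplex_rigid A : u \notin A -> v \notin A -> #|A|.+1 = d ->
  u |: A \in Z -> v |: A \in Z -> rigid f (edges Z) (u |: (v |: A)).
Proof.
move=> uA vA dA uAZ vAZ.
apply: generic_rigid_clique => //.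
  by rewrite !cardsU1 !inE negb_or uv uA vA -dA.
have sym x y : ([set x; y] \in edges Z) = ([set y; x] \in edges Z) by rewrite setUC.
move=> x y; rewrite !in_setU1.
move=> /or3P[/eqP->|/eqP->|xA] /or3P[/eqP->|/eqP->|yA]; rewrite ?eqxx // => xy.
- by apply: edge_in uAZ _ _ _; rewrite // !inE ?eqxx ?yA ?orbT.
- by rewrite sym.
- by apply: edge_in vAZ _ _ _; rewrite // !inE ?eqxx ?yA ?orbT.
- by apply: edge_in uAZ _ _ _; rewrite // !inE ?eqxx ?xA ?orbT.
- by apply: edge_in vAZ _ _ _; rewrite // !inE ?eqxx ?xA ?orbT.
- by apply: edge_in uAZ _ _ _; rewrite // !inE ?xA ?yA ?orbT.
Qed.

Definition cancelled A := [&& u \notin A, v \notin A, #|A|.+1 == d,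
  u |: A \in Z & v |: A \in Z].

(* What the lift of the whole contraction misses of Z is a sum of boundaries of
   d-simplices A + u + v, one for each pair of facets A + u, A + v of Z. *)
Lemma lift_remainder t :
  (t \in Z) = lift contracted t (+)
    \big[addb/false]_(A | cancelled A) ((t \subset u |: (v |: A)) && (#|t| == d)).
Proof.
have csub : contracted \subset contracted by [].
have cc := contracted_cyc.
pose S t := \big[addb/false]_(A | cancelled A) ((t \subset u |: (v |: A)) && (#|t| == d)).
rewrite -/(S t).
have Sd s : S s -> #|s| = d by case/big_addb_ex=> A _ /andP[_ /eqP].
have S1 A : u \notin A -> v \notin A -> #|A|.+1 = d ->
    forall x, x \in [set u; v] -> S (x |: A) = (u |: A \in Z) && (v |: A \in Z).
  move=> uA vA dA x xuv.
  have xA : x \notin A by move: xuv; rewrite !inE => /orP[]/eqP->.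
  have subA B : cancelled B -> x |: A \subset u |: (v |: B) -> B = A.
    move=> /and5P[uB vB /eqP dB _ _] /subsetP AB; apply/esym/eqP; rewrite eqEcard.
    rewrite -ltnS dA dB leqnn andbT; apply/subsetP=> z zA.
    have := AB z; rewrite !inE zA orbT => /(_ isT) /or3P[/eqP zu|/eqP zv|//].
      by rewrite zu (negPf uA) in zA.
    by rewrite zv (negPf vA) in zA.
  have cA : cancelled A = (u |: A \in Z) && (v |: A \in Z).
    by rewrite /cancelled uA vA dA eqxx.
  have dxA : #|x |: A| = d by rewrite cardsU1 xA.
  have sxA : x |: A \subset u |: (v |: A).
    by apply/subsetP=> z; move: xuv; rewrite !inE => /orP[]/eqP-> /orP[->|->]; rewrite ?orbT.
  rewrite -cA /S; case: (boolP (cancelled A)) => hA.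
    rewrite (bigD1 A) //= sxA dxA eqxx big1 // => B /andP[cB BA].
    by apply/negbTE; apply: contra BA => /andP[/(subA _ cB)->].
  rewrite big1 // => B cB; apply/negbTE; apply: contra hA => /andP[/(subA _ cB) <-] _.
  by [].
have eq_apart s : apart s -> (s \in Z) = lift contracted s (+) S s.
  move=> ap; rewrite {1}/lift ap.
  case: (boolP (#|s| == d)) => [/eqP ds|/eqP ds]; last first.
    have -> : s \in Z = false by apply/negP=> /Zd.
    have -> : S s = false by apply/negP=> /Sd.
    by rewrite addbF; apply/esym/negP=> /and3P[/Zd].
  case: (boolP (u \in s)) => us.
    have vs : v \notin s by move: ap; rewrite /apart us.
    pose A := s :\ u.
    have uA : u \notin A by rewrite !inE eqxx.
    have vA : v \notin A by rewrite !inE (negPf vs) andbF.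
    have sE : s = u |: A by rewrite setD1K.
    have dA : #|A|.+1 = d by rewrite -ds (cardsD1 u s) us.
    have -> : S s = (u |: A \in Z) && (v |: A \in Z).
      by rewrite {1}sE S1 // !inE eqxx.
    rewrite lift0_u // inE vs us -/A {3}sE.
    by rewrite -sE; case: (s \in Z); case: (_ \in Z).
  case: (boolP (v \in s)) => vs.
    pose A := s :\ v.
    have vA : v \notin A by rewrite !inE eqxx.
    have uA : u \notin A by rewrite !inE (negPf us) andbF.
    have sE : s = v |: A by rewrite setD1K.
    have dA : #|A|.+1 = d by rewrite -ds (cardsD1 v s) vs.
    have -> : S s = (u |: A \in Z) && (v |: A \in Z).
      by rewrite {1}sE S1 // !inE eqxx orbT.
    rewrite lift0_v // -/A inE in_setU1 [v == u]eq_sym (negPf uv) (negPf vA) setU11 /=.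
    by rewrite setU1K // -sE; case: (s \in Z); case: (_ \in Z).
  have -> : S s = false.
    apply/negP=> /big_addb_ex[A /and5P[uA vA /eqP dA _ _] /andP[/subsetP sA _]].
    have : s \subset A.
      apply/subsetP=> z zs; have := sA z zs; rewrite !inE => /or3P[/eqP zu|/eqP zv|//].
        by rewrite zu (negPf us) in zs.
      by rewrite zv (negPf vs) in zs.
    by move/subset_leq_card; rewrite ds -dA ltnn.
  by rewrite addbF lift0_none // inE vs (negPf us).
have cyc_all : cyclic (fun s => ((s \in Z) (+) lift contracted s) (+) S s).
  move=> r rd; rewrite 2!bdD.
  have -> : bd (fun s => s \in Z) r = false by apply: Zc.
  have -> : bd (lift contracted) r = false by apply: lift_cyclic.
  rewrite bd_sum big1 // => A /and5P[uA vA /eqP dA _ _]; apply: simplex_bd => //.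
  by rewrite !cardsU1 !inE negb_or uv uA vA -dA.
suff : ((t \in Z) (+) lift contracted t) (+) S t = false.
  by case: (t \in Z); case: (lift _ _); case: (S t).
case: (boolP (apart t)) => [/eq_apart->|ap].
  by case: (lift _ _); case: (S t).
move: (ap); rewrite negbK => /andP[ut vt].
case: (boolP (#|t| == d)) => [/eqP dt|/eqP dt]; last first.
  have -> : t \in Z = false by apply/negP=> /Zd.
  have -> : S t = false by apply/negP=> /Sd.
  by rewrite addbF; apply/negP=> /lift_size.
have rd : #|t :\ v|.+1 = d by rewrite -dt (cardsD1 v t) vt.
have := cyc_all _ rd; rewrite (bd1 _ (x := v)) ?inE ?eqxx // setD1K // big1 ?addbF //.
move=> x /andP[xt xv]; rewrite eq_apart; first by case: (lift _ _); case: (S _).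
by rewrite /apart !inE eqxx (eq_sym v) (negPf xv) andbF.
Qed.

(** Both parts of [lift_remainder] are sums of cycles with rigid support: lifts of minimal cycles,
    and boundaries of simplices all of whose edges belong to Z. *)
Lemma restr_cyclic : 2 < d ->
  (forall y : {set {set V}}, y \subset contracted -> min_cyc y -> rigid f (edges y) (cover y)) ->
  cyclic (fun t => (t \in Z) && (t \subset R)).
Proof.
move=> d3 IH r rd.
have c1 := liftset_restr d3 (subxx _) contracted_cyc IH.
transitivity (bd (fun t => restr (lift contracted) t (+) \big[addb/false]_(A | cancelled A)
    restr (fun s => (s \subset u |: (v |: A)) && (#|s| == d)) t) r).
  apply: eq_bd => t; rewrite lift_remainder /restr andb_addl; congr (_ (+) _).
  by rewrite big_distrl.
rewrite bdD c1 // bd_sum big1 // => A /and5P[uA vA /eqP dA uAZ vAZ].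
apply: (@restr_rigid _ (u |: (v |: A))) rd; last exact: simplex_rigid.
- by move=> t /andP[_ /eqP].
- move=> r' r'd; apply: simplex_bd => //.
  by rewrite !cardsU1 !inE negb_or uv uA vA -dA.
- by move=> t /andP[].
Qed.
End Restriction.
End Contraction.

(** Induction on the number of vertices: v is lost in the contraction. *)
Theorem min_cyc_rigid Z : 2 < d -> min_cyc Z -> rigid f (edges Z) (cover Z).
Proof.
move=> d3; have [n] := ubnP #|cover Z|; elim: n Z => // n IHn Z /ltnSE Zn mZ.
have [[Zd cZ] Z0 _] := mZ.
have [t tZ] := set0Pn _ Z0.
have td := Zd t tZ.
have /card_gt0P[u ut] : 0 < #|t| by lia.
have /card_gt0P[v] : 0 < #|t :\ u| by have := cardsD1 u t; rewrite ut; lia.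
rewrite !inE => /andP[vu vt].
have uv : u != v by rewrite eq_sym.
have uvZ : [set u; v] \in edges Z by apply: edge_in tZ _ _ _.
apply: saturated_min_rigid => // R sR.
apply: (restr_cyclic mZ uv uvZ sR d3) => y ysub my.
apply: IHn => //; apply: leq_trans Zn; apply: proper_card.
rewrite properE; apply/andP; split.
  apply/bigcupsP=> s /(subsetP ysub); rewrite inE => /andP[vs].
  have sub s' : s' \in Z -> s' \subset cover Z by move=> s'Z; apply: bigcup_sup.
  case: ifP => us; last exact: sub.
  case: (boolP (s \in Z)) => [/sub//|_ /= /sub/subsetP h].
  apply/subsetP=> x xs; case: (eqVneq x u) => [->|xu]; first exact: (subsetP (sub _ tZ)).
  by apply: h; rewrite !inE xu xs orbT.
apply/subsetPn; exists v; first by apply/bigcupP; exists t.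
by apply/bigcupP=> -[s /(subsetP ysub)]; rewrite inE => /andP[/negP].
Qed.
End Cycles.

(** * Spheres over Z/2Z *)

Local Open Scope ring_scope.

Lemma natr_F2 n : n%:R = (odd n)%:R :> 'F_2.
Proof. by rewrite -modn2 Fp_nat_mod. Qed.

Lemma natr_F2_eq0 n : (n%:R == 0 :> 'F_2) = ~~ odd n.
Proof. by rewrite natr_F2; case: (odd n); rewrite ?oner_eq0 ?eqxx. Qed.

Section Complex.
Variables (V : finType) (X : {set {set V}}).

(** Indexed by the number of vertices instead of the dimension, so that the empty face has index 0;
    [brank] follows the same convention. *)
Definition skel k : {set {set V}} := [set s in X | #|s| == k].

Lemma facesE k : faces X (k%:Z - 1) = skel k.
Proof. by apply/setP=> s; rewrite !inE /fdim (inj_eq (addIr _)) eqz_nat. Qed.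

Hypothesis down : forall s t : {set V}, s \in X -> t \subset s -> t \in X.

Lemma card_between (Y : {set {set V}}) (c : {set V}) n :
  (forall s, s \in Y -> #|s| = n.+1) -> #|c| = n ->
  #|[set b in Y | c \subset b]| = #|[set x | (x \notin c) && (x |: c \in Y)]|.
Proof.
move=> Yn cn; rewrite -(card_in_imset (f := fun x => x |: c)) => [|x y]; last first.
  rewrite !inE => /andP[xc _] /andP[yc _] /setP/(_ x).
  by rewrite !inE eqxx (negPf xc) /= orbF => /esym/eqP.
apply: eq_card => b; rewrite inE; apply/andP/imsetP => [[bY cb]|[x]].
  have /cards1P[x bx] : #|b :\: c| == 1%N.
    by rewrite cardsD (setIidPr cb) cn (Yn b bY) subSnn.
  have xbc : x \in b :\: c by rewrite bx !inE.
  have bE : b = x |: c.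
    rewrite -bx; apply/setP=> z; rewrite !inE.
    by case: (boolP (z \in c)) => [/(subsetP cb)->|]; rewrite ?orbF.
  exists x => //; rewrite inE -bE bY andbT.
  by move: xbc; rewrite inE => /andP[].
by rewrite inE => /andP[_ xY] ->; split=> //; apply: subsetUr.
Qed.

Lemma incidenceE i j (v : {set V} -> 'F_2) c :
  ((\row_(a < #|faces X i|) v (enum_val a)) *m incidence X i j) 0 c =
  \sum_(a in faces X i | enum_val c \subset a) v a.
Proof.
rewrite mxE big_mkcondr /= [RHS]big_enum_val /=; apply: eq_bigr => a _.
by rewrite !mxE; case: (_ \subset _); rewrite ?mulr1 ?mulr0.
Qed.

Lemma incidence_sq i : incidence X (i + 1) i *m incidence X i (i - 1) = 0.
Proof.
apply/matrixP=> a c; rewrite [RHS]mxE mxE.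
transitivity (\sum_(b in faces X i | enum_val c \subset b)
    ((b \subset (enum_val a : {set V}))%:R : 'F_2)).
  rewrite big_mkcondr /= [RHS]big_enum_val /=; apply: eq_bigr => b _.
  by rewrite !mxE; case: (_ \subset enum_val b); rewrite ?mulr1 ?mulr0.
have := enum_valP a; have := enum_valP c.
set A : {set V} := enum_val a; set C : {set V} := enum_val c.
rewrite !inE /fdim => /andP[CX /eqP Ci] /andP[AX /eqP Ai].
pose Y := [set b in X | (b \subset A) && (#|b| == #|C|.+1)].
have YE : \sum_(b in faces X i | C \subset b) ((b \subset A)%:R : 'F_2) =
    #|[set b in Y | C \subset b]|%:R.
  rewrite -natr_sum; congr (_%:R).
  rewrite -sum1_card big_mkcond [RHS]big_mkcond /=; apply: eq_bigr => b _.
  rewrite !inE /fdim (_ : (#|b|%:Z - 1 == i) = (#|b| == #|C|.+1)); last by lia.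
  by case: (b \in X); case: (b \subset A); case: (_ == _); case: (C \subset b).
rewrite YE (card_between (n := #|C|)) //; last first.
  by move=> s; rewrite inE => /and3P[_ _ /eqP].
apply/eqP; rewrite natr_F2_eq0.
case: (boolP (C \subset A)) => CA.
  rewrite (_ : [set x | _ & _] = A :\: C).
    rewrite cardsD (setIidPr CA) (_ : (#|A| - #|C|)%N = 2%N) //; lia.
  apply/setP=> x; rewrite !inE; case: (boolP (x \in C)) => //= xC.
  rewrite subUset sub1set CA cardsU1 xC add1n eqxx !andbT.
  case: (boolP (x \in A)) => xA; rewrite ?andbF // andbT.
  by apply: (down AX); rewrite subUset sub1set xA.
rewrite (_ : [set x | _ & _] = set0) ?cards0 //.
by apply/setP=> x; rewrite !inE subUset (negPf CA) !andbF.
Qed.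

Definition brank k := \rank (incidence X (k%:Z - 1) (k%:Z - 1 - 1)).

Lemma rank_boundaries k : \rank (boundaries X (k%:Z - 1)) = brank k.+1.
Proof.
rewrite /boundaries /brank.
have -> : k%:Z - 1 + 1 = k.+1%:Z - 1 by lia.
by congr (\rank (incidence _ _ _)); lia.
Qed.

Lemma skel_betti k : #|skel k| = (brank k + brank k.+1 + betti X (k%:Z - 1))%N.
Proof.
have sub : (\rank (boundaries X (k%:Z - 1)) <= \rank (cycles X (k%:Z - 1)))%N.
  by apply: mxrankS; apply/sub_kermxP; apply: incidence_sq.
rewrite /betti; move: sub; rewrite rank_boundaries /cycles mxrank_ker -/(brank k).
have := rank_leq_row (incidence X (k%:Z - 1) (k%:Z - 1 - 1)); rewrite -/(brank k).
rewrite facesE; move: #|_| (brank _) (brank _); lia.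
Qed.

Lemma brank_eq0 k : skel k = set0 -> brank k = 0%N.
Proof.
move=> sk0; have := rank_leq_row (incidence X (k%:Z - 1) (k%:Z - 1 - 1)).
by rewrite -/(brank k) facesE sk0 cards0 leqn0 => /eqP.
Qed.

Lemma brank0 : brank 0 = 0%N.
Proof.
have := rank_leq_col (incidence X (0%:Z - 1) (0%:Z - 1 - 1)); rewrite -/(brank 0).
suff -> : faces X (0%:Z - 1 - 1) = set0 by rewrite cards0 leqn0 => /eqP.
by apply/setP=> s; rewrite !inE /fdim; apply/negbTE; rewrite negb_and; apply/orP; right; lia.
Qed.

Variable N : nat.
Hypothesis XN : forall s, s \in X -> (#|s| <= N)%N.
Hypothesis sph : sphere_homology X (N%:Z - 1).

Lemma skelN1 : skel N.+1 = set0.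
Proof.
by apply/setP=> s; rewrite !inE; apply/negP=> /andP[/XN h /eqP sN]; rewrite sN ltnn in h.
Qed.

Lemma skel_rank k : #|skel k| = (brank k + brank k.+1 + (k == N))%N.
Proof. by rewrite skel_betti sph (inj_eq (addIr _)) eqz_nat. Qed.

(** By rank-nullity each face number is a sum of two consecutive boundary ranks, plus 1 in the top
    degree, so the alternating sum telescopes. *)
Lemma euler_sphere : \sum_(k < N.+1) (-1) ^+ k * #|skel k|%:Z = (-1) ^+ N.
Proof.
have tele n : \sum_(k < n) (-1) ^+ k * (brank k + brank k.+1)%N%:Z =
    - ((-1) ^+ n * (brank n)%:Z) :> int.
  elim: n => [|n IHn]; first by rewrite big_ord0 brank0 mulr0 oppr0.
  by rewrite big_ord_recr /= IHn PoszD exprS; ring.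
rewrite big_ord_recr /= skel_rank eqxx (brank_eq0 skelN1).
rewrite (eq_bigr (fun k : 'I_N => (-1) ^+ k * (brank k + brank k.+1)%N%:Z)).
  by rewrite addn0 /= tele PoszD; ring.
by move=> k _; rewrite skel_rank (ltn_eqF (ltn_ord k)) addn0.
Qed.

(** There are no boundaries in the top degree, so the cycle space is the homology, of dimension 1;
    over Z/2Z it has a single nonzero vector. *)
Lemma skel_top_unique (Y Y' : {set {set V}}) : (0 < N)%N ->
  Y \subset skel N -> cyclic N (fun s => s \in Y) -> Y != set0 ->
  Y' \subset skel N -> cyclic N (fun s => s \in Y') -> Y' != set0 -> Y = Y'.
Proof.
move=> N0 Ysub Ycyc Y0 Y'sub Y'cyc Y'0.
pose i := N%:Z - 1.
pose v (W : {set {set V}}) := \row_(a < #|faces X i|) ((enum_val a \in W)%:R : 'F_2).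
have ker (W : {set {set V}}) : W \subset skel N -> cyclic N (fun s => s \in W) -> (v W <= kermx (incidence X i (i - 1)))%MS.
  move=> Wsub Wcyc; apply/sub_kermxP/rowP => c; rewrite [RHS]mxE.
  transitivity (\sum_(a in faces X i | (enum_val c : {set V}) \subset a) ((a \in W)%:R : 'F_2)).
    exact: (incidenceE i (fun a => (a \in W)%:R)).
  rewrite -natr_sum.
  have := enum_valP c; set C : {set V} := enum_val c.
  rewrite inE /fdim => /andP[CX /eqP Ci].
  have NC : N = #|C|.+1 by rewrite /i in Ci; lia.
  apply/eqP; rewrite natr_F2_eq0.
  rewrite (_ : \sum_(_ in _ | _) _ = #|[set b in W | C \subset b]|)%N; last first.
    rewrite -sum1_card big_mkcond [RHS]big_mkcond /=; apply: eq_bigr => b _.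
    rewrite facesE; case: (boolP (b \in W)) => bW.
      by rewrite (subsetP Wsub _ bW) inE bW; case: (C \subset b).
    by rewrite [b \in [set _ in W | _]]inE (negPf bW); case: ifP.
  rewrite (card_between (n := #|C|)) //; last first.
    by move=> s /(subsetP Wsub); rewrite inE NC => /andP[_ /eqP].
  have := Wcyc C (esym NC); rewrite /bd big_addb_card => /negbT.
  by congr (~~ odd _); apply: eq_card => x; rewrite !inE.
have vinj (W W' : {set {set V}}) : W \subset skel N -> W' \subset skel N -> v W = v W' -> W = W'.
  move=> Wsub W'sub /rowP h; apply/setP=> s.
  case: (boolP (s \in skel N)) => [|sN]; last first.
    by rewrite !(negPf (contra (subsetP _ _) sN)).
  rewrite -facesE => sF; have := h (enum_rank_in sF s).
  by rewrite !mxE enum_rankK_in //; do 2!case: (s \in _).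
have v0 (W : {set {set V}}) : W \subset skel N -> W != set0 -> v W != 0.
  move=> Wsub; apply: contraNneq => W0; apply/eqP/vinj; rewrite ?sub0set //.
  by rewrite W0; apply/rowP=> a; rewrite !mxE inE.
have rk1 : \rank (kermx (incidence X i (i - 1))) = 1%N.
  rewrite mxrank_ker -/(brank N) facesE skel_rank eqxx (brank_eq0 skelN1).
  by rewrite addn0 addnC addnK.
have rv : \rank (v Y) = 1%N by rewrite rank_rV v0.
have kv : (kermx (incidence X i (i - 1)) <= v Y)%MS.
  by rewrite -(geq_leqif (mxrank_leqif_sup (ker Y Ysub Ycyc))) rk1 rv.
have /submxP[a aE] := submx_trans (ker Y' Y'sub Y'cyc) kv.
apply: vinj => //.
have aE' : v Y' = a 0 0 *: v Y by rewrite aE {1}[a]mx11_scalar mul_scalar_mx.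
have : a 0 0 != 0.
  by apply: contraNneq (v0 _ Y'sub Y'0) => a0; rewrite aE' a0 scale0r.
rewrite aE' -[a 0 0]natr_Zp natr_F2; case: (odd _); last by rewrite eqxx.
by rewrite scale1r.
Qed.
End Complex.

(** * Face counts in links *)

Local Close Scope ring_scope.

Section FaceCounts.
Variables (V : finType) (D : {set {set V}}).
Implicit Types (s t F : {set V}) (x y : V).

(** The vertices of the link of t. Likewise [up t k] stands for the faces of the link with k
    vertices, kept as faces of D so that no complements need to be taken. *)
Definition nb t := [set x | (x \notin t) && (x |: t \in D)].
Definition up t k := [set F in D | (t \subset F) && (#|F| == #|t| + k)].

Hypothesis down : forall s t, s \in D -> t \subset s -> t \in D.

Lemma in_link s t : (s \in link D t) = (s :|: t \in D) && [disjoint s & t].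
Proof.
rewrite inE -setI_eq0 andb_idl // => /andP[stD _].
by apply: down stD (subsetUl _ _).
Qed.

Lemma link_down t s s' : s \in link D t -> s' \subset s -> s' \in link D t.
Proof.
rewrite !in_link => /andP[stD st] ss'; apply/andP; split.
  exact: down stD (setSU _ ss').
exact: disjointWl st.
Qed.

Lemma skel_link t k : skel (link D t) k = [set F :\: t | F in up t k].
Proof.
apply/setP=> s; apply/idP/imsetP => [|[F]].
  rewrite inE in_link => /andP[/andP[sD st] /eqP sk].
  have sE : (s :|: t) :\: t = s by rewrite setDUl setDv setU0; apply/setDidPl.
  exists (s :|: t); last by rewrite sE.
  rewrite inE sD subsetUr /= -sk cardsU (_ : s :&: t = set0); last first.
    by apply/eqP; rewrite setI_eq0.
  by rewrite cards0 subn0 addnC.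
rewrite inE => /and3P[FD tF /eqP Fk] ->.
rewrite inE in_link cardsD (setIidPr tF) Fk addKn eqxx andbT.
rewrite setUC -{1}(setIidPr tF) setID FD /=.
by rewrite disjoints_subset setDE subsetIr.
Qed.

Lemma card_skel_link t k : #|skel (link D t) k| = #|up t k|.
Proof.
rewrite skel_link card_in_imset // => F F'; rewrite !inE => /and3P[_ tF _] /and3P[_ tF' _] e.
by rewrite -(setID F t) -(setID F' t) (setIidPr tF) (setIidPr tF') e.
Qed.

Lemma up0 t : t \in D -> #|up t 0| = 1.
Proof.
move=> tD; rewrite (_ : up t 0 = [set t]) ?cards1 //.
apply/setP=> F; rewrite !inE addn0; apply/and3P/eqP => [[_ tF /eqP Ft]|->].
  by apply/esym/eqP; rewrite eqEcard tF Ft leqnn.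
by rewrite subxx tD eqxx.
Qed.

Lemma double_count t k : \sum_(x in nb t) #|up (x |: t) k| = k.+1 * #|up t k.+1|.
Proof.
transitivity (\sum_(F in up t k.+1) \sum_(x in F :\: t) 1); last first.
  rewrite (eq_bigr (fun=> k.+1)) ?sum_nat_const 1?mulnC // => F.
  rewrite inE sum1_card => /and3P[_ tF /eqP Fk].
  by rewrite cardsD (setIidPr tF) Fk addKn.
rewrite (exchange_big_dep predT) //= big_mkcond; apply: eq_bigr => x _.
rewrite sum1_card; case: ifP => xt.
  move: xt; rewrite inE => /andP[xt xtD].
  apply: eq_card => F; rewrite inE [RHS]unfold_in /= !inE xt.
  rewrite subUset sub1set cardsU1 xt add1n addSnnS.
  by case: (F \in D); case: (x \in F); case: (t \subset F); case: (_ == _).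
apply/esym/eq_card0 => F; rewrite [LHS]unfold_in /= !inE; apply/negP.
move=> /and3P[/and3P[FD tF _] xNt xF]; move: xt; rewrite inE xNt /=.
by rewrite (down FD) // subUset sub1set xF.
Qed.

Lemma up1 t : t \in D -> #|up t 1| = #|nb t|.
Proof.
move=> tD; rewrite -[LHS]mul1n -double_count -sum1_card; apply: eq_bigr => x.
by rewrite inE => /andP[_]; apply: up0.
Qed.
End FaceCounts.

(** * Euler relations, ridges and connectedness in a homology 4-sphere *)

Section Sphere.
Variables (V : finType) (D : {set {set V}}).
Implicit Types (s t F : {set V}) (x y : V).
Hypothesis hD : sphere_class 2 4 D.

Let sph : homology_sphere D 4. Proof. by case: hD. Qed.

Lemma face_sub s t : s \in D -> t \subset s -> t \in D.
Proof. by have [[_ h _] _ _] := sph; apply: h. Qed.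

Lemma face1 x : [set x] \in D.
Proof. by have [[_ _ h] _ _] := sph; apply: h. Qed.

Lemma face0 : set0 \in D.
Proof.
have [[/set0Pn[s sD] _ _] _ _] := sph.
by apply: face_sub sD (sub0set _).
Qed.

Lemma face_facet s : s \in D -> exists F, [/\ F \in D, #|F| = 5 & s \subset F].
Proof.
move=> sD; have [_ pure _] := sph.
have [F mF sF] := maxset_exists (P := [pred t | t \in D]) sD.
exists F; split=> //; first by have := maxsetp mF.
by have := pure F mF; rewrite /fdim; lia.
Qed.

Lemma face_card s : s \in D -> #|s| <= 5.
Proof. by case/face_facet=> F [_ <- /subset_leq_card]. Qed.

(** The form in which the bound on missing faces enters: otherwise t would be a missing face of
    dimension at least 3. *)
Lemma face_intro t : 4 <= #|t| -> (forall x, x \in t -> t :\ x \in D) -> t \in D.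
Proof.
move=> t4 tx; apply/negPn/negP => tD.
have [_ miss] := hD; have : missing_face D t.
  split=> // s /properP[st [x xt xs]]; apply: face_sub (tx x xt) _.
  by rewrite subsetD1 st.
by move=> /miss; rewrite /fdim; lia.
Qed.

Lemma link_sphere t N : t \in D -> #|t| + N = 5 ->
  sphere_homology (link D t) (N%:Z - 1)%R.
Proof.
move=> tD tN; have [_ _ /(_ t tD)] := sph.
by rewrite (_ : (4 - #|t|%:Z = N%:Z - 1)%R) //; lia.
Qed.

Lemma link_card t N s : #|t| + N = 5 -> s \in link D t -> #|s| <= N.
Proof.
move=> tN; rewrite (in_link face_sub) => /andP[/face_card st5].
rewrite -setI_eq0 => /eqP st0; move: st5; rewrite cardsU st0 cards0; lia.
Qed.

Lemma euler_link t N : t \in D -> #|t| + N = 5 ->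
  (\sum_(k < N.+1) (-1) ^+ k * #|up D t k|%:Z = (-1) ^+ N)%R.
Proof.
move=> tD tN; rewrite -(euler_sphere (link_down face_sub (t := t)) (@link_card t N ^~ tN) (link_sphere tD tN)).
by apply: eq_bigr => k _; rewrite card_skel_link //; apply: face_sub.
Qed.

Lemma ridge_nb t : t \in D -> #|t| = 4 -> #|nb D t| = 2.
Proof.
move=> tD t4; have := euler_link (N := 1) tD; rewrite t4 => /(_ (erefl _)).
by rewrite !big_ord_recl big_ord0 /= /bump /= !(add1n, addn0, exprS, expr0) up0 ?up1 //; try exact: face_sub; lia.
Qed.

Lemma euler3 t : t \in D -> #|t| = 3 -> #|up D t 2| = #|nb D t|.
Proof.
move=> tD t4; have := euler_link (N := 2) tD; rewrite t4 => /(_ (erefl _)).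
by rewrite !big_ord_recl big_ord0 /= /bump /= !(add1n, addn0, exprS, expr0) up0 ?up1 //; try exact: face_sub; lia.
Qed.

Lemma euler2 t : t \in D -> #|t| = 2 ->
  3 * #|up D t 3| = 2 * #|up D t 2| /\ #|up D t 2| + 6 = 3 * #|nb D t|.
Proof.
move=> tD t2.
have e : 3 * #|up D t 3| = 2 * #|up D t 2|.
  rewrite -!double_count; try exact: face_sub.
  apply: eq_bigr => x; rewrite inE => /andP[xt xtD].
  by rewrite euler3 ?up1 //; [exact: face_sub | rewrite cardsU1 xt t2].
split=> //; have := euler_link (N := 3) tD; rewrite t2 => /(_ (erefl _)).
rewrite !big_ord_recl big_ord0 /= /bump /= !(add1n, addn0, exprS, expr0) up0 ?up1 //; try exact: face_sub.
by rewrite !(mulN1r, mulNr, mul1r, opprK); move: #|up D t 2| #|up D t 3| e => a b e; lia.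
Qed.

Lemma facet_ridge F x : F \in D -> #|F| = 5 -> x \in F ->
  exists y, [/\ y != x, y \notin F & nb D (F :\ x) = [set x; y]].
Proof.
move=> FD F5 xF; have rD : F :\ x \in D by apply: face_sub FD (subsetDl _ _).
have r4 : #|F :\ x| = 4 by have := cardsD1 x F; rewrite xF F5; lia.
have /eqP := ridge_nb rD r4; have xr : x \in nb D (F :\ x).
  by rewrite !inE eqxx /= setD1K.
rewrite (cardsD1 x) xr => /cards1P[y ry].
have /setP/(_ y) := ry; rewrite !inE eqxx => /andP[yx /andP[yF _]].
exists y; split=> //; first by move: yF; rewrite yx.
by rewrite -(setD1K xr) ry.
Qed.

(** A ridge lies in exactly two facets, so a family closed under crossing ridges contains both of
    them or neither. *)
Lemma link_top_cyclic t N : t \in D -> #|t| + N = 5 -> 0 < N ->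
  forall Y : {set {set V}}, Y \subset skel (link D t) N ->
  (forall s x, s \in Y -> x \in s -> exists y, [/\ y != x, y \notin s & y |: (s :\ x) \in Y]) ->
  cyclic N (fun s => s \in Y).
Proof.
move=> tD tN N0 Y Ysub Yadj r rN; rewrite /bd big_addb_card.
case: (set_0Vmem [set x | (x \notin r) && (x |: r \in Y)]) => [e0|[x]].
  rewrite eq_card0 // => x; have := in_set0 x.
  by rewrite -e0 inE => h; rewrite !unfold_in.
rewrite inE => /andP[xr xrY].
have [y [yx]] := Yadj _ x xrY (setU11 _ _); rewrite setU1K // !inE negb_or => /andP[_ yr] yrY.
have rtD : r :|: t \in D.
  have := subsetP Ysub _ xrY; rewrite inE (in_link face_sub) => /andP[/andP[h _] _].
  by apply: face_sub h _; rewrite setSU // subsetUr.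
have dis : [disjoint r & t].
  have := subsetP Ysub _ xrY; rewrite inE (in_link face_sub) => /andP[/andP[_ h] _].
  by apply: disjointWl h; apply: subsetUr.
have rt4 : #|r :|: t| = 4.
  by rewrite cardsU (_ : r :&: t = set0) ?cards0; [lia | apply/eqP; rewrite setI_eq0].
have inN z : z \notin r -> z |: r \in Y -> z \in nb D (r :|: t).
  move=> zr zrY; have := subsetP Ysub _ zrY; rewrite inE (in_link face_sub) => /andP[/andP[h1 h2] _].
  rewrite !inE setUA h1 andbT negb_or zr /=.
  by rewrite (disjointFr h2) // setU11.
suff -> : #|[pred z | (z \notin r) && (z |: r \in Y)]| = 2 by [].
apply/eqP; rewrite eqn_leq; apply/andP; split.
  rewrite -(ridge_nb rtD rt4); apply/subset_leq_card/subsetP => z.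
  by rewrite inE => /andP[]; apply: inN.
rewrite (_ : 2 = #|[set x; y]|); last by rewrite cards2 eq_sym yx.
apply/subset_leq_card/subsetP => z; rewrite !inE => /orP[]/eqP->.
  by rewrite xr.
by rewrite yr.
Qed.

Lemma skel_link_adj t N s x : #|t| + N = 5 ->
  s \in skel (link D t) N -> x \in s ->
  exists y, [/\ y != x, y \notin s & y |: (s :\ x) \in skel (link D t) N].
Proof.
move=> tN; rewrite inE (in_link face_sub) => /andP[/andP[stD dis] /eqP sN] xs.
have st5 : #|s :|: t| = 5.
  by rewrite cardsU (_ : s :&: t = set0) ?cards0; [lia | apply/eqP; rewrite setI_eq0].
have xst : x \in s :|: t by rewrite inE xs.
have [y [yx yst nbE]] := facet_ridge stD st5 xst.
move: (yst); rewrite inE negb_or => /andP[ys yt].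
exists y; split=> //; rewrite inE (in_link face_sub).
have xt : x \notin t by rewrite (disjointFr dis).
have yx' : y \notin s :\ x by rewrite inE (negPf ys) andbF.
have -> : #|y |: (s :\ x)| = N by rewrite cardsU1 yx' -sN (cardsD1 x s) xs.
have : y \in nb D ((s :|: t) :\ x) by rewrite nbE !inE eqxx orbT.
rewrite inE => /andP[_]; rewrite setDUl (_ : t :\ x = t); last first.
  by apply/setDidPl; rewrite disjoint_sym disjoints1.
rewrite eqxx andbT setUA => -> /=.
rewrite disjoint_sym disjoints_subset; apply/subsetP=> z zt; rewrite !inE negb_or.
rewrite (contraTneq _ zt) => [|->//]; rewrite negb_and orbC (contraTN _ zt) // => zs.
by rewrite (disjointFr dis).
Qed.

Lemma link_min_cyc t N : t \in D -> #|t| + N = 5 -> 0 < N ->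
  min_cyc N (skel (link D t) N).
Proof.
move=> tD tN N0; have cS : cyclic N (fun s => s \in skel (link D t) N).
  by apply: (link_top_cyclic tD tN N0) => // s x; apply: skel_link_adj.
split.
- by split=> // s; rewrite inE => /andP[_ /eqP].
- have [F [FD F5 tF]] := face_facet tD.
  apply/set0Pn; exists (F :\: t); rewrite (skel_link face_sub); apply/imsetP; exists F => //.
  by rewrite inE FD tF F5 tN /=.
move=> Y Ysub [_ Yc] Y0.
apply: (skel_top_unique (link_down face_sub (t := t)) (@link_card t N ^~ tN) (link_sphere tD tN)) => //.
apply/set0Pn; have [s sY] := set0Pn _ Y0; exists s; exact: (subsetP Ysub).
Qed.

(** Strong connectedness drawn from homology: the family is a nonzero top cycle of the link of t,
    and that cycle is unique. It serves to spread a local property to all facets through t. *)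
Lemma facets_connected t (G : {set {set V}}) : t \in D -> #|t| < 5 -> G != set0 ->
  (forall F, F \in G -> [/\ F \in D, #|F| = 5 & t \subset F]) ->
  (forall F x, F \in G -> x \in F -> x \notin t ->
     exists y, [/\ y != x, y \notin F & y |: (F :\ x) \in G]) ->
  forall F, F \in D -> #|F| = 5 -> t \subset F -> F \in G.
Proof.
move=> tD t5 G0 Gf Gadj F FD F5 tF.
have tN : #|t| + (5 - #|t|) = 5 by rewrite subnKC // ltnW.
have N0 : 0 < 5 - #|t| by rewrite subn_gt0.
set N := 5 - #|t| in tN N0.
pose Y := [set F' :\: t | F' in G].
have Ysub : Y \subset skel (link D t) N.
  apply/subsetP=> s /imsetP[F' F'G ->]; rewrite (skel_link face_sub).
  apply: imset_f; have [F'D F'5 tF'] := Gf _ F'G.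
  by rewrite inE F'D tF' F'5 tN /=.
have Yadj s x : s \in Y -> x \in s -> exists y, [/\ y != x, y \notin s & y |: (s :\ x) \in Y].
  move=> /imsetP[F' F'G ->]; rewrite inE => /andP[xt xF'].
  have [y [yx yF' yG]] := Gadj _ _ F'G xF' xt.
  have [_ _ tF'] := Gf _ F'G.
  exists y; split=> //; first by rewrite inE (negPf yF') andbF.
  apply/imsetP; exists (y |: (F' :\ x)) => //; apply/setP=> z; rewrite !inE.
  case: (eqVneq z y) => [->|_] /=; last by rewrite andbCA.
  by rewrite (contra (subsetP tF' y) yF').
have [_ _ h] := link_min_cyc tD tN N0.
have YE : Y = skel (link D t) N.
  apply: h => //.
    by split=> [s /(subsetP Ysub)|]; [rewrite inE => /andP[_ /eqP] | apply: link_top_cyclic Ysub Yadj].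
  by have [F' F'G] := set0Pn _ G0; apply/set0Pn; exists (F' :\: t); apply: imset_f.
have : F :\: t \in Y.
  rewrite YE (skel_link face_sub); apply: imset_f.
  by rewrite inE FD tF F5 tN /=.
move=> /imsetP[F' F'G e]; have [_ _ tF'] := Gf _ F'G.
by rewrite -(setID F t) (setIidPr tF) e -{1}(setIidPr tF') setID.
Qed.

End Sphere.

(** * Links of vertices *)

Ltac case_eqs :=
  repeat match goal with
  | |- context [?z == ?a] => case: (z == a) => //=
  end.
Ltac subset_tac :=
  let z := fresh in apply/subsetP=> z; rewrite !inE; case_eqs; rewrite ?orbT ?andbT.
Ltac seteq_tac :=
  let z := fresh in apply/setP=> z; rewrite !inE; case_eqs; rewrite ?orbT ?andbT ?orbF.

Section LinkGraph.
Variables (V : finType) (D : {set {set V}}).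
Implicit Types (s t F e : {set V}) (x y a b c : V).
Hypothesis hD : sphere_class 2 4 D.

Let sub s t : s \in D -> t \subset s -> t \in D. Proof. exact: face_sub. Qed.

Lemma card_gt5 : 5 < #|V|.
Proof.
have [F [FD F5 _]] := face_facet hD (face0 hD).
have /card_gt0P[x xF] : 0 < #|F| by rewrite F5.
have [y [_ yF _]] := facet_ridge hD FD F5 xF.
by rewrite -F5 proper_card // properE subset_predT /=; apply/subsetPn; exists y.
Qed.

Lemma skel2P t e : reflect (exists x y, [/\ e = [set x; y], x != y, x \notin t, y \notin t &
   x |: (y |: t) \in D]) (e \in skel (link D t) 2).
Proof.
apply: (iffP idP) => [|[x [y [-> xy xt yt h]]]].
  rewrite inE (in_link sub) => /andP[/andP[eD dis] /cards2P[x [y [xy eE]]]].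
  exists x, y; split=> //; rewrite ?eE.
  - by rewrite (disjointFr dis) // eE !inE eqxx.
  - by rewrite (disjointFr dis) // eE !inE eqxx orbT.
  - by rewrite setUA -eE.
rewrite inE (in_link sub) -setUA h cards2 xy eqxx andbT /=.
rewrite disjoint_sym disjoints_subset; apply/subsetP=> z zt; rewrite !inE negb_or.
by rewrite (contraTneq _ zt) ?(contraTneq _ zt) // => ->.
Qed.

Lemma link_edges t N : #|t| + N = 5 -> 1 < N ->
  edges (skel (link D t) N) = skel (link D t) 2.
Proof.
move=> tN N1; apply/setP=> e; apply/idP/idP.
  rewrite inE => /andP[e2 /existsP[s /andP[]]].
  rewrite !inE e2 andbT -!(in_set (fun e => (e \in D) && _)) => /andP[sL _] es.
  exact: (link_down sub) sL es.
move=> eS; have := eS; rewrite inE (in_link sub) => /andP[/andP[eD dis] e2].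
have [F [FD F5 eF]] := face_facet hD eD.
rewrite inE e2; apply/existsP; exists (F :\: t); rewrite (skel_link sub).
move: eF; rewrite subUset => /andP[eF tF]; rewrite subsetD eF dis !andbT.
by apply: imset_f; rewrite inE FD tF F5 tN /=.
Qed.

Lemma link_cover t N : #|t| + N = 5 -> 0 < N -> cover (skel (link D t) N) = nb D t.
Proof.
move=> tN N0; apply/setP=> x; apply/bigcupP/idP => [[s]|].
  rewrite inE (in_link sub) inE => /andP[/andP[sD dis] _] xs.
  rewrite (disjointFr dis) //=; apply: sub sD _.
  by rewrite subUset sub1set inE xs subsetUr.
rewrite inE => /andP[xt xtD]; have [F [FD F5]] := face_facet hD xtD.
rewrite subUset sub1set => /andP[xF tF].
exists (F :\: t); last by rewrite inE xt.
by rewrite (skel_link sub); apply: imset_f; rewrite inE FD tF F5 tN /=.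
Qed.

Lemma link_rigid t N (f : V -> 'rV[rat]_N) : t \in D -> #|t| + N = 5 -> 2 < N ->
  generic f -> rigid f (skel (link D t) 2) (nb D t) /\ inside (skel (link D t) 2) (nb D t).
Proof.
move=> tD tN N2 gf; rewrite -(link_edges tN (ltnW N2)) -(link_cover tN (ltnW (ltnW N2))).
split; last exact: edges_inside.
apply: min_cyc_rigid => //; last by apply: link_min_cyc => //; apply: ltnW (ltnW _).
by have := card_gt5; lia.
Qed.

Lemma nb_gt t N : t \in D -> #|t| + N = 5 -> 0 < N -> N < #|nb D t|.
Proof.
move=> tD tN N0; have [F [FD F5 tF]] := face_facet hD tD.
have FtN : #|F :\: t| = N by rewrite cardsD (setIidPr tF) F5; lia.
have /card_gt0P[x] : 0 < #|F :\: t| by rewrite FtN.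
rewrite inE => /andP[xt xF]; have [y [yx yF nbE]] := facet_ridge hD FD F5 xF.
have ynb : y \in nb D (F :\ x) by rewrite nbE !inE eqxx orbT.
rewrite -FtN proper_card // properE; apply/andP; split.
  apply/subsetP=> z; rewrite !inE => /andP[zt zF]; rewrite zt /=.
  by apply: sub FD _; rewrite subUset sub1set zF.
apply/subsetPn; exists y; last by rewrite inE (negPf yF) andbF.
move: ynb; rewrite !inE => /andP[_ yD]; rewrite (contra (subsetP tF y) yF) /=.
apply: sub yD _; apply: setUS; apply/subsetP=> z zt; rewrite !inE (subsetP tF) // andbT.
by apply: contraTneq zt => ->.
Qed.

Variable v : V.
Local Notation n := #|nb D [set v]|.
Local Notation m := #|up D [set v] 2|.

Lemma link_graph_count (E' : {set {set V}}) (U' : {set V}) : E' \subset skel (link D [set v]) 2 -> inside E' U' ->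
  4 <= #|U'| -> n * 4 + #|E'| <= m + #|U'| * 4.
Proof.
move=> E'E E'U U4; have [f gf] := generic_exists V 4.
have vN : #|[set v]| + 4 = 5 by rewrite cards1.
have [rg ins] := link_rigid (face1 hD v) vN (isT : 2 < 4) gf.
rewrite -(card_skel_link sub); apply: rigid_count_sub ins rg E'E E'U _.
by apply: generic_spanning => //; have := card_gt5; lia.
Qed.

(** The closed star of a in the link of v: since e may contain a, the edges through a are
    included. *)
Definition star a := [set e : {set V} | [&& #|e| == 2, v \notin e & e :|: [set a; v] \in D]].

Lemma card2_face a : a \in nb D [set v] -> a != v /\ [set a; v] \in D.
Proof. by rewrite !inE => /andP[]. Qed.

(** The link of av is a 2-sphere with k vertices and 3k - 6 edges; coning it from a adds k edges. *)
Lemma card_star a : a \in nb D [set v] -> #|star a| + 6 = 4 * #|nb D [set a; v]|.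
Proof.
move=> anb; have [av avD] := card2_face anb.
have av2 : #|[set a; v]| = 2 by rewrite cards2 av.
have [_ e2] := euler2 hD avD av2.
suff -> : #|star a| = #|nb D [set a; v]| + #|up D [set a; v] 2| by lia.
rewrite -(card_skel_link sub) -(cardsID [set e : {set V} | a \in e]); congr (_ + _).
  have inj : {in nb D [set a; v] &, injective (fun x => [set a; x])}.
    move=> x y; rewrite !inE !negb_or => /andP[/andP[xa _] _] _ /setP/(_ x).
    by rewrite !inE eqxx orbT (negPf xa) => /esym/eqP.
  rewrite -(card_in_imset inj); apply: eq_card => e; apply/idP/imsetP.
    rewrite !inE => /andP[/and3P[/cards2P[p [q [pq ->]]] ve eD] ae].
    have [x eE xa] : exists2 x, [set p; q] = [set a; x] & x != a.
      move: ae; rewrite !inE => /orP[]/eqP->; first by exists q; rewrite // eq_sym.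
      by exists p; rewrite // setUC.
    exists x => //; move: ve eD; rewrite eE !inE !negb_or xa => /andP[_ vx] h.
    by rewrite eq_sym vx /=; apply: sub h _; subset_tac.
  case=> x; rewrite !inE !negb_or => /andP[/andP[xa xv] xD] ->.
  rewrite !inE cards2 (eq_sym a) xa /= !negb_or !(eq_sym v) av xv eqxx /=.
  by rewrite andbT; apply: sub xD _; subset_tac.
apply: eq_card => e; apply/idP/skel2P.
  rewrite !inE => /andP[ae /and3P[/cards2P[p [q [pq eE]]] ve eD]]; subst e.
  exists p, q; split=> //; move: ae ve; rewrite !inE !negb_or ![a == _]eq_sym ![v == _]eq_sym.
  - by move=> /andP[-> _] /andP[-> _].
  - by move=> /andP[_ ->] /andP[_ ->].
  by move=> _ _; rewrite setUA.
case=> p [q [-> pq]]; rewrite !inE !negb_or => /andP[pa pv] /andP[qa qv] h.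
rewrite cards2 pq /= ![a == _]eq_sym ![v == _]eq_sym pa pv qa qv /=.
by rewrite -setUA.
Qed.

Lemma star_link a : star a \subset skel (link D [set v]) 2.
Proof.
apply/subsetP=> e; rewrite !inE => /and3P[e2 ve eD].
rewrite e2 andbT; apply/and3P; split.
- by apply: sub eD _; apply: subsetUl.
- by apply: sub eD _; apply: setUS; apply: subsetUr.
by rewrite -subset0; apply/subsetP=> z; rewrite !inE => /andP[ze /eqP zv]; rewrite -zv ze in ve.
Qed.

Definition ball a := a |: nb D [set a; v].

Lemma star_ball a : a \in nb D [set v] -> inside (star a) (ball a).
Proof.
move=> anb e; rewrite inE => /and3P[_ ve eD]; apply/subsetP=> x xe; rewrite !inE negb_or.
case: (eqVneq x a) => //= xa; rewrite (contraTneq _ xe) => [|->//] /=.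
by apply: sub eD _; rewrite subUset sub1set inE xe subsetUr.
Qed.

Lemma card_ball a : #|ball a| = #|nb D [set a; v]|.+1.
Proof. by rewrite cardsU1 !inE eqxx. Qed.

Lemma star_nb a : a \in nb D [set v] -> 3 < #|nb D [set a; v]|.
Proof.
move=> anb; have [av avD] := card2_face anb.
by apply: nb_gt => //; rewrite cards2 av.
Qed.

Definition chords a := [set e in skel (link D [set v]) 2 |
  (e \subset nb D [set a; v]) && (e :|: [set a; v] \notin D)].

(** The closed star of a has 4|U| - 10 edges on its vertex set U, and each missing triangle at a
    adds one more edge on the same vertices. *)
Lemma chord_bound a : a \in nb D [set v] -> 4 * n + #|chords a| <= m + 10.
Proof.
move=> anb; have cs := card_star anb; have cb := card_ball a; have sn := star_nb anb.
have cE : #|star a :|: chords a| = #|star a| + #|chords a|.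
  rewrite cardsU (_ : star a :&: chords a = set0) ?cards0 ?subn0 //.
  apply/setP=> e; rewrite !inE.
  by case: (e :|: _ \in D); rewrite ?andbF.
have c1 : star a :|: chords a \subset skel (link D [set v]) 2.
  by rewrite subUset star_link; apply/subsetP=> e; rewrite inE => /andP[].
have c2 : inside (star a :|: chords a) (ball a).
  move=> e; rewrite inE => /orP[/(star_ball anb)//|].
  by rewrite inE => /and3P[_ h _]; apply: subset_trans h (subsetUr _ _).
have := link_graph_count c1 c2; rewrite cE cb; lia.
Qed.

(** Inclusion-exclusion for two closed stars, each with 4|U| - 10 edges, inside the rigid graph of
    the link. *)
Lemma two_star_bound a b : a \in nb D [set v] -> b \in nb D [set v] ->
  4 * n + 4 * #|ball a :&: ball b| <= m + 20 + #|star a :&: star b|.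
Proof.
move=> anb bnb; have sa := card_star anb; have sb := card_star bnb.
have ba := card_ball a; have bb := card_ball b; have na := star_nb anb.
have c1 : star a :|: star b \subset skel (link D [set v]) 2.
  by rewrite subUset !star_link.
have c2 : inside (star a :|: star b) (ball a :|: ball b).
  move=> e; rewrite inE => /orP[/(star_ball anb)|/(star_ball bnb)] h.
    by apply: subset_trans h (subsetUl _ _).
  by apply: subset_trans h (subsetUr _ _).
have cab := subset_leq_card (subsetUl (ball a) (ball b)).
have h4 : 4 <= #|ball a :|: ball b| by rewrite (leq_trans _ cab) // ba; apply: leqW.
have := link_graph_count c1 c2 h4.
have := cardsUI (star a) (star b); have := cardsUI (ball a) (ball b).
rewrite ba bb; move: sa sb; clear.
have key (n' m' sa sb ca cb us is_ ub ib : nat) : sa + 6 = 4 * ca -> sb + 6 = 4 * cb ->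
  ub + ib = ca.+1 + cb.+1 -> us + is_ = sa + sb -> n' * 4 + us <= m' + ub * 4 ->
  4 * n' + 4 * ib <= m' + 20 + is_ by lia.
exact: key.
Qed.

(* Faces of the link of v are handled as faces of D containing v; C collects the
   common neighbours of a and b lying outside the link of the edge ab. *)
Lemma two_star_common a b (C : {set V}) :
  a \in nb D [set v] -> b \in nb D [set a; v] -> #|C| <= 1 ->
  C \subset (nb D [set a; v] :&: nb D [set b; v]) :\: nb D (b |: [set a; v]) ->
  (forall x, x \in nb D [set a; v] -> x \in nb D [set b; v] -> x \notin C ->
     x \in nb D (b |: [set a; v])) ->
  4 * n + #|nb D (b |: [set a; v])| + 4 * #|C| <= m + 13 +
  #|[set x in nb D (b |: [set a; v]) | [exists c in C,
      (x |: (c |: [set a; v]) \in D) && (x |: (c |: [set b; v]) \in D)]]|.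
Proof.
move=> anb babv C1 Csub Kall.
set K := nb D (b |: [set a; v]); set K' := [set x in K | _].
have [av avD] := card2_face anb.
have := babv; rewrite !inE negb_or => /andP[/andP[ba bv] abvD].
have bnb : b \in nb D [set v].
  by rewrite !inE bv; apply: sub abvD _; subset_tac.
have KE x : (x \in K) = [&& x != b, x != a, x != v & x |: (b |: [set a; v]) \in D].
  by rewrite /K !inE !negb_or -!andbA.
have nbaE x : (x \in nb D [set a; v]) = [&& x != a, x != v & x |: [set a; v] \in D].
  by rewrite !inE negb_or -andbA.
have nbbE x : (x \in nb D [set b; v]) = [&& x != b, x != v & x |: [set b; v] \in D].
  by rewrite !inE negb_or -andbA.
have Knb x : x \in K -> (x \in nb D [set a; v]) && (x \in nb D [set b; v]).
  rewrite KE nbaE nbbE => /and4P[-> -> -> xD] /=; apply/andP; split.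
    by apply: sub xD _; subset_tac.
  by apply: sub xD _; subset_tac.
have CP c : c \in C -> [/\ c \in nb D [set a; v], c \in nb D [set b; v] & c \notin K].
  by move=> /(subsetP Csub); rewrite in_setD in_setI => /and3P[-> -> ->].
have wC : #|K| + 2 + #|C| <= #|ball a :&: ball b|.
  have -> : #|K| + 2 + #|C| = #|(K :|: [set a; b]) :|: C|.
    rewrite cardsU cardsU cards2 eq_sym ba /=.
    rewrite (_ : K :&: _ = set0) ?cards0 ?subn0; last first.
      apply/setP=> x; rewrite in_setI in_set2 in_set0 KE.
      by case: (x == b); case: (x == a); rewrite /= ?andbF.
    rewrite (_ : (K :|: [set a; b]) :&: C = set0) ?cards0 ?subn0 //.
    apply/setP=> x; rewrite in_setI in_setU in_set2 in_set0; apply/negP=> /andP[h /CP[]].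
    rewrite nbaE nbbE => /and3P[xa _ _] /and3P[xb _ _] xK.
    by rewrite (negPf xa) (negPf xb) (negPf xK) in h.
  apply/subset_leq_card/subsetP=> x; rewrite in_setU in_setU in_set2 in_setI !in_setU1.
  move=> /orP[/orP[/Knb/andP[-> ->]|/orP[/eqP->|/eqP->]]|/CP[-> -> _]]; rewrite ?orbT //.
    rewrite eqxx nbbE eq_sym ba av /= orbC; apply/orP; left; by apply: sub abvD _; subset_tac.
  by rewrite eqxx babv orbT.
have t3 : #|b |: [set a; v]| = 3 by rewrite cardsU1 !inE negb_or ba bv cards2 av.
(* The common edges are ab, those from a and from b to K, the |K| edges of the circle that is the
   link of abv, and those from the vertex of C to [K']. A common edge inside K is on that circle
   because it closes up to a facet by [face_intro]. *)
have iC : #|star a :&: star b| <= 1 + #|K| + #|K| + #|K| + #|K'|.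
  pose S1 := [set [set a; b]]; pose S2 := [set [set a; x] | x in K].
  pose S3 := [set [set b; x] | x in K]; pose S4 := skel (link D (b |: [set a; v])) 2.
  pose S5 := [set C :|: [set x] | x in K'].
  have c4 : #|S4| = #|K| by rewrite (card_skel_link sub) (euler3 hD).
  have c5 : #|S1 :|: S2 :|: S3 :|: S4 :|: S5| <= 1 + #|K| + #|K| + #|K| + #|K'|.
    do 4!(apply: leq_trans (leq_card_setU _ _) (leq_add _ _); last by rewrite ?c4 ?leq_imset_card).
    by rewrite cards1.
  apply: leq_trans c5; apply/subset_leq_card/subsetP=> e.
  rewrite in_setI !in_setU in_set1 => /andP[].
  rewrite inE => /and3P[/cards2P[p [q [pq ->]]] vpq pqa].
  rewrite inE => /and3P[_ _ pqb].
  have [pv qv] : p != v /\ q != v.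
    by move: vpq; rewrite !inE negb_or ![v == _]eq_sym => /andP[].
  have inab x y : [set x; y] :|: [set a; v] \in D -> x != a -> x != v -> x \in nb D [set a; v].
    by move=> h xa xv; rewrite nbaE xa xv; apply: sub h _; subset_tac.
  have inbb x y : [set x; y] :|: [set b; v] \in D -> x != b -> x != v -> x \in nb D [set b; v].
    by move=> h xa xv; rewrite nbbE xa xv; apply: sub h _; subset_tac.
  have caseab x y : [set x; y] = [set p; q] -> x = a -> y != v -> x != y ->
      ([set p; q] == [set a; b]) || ([set p; q] \in S2).
    move=> E xa yv xy; rewrite -E xa; case: (eqVneq y b) => [->|yb]; first by rewrite eqxx.
    apply/orP; right; apply/imsetP; exists y => //.
    rewrite KE yb eq_sym -xa xy yv; apply: sub pqb _; rewrite -E xa.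
    by subset_tac.
  have casebb x y : [set x; y] = [set p; q] -> x = b -> y != v -> x != y ->
      ([set p; q] == [set a; b]) || ([set p; q] \in S3).
    move=> E xb yv xy; rewrite -E xb; case: (eqVneq y a) => [->|ya].
      by rewrite setUC eqxx.
    apply/orP; right; apply/imsetP; exists y => //.
    rewrite KE ya eq_sym -xb xy yv; apply: sub pqa _; rewrite -E xb.
    by subset_tac.
  have pqE := erefl [set p; q]; have qpE : [set q; p] = [set p; q] := setUC _ _.
  have qp : q != p by rewrite eq_sym.
  have [pa|pa] := eqVneq p a.
    by have /orP[->|->] := caseab _ _ pqE pa qv pq; rewrite ?orbT.
  have [qa|qa] := eqVneq q a.
    by have /orP[->|->] := caseab _ _ qpE qa pv qp; rewrite ?orbT.
  have [pb|pb] := eqVneq p b.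
    by have /orP[->|->] := casebb _ _ pqE pb qv pq; rewrite ?orbT.
  have [qb|qb] := eqVneq q b.
    by have /orP[->|->] := casebb _ _ qpE qb pv qp; rewrite ?orbT.
  have pqa' : [set q; p] :|: [set a; v] \in D by rewrite qpE.
  have pqb' : [set q; p] :|: [set b; v] \in D by rewrite qpE.
  have pna := inab _ _ pqa pa pv; have pnb := inbb _ _ pqb pb pv.
  have qna := inab _ _ pqa' qa qv; have qnb := inbb _ _ pqb' qb qv.
  have caseC x y : [set x; y] = [set p; q] -> x \in C -> y \notin C ->
      y \in nb D [set a; v] -> y \in nb D [set b; v] -> [set p; q] \in S5.
    move=> E xC yC yna ynb; apply/imsetP; exists y; last first.
      rewrite -E; congr (_ :|: _); apply/eqP; rewrite eqEcard sub1set xC cards1 /=.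
      exact: C1.
    rewrite inE Kall //=; apply/existsP; exists x; rewrite xC /=.
    by apply/andP; split; [apply: sub pqa _ | apply: sub pqb _]; rewrite -E; subset_tac.
  have [pC|pC] := boolP (p \in C).
    have qC : q \notin C.
      apply/negP=> qC; have : #|[set p; q]| <= #|C|.
        by apply/subset_leq_card; rewrite subUset !sub1set pC.
      by rewrite cards2 pq => /leq_trans/(_ C1).
    by rewrite (caseC _ _ pqE) ?orbT.
  have [qC|qC] := boolP (q \in C).
    by rewrite (caseC _ _ qpE) ?orbT.
  suff -> : [set p; q] \in S4 by rewrite ?orbT.
  have pK := Kall p pna pnb pC; have qK := Kall q qna qnb qC.
  move: (pK) (qK); rewrite !KE => /and4P[_ _ _ pD] /and4P[_ _ _ qD].
  apply/skel2P; exists p, q; split=> //; rewrite ?in_setU1 ?in_set1 ?negb_or ?pa ?pb ?pv ?qa ?qb ?qv //.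
  have f4 : p |: (q |: (b |: [set a])) \in D.
    apply: (face_intro hD).
      by rewrite !cardsU1 !inE !negb_or pq pa pb qa qb ba cards1.
    move=> x; rewrite !inE => /or4P[]/eqP->.
    - by apply: sub qD _; subset_tac.
    - by apply: sub pD _; subset_tac.
    - by apply: sub pqa _; subset_tac.
    by apply: sub pqb _; subset_tac.
  apply: (face_intro hD).
    by rewrite !cardsU1 !inE !negb_or pq pa pb qa qb ba pv qv bv av cards1.
  move=> x; rewrite !inE => /or4P[/eqP->|/eqP->|/eqP->|/orP[]/eqP->].
  - by apply: sub qD _; subset_tac.
  - by apply: sub pD _; subset_tac.
  - by apply: sub pqa _; subset_tac.
  - by apply: sub pqb _; subset_tac.
  by apply: sub f4 _; subset_tac.
have := two_star_bound anb bnb; move: wC iC; clear; lia.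
Qed.
End LinkGraph.

(** * Light vertices *)

Section Light.
Variables (V : finType) (D : {set {set V}}).
Implicit Types (s t F e T S : {set V}) (x y a b c v : V).
Hypothesis hD : sphere_class 2 4 D.

Let sub s t : s \in D -> t \subset s -> t \in D. Proof. exact: face_sub. Qed.

(* The link of v is the join of the boundary of the triangle T with a circle. *)
Definition light v T := [/\ #|T| = 3, v \notin T,
  forall F, F \in D -> #|F| = 5 -> v \in F -> #|F :&: T| = 2 &
  forall F e, F \in D -> #|F| = 5 -> v \in F -> e \subset T -> #|e| = 2 ->
    (F :\: T) :|: e \in D].

Lemma card_pair_compl T e : #|T| = 3 -> e \subset T -> #|e| = 2 ->
  exists z, [/\ z \in T, z \notin e & T = z |: e].
Proof.
move=> T3 eT e2; have /cards1P[z zE] : #|T :\: e| == 1.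
  by rewrite cardsD (setIidPr eT) T3 e2.
have : z \in T :\: e by rewrite zE !inE.
rewrite inE => /andP[ze zT]; exists z; split=> //.
by rewrite -zE -{1}(setID T e) (setIidPr eT) setUC.
Qed.

Lemma set2_sub T x y : x \in T -> y \in T -> x != y -> [set x; y] \subset T /\ #|[set x; y]| = 2.
Proof. by move=> xT yT xy; rewrite subUset !sub1set xT yT cards2 xy. Qed.

Lemma swap_card F T e : #|F| = 5 -> #|F :&: T| = 2 -> e \subset T -> #|e| = 2 ->
  [/\ #|(F :\: T) :|: e| = 5, ((F :\: T) :|: e) :&: T = e &
      ((F :\: T) :|: e) :\: T = F :\: T].
Proof.
move=> F5 F2 eT e2.
have E1 : ((F :\: T) :|: e) :&: T = e.
  apply/setP=> z; rewrite !inE; have := subsetP eT z.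
  by case: (z \in e) => [->//|_]; case: (z \in T); rewrite ?andbF ?orbF.
have E2 : ((F :\: T) :|: e) :\: T = F :\: T.
  apply/setP=> z; rewrite !inE; have := subsetP eT z.
  by case: (z \in e) => [->//|_]; case: (z \in T); rewrite ?andbF ?orbF.
split=> //; rewrite -(cardsID T) E1 E2 e2.
by have := cardsID T F; rewrite F5 F2.
Qed.

Lemma light_intro v T a b : #|T| = 3 -> v \notin T -> a \in T -> b \in T -> a != b ->
  a |: [set b; v] \in D ->
  (forall F, F \in D -> #|F| = 5 -> v \in F -> a \in F -> b \in F ->
     F :&: T = [set a; b] /\
     forall e, e \subset T -> #|e| = 2 -> (F :\: T) :|: e \in D) ->
  light v T.
Proof.
move=> T3 vT aT bT ab abv Q.
have abT : [set a; b] \subset T by rewrite subUset !sub1set aT.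
pose G := [set F in D | [&& #|F| == 5, v \in F, #|F :&: T| == 2 &
   (F :\: T) :|: [set a; b] \in D]].
have inG F : F \in G -> [/\ F \in D, #|F| = 5, v \in F, #|F :&: T| = 2 &
    forall e, e \subset T -> #|e| = 2 -> (F :\: T) :|: e \in D].
  rewrite inE => /and5P[FD /eqP F5 vF /eqP F2 F0]; split=> // e eT e2.
  have [c5 c6 c7] := swap_card F5 F2 abT ltac:(by rewrite cards2 ab).
  have [|||_] := Q _ F0 c5; rewrite ?inE ?eqxx ?orbT ?vF ?vT //.
  by rewrite c7; apply.
have allG : forall F, F \in D -> #|F| = 5 -> [set v] \subset F -> F \in G.
  apply: (facets_connected hD (face1 hD v)); first by rewrite cards1.
  - have [F [FD F5 sF]] := face_facet hD abv.
    have [aF bF vF] : [/\ a \in F, b \in F & v \in F].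
      by move: sF; rewrite !subUset !sub1set => /and3P[].
    have [FT Fe] := Q F FD F5 vF aF bF.
    apply/set0Pn; exists F; rewrite inE FD F5 vF FT cards2 ab /=.
    by apply: Fe; rewrite ?cards2 ?ab.
  - by move=> F /inG[FD F5 vF _ _]; rewrite sub1set.
  move=> F x /[dup] FG /inG[FD F5 vF F2 Fe] xF; rewrite inE => xv.
  have [xT|xT] := boolP (x \in T).
    have [y [yT ye TE]] := card_pair_compl T3 (subsetIr F T) F2.
    have yF : y \notin F by move: ye; rewrite inE yT andbT.
    have xe : x \in F :&: T by rewrite inE xF.
    have e'2 : #|y |: (F :&: T) :\ x| = 2.
      by rewrite cardsU1 !inE (negPf yF) andbF; have := cardsD1 x (F :&: T); rewrite xe F2 => <-.
    have e'T : y |: (F :&: T) :\ x \subset T.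
      by rewrite subUset sub1set yT; apply/subsetP=> z; rewrite !inE => /and3P[].
    have E : y |: (F :\ x) = (F :\: T) :|: (y |: (F :&: T) :\ x).
      apply/setP=> z; rewrite !inE; case: (eqVneq z y) => [->|zy]; first by rewrite orbT.
      by case: (eqVneq z x) => [->|zx] /=; [rewrite xT | case: (z \in T); case: (z \in F)].
    have [c5 c6 c7] := swap_card F5 F2 e'T e'2.
    exists y; split=> //; first by apply: contraNneq yF => ->.
    rewrite inE E Fe // c5 c6 c7 e'2 !inE vF vT /=.
    by apply: Fe; rewrite // cards2 ab.
  have ab2 : #|[set a; b]| = 2 by rewrite cards2 ab.
  have F0D := Fe _ abT ab2.
  have [c5 c6 c7] := swap_card F5 F2 abT ab2.
  have xF0 : x \in (F :\: T) :|: [set a; b] by rewrite !inE xT xF.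
  have [y [yx yF0 nbE]] := facet_ridge hD F0D c5 xF0.
  pose F1 := y |: (((F :\: T) :|: [set a; b]) :\ x).
  have F1D : F1 \in D.
    have : y \in nb D (((F :\: T) :|: [set a; b]) :\ x) by rewrite nbE !inE eqxx orbT.
    by rewrite inE => /andP[].
  have F15 : #|F1| = 5.
    rewrite cardsU1 in_setD1 (negPf yF0) andbF /=.
    by have := cardsD1 x ((F :\: T) :|: [set a; b]); rewrite xF0 c5 => <-.
  have [ax bx] : a != x /\ b != x.
    by split; apply: contraNneq xT => <-.
  have [|||F1T F1e] := Q F1 F1D F15; rewrite ?inE ?ax ?bx ?eqxx ?orbT ?(eq_sym v) ?xv ?vF ?vT ?orbT //.
  have yT : y \notin T.
    apply/negP=> yT; have : y \in F1 :&: T by rewrite inE yT setU11.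
    rewrite F1T => h; move/negP: yF0; apply; by rewrite in_setU h orbT.
  have yF : y \notin F by apply: contra yF0 => yF; rewrite !inE yT yF.
  have F1E : F1 :\: T = y |: ((F :\: T) :\ x).
    apply/setP=> z; rewrite !inE; case: (eqVneq z y) => [->|zy]; first by rewrite yT.
    case: (boolP (z \in T)) => [zT|zT]; rewrite /= ?andbF //.
    case: (eqVneq z a) => [za|_]; first by rewrite za aT in zT.
    case: (eqVneq z b) => [zb|_]; first by rewrite zb bT in zT.
    by rewrite !orbF.
  have E : y |: (F :\ x) = (F1 :\: T) :|: (F :&: T).
    rewrite F1E; apply/setP=> z; rewrite !inE; case: (eqVneq z y) => //= _.
    by case: (eqVneq z x) => [->|_] /=; [rewrite (negPf xT) andbF | case: (z \in T); case: (z \in F)].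
  have F12 : #|F1 :&: T| = 2 by rewrite F1T.
  have [d5 d6 d7] := swap_card F15 F12 (subsetIr F T) F2.
  exists y; split=> //; rewrite inE E F1e ?subsetIr // d5 d6 d7 F2 /=.
  rewrite F1E !inE vF vT (eq_sym v x) xv orbT /=.
  by rewrite -F1E; apply: F1e.
split=> // F.
  by move=> FD F5 vF; have /inG[] := allG F FD F5 ltac:(by rewrite sub1set).
by move=> e FD F5 vF eT e2; have /inG[_ _ _ _] := allG F FD F5 ltac:(by rewrite sub1set); apply.
Qed.

Section Vertex.
Variable v : V.
Local Notation n := #|nb D [set v]|.
Local Notation m := #|up D [set v] 2|.

Lemma nb1E x : (x \in nb D [set v]) = (x != v) && ([set x; v] \in D).
Proof. by rewrite !inE. Qed.

Lemma nb2E a x : (x \in nb D [set a; v]) = [&& x != a, x != v & x |: [set a; v] \in D].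
Proof. by rewrite !inE negb_or -andbA. Qed.

(** Only triangles of the link need to be filled: larger cliques then follow from [face_intro]. *)
Definition flag := forall x y z, x != y -> x != z -> y != z -> x != v -> y != v -> z != v ->
  x |: [set y; v] \in D -> x |: [set z; v] \in D -> y |: [set z; v] \in D ->
  x |: (y |: [set z; v]) \in D.

Lemma flag_clique S : flag -> v \notin S -> 0 < #|S| ->
  (forall x y, x \in S -> y \in S -> x |: [set y; v] \in D) -> v |: S \in D.
Proof.
move=> fl; have [k] := ubnP #|S|; elim: k S => // k IHk S /ltnSE Sk vS S0 SD.
have IH x : x \in S -> 1 < #|S| -> v |: (S :\ x) \in D.
  move=> xS S1; have Sx : #|S| = #|S :\ x|.+1 by rewrite (cardsD1 x S) xS.
  apply: IHk.
  - by rewrite -Sx.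
  - by rewrite inE (negPf vS) andbF.
  - by rewrite -ltnS -Sx.
  by move=> y z; rewrite !inE => /andP[_ yS] /andP[_ zS]; apply: SD.
have [S1|S1] := leqP #|S| 1.
  have /cards1P[x Sx] : #|S| == 1 by rewrite eqn_leq S1.
  have xS : x \in S by rewrite Sx inE.
  by apply: sub (SD x x xS xS) _; rewrite Sx; subset_tac.
have [S2|S2] := leqP #|S| 2.
  have /cards2P[x [y [xy Sxy]]] : #|S| == 2 by rewrite eqn_leq S2.
  have xS : x \in S by rewrite Sxy !inE eqxx.
  have yS : y \in S by rewrite Sxy !inE eqxx orbT.
  by apply: sub (SD x y xS yS) _; rewrite Sxy; subset_tac.
have [S3|S3] := leqP #|S| 3.
  have /card_gt0P[x xS] : 0 < #|S| by [].
  have Sx : #|S :\ x| == 2.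
    have := cardsD1 x S; rewrite xS => e; move: S2 S3; rewrite e; clear; case: #|_| => [|[|[]]]; lia.
  have /cards2P[y [z [yz Syz]]] := Sx.
  have yS' : y \in S :\ x by rewrite Syz !inE eqxx.
  have zS' : z \in S :\ x by rewrite Syz !inE eqxx orbT.
  move: yS' zS'; rewrite !inE => /andP[yx yS] /andP[zx zS].
  have nv w : w \in S -> w != v by apply: contraTneq => ->.
  have h : x |: (y |: [set z; v]) \in D.
    by apply: fl; rewrite ?nv ?SD // eq_sym.
  apply: sub h _.
  by rewrite -(setD1K xS) Syz; subset_tac.
have SinD : S \in D.
  apply: (face_intro hD) => // x xS; apply: sub (IH x xS S1) _; apply: subsetUr.
apply: (face_intro hD).
  by rewrite cardsU1 vS; move: S3; clear; lia.
move=> x; rewrite !inE => /predU1P[->|xS].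
  by apply: sub SinD _; apply/subsetP=> z; rewrite !inE; case: (z == v).
apply: sub (IH x xS S1) _; apply/subsetP=> z; rewrite !inE.
by case: (z == v) => //=; rewrite ?orbT.
Qed.

(* In a flag link all edges of a link with g_2 <= 1 have degree four; counting
   degrees then contradicts the Euler relations. *)
Lemma flag_bound a0 : flag -> a0 \in nb D [set v] -> 4 * n + 2 <= m + 10.
Proof.
move=> fl a0nb; rewrite leqNgt; apply/negP => small.
have nv x : x \in nb D [set v] -> x != v by rewrite nb1E => /andP[].
have nbsub a x : x \in nb D [set a; v] -> x \in nb D [set v].
  by rewrite nb2E nb1E => /and3P[_ -> xD] /=; apply: sub xD _; subset_tac.
have nbsym a b : a \in nb D [set v] -> b \in nb D [set a; v] -> a \in nb D [set b; v].
  move=> /nv av; rewrite !nb2E av eq_sym => /and3P[-> _ h] /=; apply: sub h _; subset_tac.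
have common a b x : a \in nb D [set v] -> b \in nb D [set a; v] ->
    (x \in nb D (b |: [set a; v])) = (x \in nb D [set a; v]) && (x \in nb D [set b; v]).
  move=> /nv av; rewrite !nb2E !inE !negb_or => /and3P[ba bv abD].
  apply/idP/idP.
    move=> /andP[/and3P[-> -> ->] xD] /=; apply/andP; split.
      by apply: sub xD _; subset_tac.
    by apply: sub xD _; subset_tac.
  move=> /andP[/and3P[xa xv xaD] /and3P[xb _ xbD]]; rewrite xa xb xv /=.
  by apply: fl; rewrite // ?(eq_sym a).
(* At most 4 by [two_star_common] with empty C. With only three vertices the circle K would be a
   triangle, and K with a and b a clique of five in the link of v, giving a face with six
   vertices. *)
have k4 a b : a \in nb D [set v] -> b \in nb D [set a; v] -> #|nb D (b |: [set a; v])| = 4.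
  move=> anb bnb; have av := nv _ anb.
  move: (bnb); rewrite nb2E => /and3P[ba bv abD].
  have t3 : #|b |: [set a; v]| = 3 by rewrite cardsU1 !inE negb_or ba bv cards2 av.
  have := @two_star_common V D hD v a b set0 anb bnb.
  rewrite cards0 sub0set => /(_ isT isT) h.
  have {}h : 4 * n + #|nb D (b |: [set a; v])| <= m + 13.
    have := h _; rewrite (_ : [set x in _ | _] = set0).
      rewrite cards0 muln0 !addn0; apply => x xa xb _; by rewrite common // xa.
    by apply/setP=> x; rewrite !inE; apply/negbTE/negP=> /andP[_ /existsP[c]]; rewrite inE.
  apply/eqP; rewrite eqn_leq; apply/andP; split; first by move: h small; clear; lia.
  have tD : b |: [set a; v] \in D by [].
  have := nb_gt hD tD (N := 2); rewrite t3 => /(_ (erefl _) isT) k3.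
  rewrite leqNgt; apply/negP => k4.
  set K := nb D _ in k3 k4.
  have K3 : #|K| = 3 by apply/eqP; rewrite eqn_leq k3 andbT.
  have KE x : x \in K -> [/\ x != b, x != a, x != v & x |: (b |: [set a; v]) \in D].
    by rewrite !inE !negb_or => /andP[/and3P[-> -> ->] ->].
  have KK x y : x \in K -> y \in K -> y != x -> y |: (x |: (b |: [set a; v])) \in D.
    move=> xK yK yx; have [xb xa xv xD] := KE x xK.
    have x4 : #|x |: (b |: [set a; v])| = 4 by rewrite cardsU1 t3 !inE !negb_or xa xb xv.
    have r2 := ridge_nb hD xD x4.
    have rsub : nb D (x |: (b |: [set a; v])) \subset K :\ x.
      apply/subsetP=> z; rewrite !inE !negb_or => /andP[/and4P[-> -> -> ->] zD] /=.
      by apply: sub zD _; subset_tac.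
    have : nb D (x |: (b |: [set a; v])) == K :\ x.
      by rewrite eqEcard rsub r2; have := cardsD1 x K; rewrite xK K3 add1n => -[<-].
    move=> /eqP/setP/(_ y); rewrite [y \in _ :\ _]inE in_set1 yx yK.
    by rewrite inE => /andP[_].
  pose S := K :|: [set a; b].
  have S5 : #|S| = 5.
    rewrite cardsU K3 cards2 eq_sym ba (_ : K :&: _ = set0) ?cards0 //.
    apply/setP=> x; rewrite in_setI in_set2 in_set0; apply/negP=> /andP[/KE[xb xa _ _]].
    by rewrite (negPf xa) (negPf xb).
  have SE z : (z \in S) = [|| z \in K, z == a | z == b] by rewrite /S in_setU in_set2.
  have vS : v \notin S.
    by rewrite SE !negb_or !(eq_sym v) av bv !andbT; apply/negP=> /KE[_ _]; rewrite eqxx.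
  have : v |: S \in D.
    apply: flag_clique => //; first by rewrite S5.
    move=> x y; rewrite !SE.
    move=> /orP[xK|/orP[]/eqP->] /orP[yK|/orP[]/eqP->].
    - have [->|yx] := eqVneq y x.
        by have [_ _ _ xD] := KE x xK; apply: sub xD _; subset_tac.
      by apply: sub (KK x y xK yK yx) _; subset_tac.
    - by have [_ _ _ xD] := KE x xK; apply: sub xD _; subset_tac.
    - by have [_ _ _ xD] := KE x xK; apply: sub xD _; subset_tac.
    - by have [_ _ _ xD] := KE y yK; apply: sub xD _; subset_tac.
    - by apply: sub abD _; subset_tac.
    - by apply: sub abD _; subset_tac.
    - by have [_ _ _ xD] := KE y yK; apply: sub xD _; subset_tac.
    - by apply: sub abD _; subset_tac.
    by apply: sub abD _; subset_tac.
  by move/(face_card hD); rewrite cardsU1 vS S5.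
(* A 2-sphere with k vertices, all of degree 4, satisfies 4k = 2(3k - 6). *)
have m6 a : a \in nb D [set v] -> #|nb D [set a; v]| = 6.
  move=> anb; have av := nv _ anb; move: (anb); rewrite nb1E => /andP[_ avD].
  have av2 : #|[set a; v]| = 2 by rewrite cards2 av.
  have [_ e2] := euler2 hD avD av2.
  have : 4 * #|nb D [set a; v]| = 2 * #|up D [set a; v] 2|.
    rewrite -(double_count sub) (eq_bigr (fun=> 4)) ?sum_nat_const 1?mulnC // => b bnb.
    rewrite (up1 sub) ?k4 //.
    by move: bnb; rewrite nb2E => /and3P[].
  by move: e2; clear; lia.
have m3n : 6 * n = 2 * m.
  rewrite -(double_count sub) (eq_bigr (fun=> 6)) ?sum_nat_const 1?mulnC // => a anb.
  rewrite (up1 sub) ?m6 //.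
  by move: anb; rewrite nb1E => /andP[].
(* As m = 3n, the number m - 4n + 10 is 10 - n. Being at most 1 it gives n >= 9; the bound for two
   adjacent stars gives n <= 9. *)
have n9 : n = 9.
  have [b bnb] : exists b, b \in nb D [set a0; v].
    by apply/card_gt0P; rewrite m6.
  have := @two_star_common V D hD v a0 b set0 a0nb bnb.
  rewrite cards0 sub0set k4 // => /(_ isT isT) h.
  have {}h : 4 * n + 4 <= m + 13.
    have := h _; rewrite (_ : [set x in _ | _] = set0).
      rewrite cards0 muln0 !addn0; apply => x xa xb _; by rewrite common // xa.
    by apply/setP=> x; rewrite !inE; apply/negbTE/negP=> /andP[_ /existsP[c]]; rewrite inE.
  by move: h small m3n; clear; lia.
(* Nine vertices: a0, its six neighbours N, and two others R. Each vertex of N has exactly one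
   neighbour in R, yet each vertex of R has at least five in N, and 5 + 5 > 6. *)
pose N := nb D [set a0; v]; pose R := nb D [set v] :\: (a0 |: N).
have N6 : #|N| = 6 by apply: m6.
have aN : a0 \notin N by rewrite /N nb2E eqxx.
have R2 : #|R| = 2.
  rewrite cardsD (setIidPr _) ?cardsU1 ?aN ?N6 ?n9 //.
  by rewrite subUset sub1set a0nb; apply/subsetP=> x /nbsub.
have NR x : x \in N -> #|nb D [set x; v] :&: R| = 1.
  move=> xN; have xnb := nbsub _ _ xN; have x6 := m6 _ xnb.
  have ax := nbsym _ _ a0nb xN.
  have := cardsID (a0 |: N) (nb D [set x; v]); rewrite x6.
  have -> : nb D [set x; v] :\: (a0 |: N) = nb D [set x; v] :&: R.
    apply/setP=> z; rewrite !in_setD !in_setI in_setD andbC.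
    by case: (boolP (z \in nb D [set x; v])) => //= /nbsub->; rewrite andbT.
  have -> : nb D [set x; v] :&: (a0 |: N) = a0 |: nb D (x |: [set a0; v]).
    apply/setP=> z; rewrite in_setI !in_setU1 common // andbC.
    by case: (eqVneq z a0) => [->|_]; rewrite ?ax.
  rewrite cardsU1 k4 // !inE eqxx !orbT /=; lia.
have RN r : r \in R -> 4 < #|nb D [set r; v] :&: N|.
  rewrite in_setD in_setU1 negb_or => /andP[/andP[ra rN] rnb].
  have := cardsID N (nb D [set r; v]); rewrite m6 //.
  suff : #|nb D [set r; v] :\: N| <= 1 by clear; lia.
  have sR : nb D [set r; v] :\: N \subset R :\ r.
    apply/subsetP=> z; rewrite in_setD => /andP[zN zr]; have znb := nbsub _ _ zr.
    rewrite in_setD1 in_setD in_setU1 negb_or zN znb.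
    have -> : z != r by apply: contraTneq zr => ->; rewrite nb2E eqxx.
    rewrite !andbT /=; apply: contraNneq rN => za; rewrite za in zr.
    by apply: nbsym zr; exact: rnb.
  have := subset_leq_card sR; have := cardsD1 r R.
  rewrite R2 in_setD in_setU1 negb_or ra rN rnb /=; clear; lia.
have /cards2P[r [r' [rr' Rrr']]] : #|R| == 2 by rewrite R2.
have rR : r \in R by rewrite Rrr' !inE eqxx.
have r'R : r' \in R by rewrite Rrr' !inE eqxx orbT.
have /card_gt0P[x] : 0 < #|(nb D [set r; v] :&: N) :&: (nb D [set r'; v] :&: N)|.
  have := RN _ rR; have := RN _ r'R.
  have := cardsUI (nb D [set r; v] :&: N) (nb D [set r'; v] :&: N).
  have : #|(nb D [set r; v] :&: N) :|: (nb D [set r'; v] :&: N)| <= 6.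
    by rewrite -N6 subset_leq_card // subUset !subsetIr.
  clear; lia.
rewrite !in_setI => /andP[/andP[xr xN] /andP[xr' _]].
have Rnb z : z \in R -> z \in nb D [set v] by rewrite in_setD => /andP[].
have := NR _ xN; suff -> : nb D [set x; v] :&: R = R by rewrite R2.
apply/setIidPr/subsetP=> z; rewrite Rrr' in_set2 => /orP[]/eqP->; apply: nbsym => //; exact: Rnb.
Qed.
Definition chord x y z := [/\ y \in nb D [set x; v], z \in nb D [set x; v],
  y \in nb D [set z; v] & x |: (y |: [set z; v]) \notin D].

Lemma chord_in x y z : x != v -> chord x y z -> [set y; z] \in chords D v x.
Proof.
move=> xv [ynb znb yz xyz]; rewrite inE; apply/and3P; split.
- apply/skel2P; first exact: hD.
  move: ynb znb yz; rewrite !nb2E => /and3P[_ yv _] /and3P[_ zv _] /and3P[yz _ h].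
  by exists y, z; split; rewrite // inE.
- by apply/subsetP=> w; rewrite !inE => /orP[]/eqP->; move: ynb znb; rewrite !inE.
apply: contra xyz => h; apply: sub h _; subset_tac.
Qed.

Lemma chord_rot x y z : x != v -> chord x y z -> [/\ chord x z y, chord y x z & chord z x y].
Proof.
move=> xv [ynb znb yz xyz]; move: ynb znb yz; rewrite !nb2E.
move=> /and3P[yx yv yxD] /and3P[zx zv zxD] /and3P[yz _ yzD].
have [xy xz zy] : [/\ x != y, x != z & z != y] by split; rewrite eq_sym.
split; split; rewrite ?nb2E ?xy ?xz ?zy ?yx ?zx ?yz ?xv ?yv ?zv //=;
  try by [apply: sub yxD _; subset_tac | apply: sub zxD _; subset_tac | apply: sub yzD _; subset_tac];
  apply: contra xyz => h; apply: sub h _; subset_tac.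
Qed.

(** By [chord_bound] each vertex of the link is in at most one missing triangle, and
    [two_star_common] with C = {c} becomes tight: every vertex of the link of abv also spans faces
    with acv and bcv. Hence in a facet through a, b, v the pair ab may be replaced by ac or bc, as
    [light_intro] requires. *)
Lemma chord_light a b c : a \in nb D [set v] -> chord a b c -> m + 10 < 4 * n + 2 ->
  light v [set a; b; c].
Proof.
move=> anb abc small.
have nv x : x \in nb D [set v] -> x != v by rewrite nb1E => /andP[].
have nbsub p x : x \in nb D [set p; v] -> x \in nb D [set v].
  by rewrite nb2E nb1E => /and3P[_ -> xD] /=; apply: sub xD _; subset_tac.
have nbsym p q : p \in nb D [set v] -> q \in nb D [set p; v] -> p \in nb D [set q; v].
  move=> /nv pv; rewrite !nb2E pv eq_sym => /and3P[-> _ h] /=; apply: sub h _; subset_tac.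
have av := nv _ anb.
have uniq x y z y' z' : x \in nb D [set v] -> chord x y z -> chord x y' z' ->
    [set y; z] = [set y'; z'].
  move=> xnb h h'; apply/eqP/negPn/negP => ne.
  have : #|[set [set y; z]; [set y'; z']]| <= #|chords D v x|.
    apply/subset_leq_card/subsetP => e; rewrite in_set2.
    by move=> /orP[]/eqP->; apply: chord_in => //; apply: nv.
  by rewrite cards2 ne; have := chord_bound hD xnb; move: small; clear; lia.
have [acb bac cab] := chord_rot av abc.
have [bna cna bnc abcD] := abc.
have bnb := nbsub _ _ bna; have cnb := nbsub _ _ cna.
have bv := nv _ bnb; have cv := nv _ cnb.
have [ba ca bc] : [/\ b != a, c != a & b != c].
  by move: bna cna bnc; rewrite !nb2E => /and3P[-> _ _] /and3P[-> _ _] /and3P[->].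
have avD : [set a; v] \in D by move: anb; rewrite nb1E => /andP[].
have [cna' cnb'] : c \in nb D [set a; v] /\ c \in nb D [set b; v].
  by split=> //; apply: nbsym.
(* v has at most one missing triangle at each vertex of its link *)
have fill x y z : x \in nb D [set v] -> y \in nb D [set x; v] -> z \in nb D [set x; v] ->
    y \in nb D [set z; v] -> (exists p q, chord x p q /\ [set y; z] <> [set p; q]) ->
    x |: (y |: [set z; v]) \in D.
  move=> xnb ynb znb yz [p [q [xpq ne]]]; apply/negPn/negP => h; apply: ne.
  by apply: (uniq x) => //; split.
have ne2 x y z : y != z -> y != x -> [set x; y] <> [set x; z].
  move=> yz yx /setP/(_ y); rewrite !inE eqxx orbT (negPf yx) (negPf yz) //.
have Kfill x : x \in nb D [set a; v] -> x \in nb D [set b; v] -> x != c ->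
    x \in nb D (b |: [set a; v]).
  move=> xa xb xc; have xnb := nbsub _ _ xa.
  have h : a |: (x |: [set b; v]) \in D.
    apply: fill => //; exists c, b; split => //.
    rewrite setUC [X in _ <> X]setUC; apply: ne2 => //.
    by move: xb; rewrite nb2E => /and3P[].
  move: xa xb; rewrite nb2E !inE !negb_or => /and3P[-> -> _] /andP[/andP[-> _] _] /=.
  by apply: sub h _; subset_tac.
pose K := nb D (b |: [set a; v]).
have KE x : (x \in K) = [&& x != b, x != a, x != v & x |: (b |: [set a; v]) \in D].
  by rewrite /K !inE !negb_or -!andbA.
have cK : c \notin K.
  rewrite KE ca cv !(eq_sym c) bc /=; apply: contra abcD => h; apply: sub h _; subset_tac.
have Kc x : x \in K -> (x |: (c |: [set a; v]) \in D) && (x |: (c |: [set b; v]) \in D).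
  have := @two_star_common V D hD v a b [set c] anb bna.
  rewrite cards1 sub1set in_setD in_setI cK cna' cnb' => /(_ isT isT) h.
  have {}h : 4 * n + #|K| + 4 * 1 <= m + 13 +
    #|[set x in K | (x |: (c |: [set a; v]) \in D) && (x |: (c |: [set b; v]) \in D)]|.
    apply: leq_trans (h _) _.
      by move=> y ya yb; rewrite in_set1; apply: Kfill.
    rewrite leq_add2l; apply/subset_leq_card/subsetP=> y; rewrite !(in_set _ y) -/K.
    by move=> /andP[-> /existsP[c']]; rewrite inE => /andP[/eqP->].
  set K' := [set x in K | _] in h.
  have K'K : K' = K.
    apply/eqP; rewrite eqEcard; apply/andP; split; last by move: h small; clear; lia.
    by apply/subsetP=> y; rewrite /K' inE => /andP[].
  by rewrite -{1}K'K /K' inE => /andP[].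
have notT : b |: [set a; v] \in D by move: bna; rewrite nb2E => /and3P[].
have T3 : #|[set a; b; c]| = 3.
  by rewrite setUC cardsU1 !inE cards2 negb_or ca (eq_sym c) bc (eq_sym a) ba.
have TvD F : F \in D -> [set a; b; c] \subset F -> v \in F -> False.
  move=> FD TF vF; move/negP: abcD; apply; apply: sub FD _.
  rewrite !subUset !sub1set vF; move: TF; rewrite !subUset !sub1set.
  by move=> /andP[/andP[-> ->] ->].
have Q F : F \in D -> #|F| = 5 -> v \in F -> a \in F -> b \in F ->
    exists x y, [/\ x != y, x \notin [set a; b; c], y \notin [set a; b; c] &
    [/\ F = x |: (y |: (v |: [set a; b])), x |: (y |: (v |: [set a; c])) \in D &
      x |: (y |: (v |: [set b; c])) \in D]].
  move=> FD F5 vF aF bF.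
  have sF : v |: [set a; b] \subset F by rewrite !subUset !sub1set vF aF.
  have c3 : #|v |: [set a; b]| = 3 by rewrite cardsU1 !inE !(eq_sym v) negb_or av bv cards2 eq_sym ba.
  have /cards2P[x [y [xy Fxy]]] : #|F :\: (v |: [set a; b])| == 2.
    by rewrite cardsD (setIidPr sF) F5 c3.
  have FE : F = x |: (y |: (v |: [set a; b])).
    by rewrite -(setID F (v |: [set a; b])) (setIidPr sF) Fxy; seteq_tac.
  have xP : x \in F :\: (v |: [set a; b]) by rewrite Fxy !inE eqxx.
  have yP : y \in F :\: (v |: [set a; b]) by rewrite Fxy !inE eqxx orbT.
  move: xP yP; rewrite !inE !negb_or.
  move=> /andP[/and3P[xv xa xb] xF] /andP[/and3P[yv ya yb] yF].
  have nc z : z \in F -> z != c.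
    move=> zF; apply/eqP => zc; apply: (TvD F) => //.
    by rewrite !subUset !sub1set aF bF -zc.
  have xc := nc x xF; have yc := nc y yF.
  have xK : x \in K by rewrite KE xa xb xv; apply: sub FD _; rewrite FE; subset_tac.
  have yK : y \in K by rewrite KE ya yb yv; apply: sub FD _; rewrite FE; subset_tac.
  have /andP[xca xcb] := Kc x xK; have /andP[yca ycb] := Kc y yK.
  have xnb : x \in nb D [set v] by rewrite nb1E xv; apply: sub FD _; rewrite FE; subset_tac.
  have cxy : c |: (x |: [set y; v]) \in D.
    have xc' : x \in nb D [set c; v] by rewrite nb2E xc xv; apply: sub xca _; subset_tac.
    have yc' : y \in nb D [set c; v] by rewrite nb2E yc yv; apply: sub yca _; subset_tac.
    apply: fill => //.
      by rewrite nb2E xy xv; apply: sub FD _; rewrite FE; subset_tac.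
    exists a, b; split => // /setP/(_ x); rewrite !inE eqxx (negPf xa) (negPf xb).
    by [].
  have five p : p \in F -> p != x -> p != y -> p != v -> p != c ->
      x |: (c |: [set p; v]) \in D -> y |: (c |: [set p; v]) \in D ->
      x |: (y |: (v |: [set p; c])) \in D.
    move=> pF px py pv pc xD yD.
    have pxy : p |: (x |: [set y; v]) \in D.
      by apply: sub FD _; rewrite !subUset !sub1set pF xF yF.
    have four : x |: (y |: [set p; c]) \in D.
      apply: (face_intro hD).
        by rewrite !cardsU1 !inE cards1 !negb_or xy xc yc pc !(eq_sym _ p) px py.
      move=> z; rewrite !inE => /or4P[]/eqP->.
      - by apply: sub yD _; subset_tac.
      - by apply: sub xD _; subset_tac.
      - by apply: sub cxy _; subset_tac.
      by apply: sub pxy _; subset_tac.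
    apply: (face_intro hD).
      by rewrite !cardsU1 !inE cards1 !negb_or xy xc yc pc xv yv !(eq_sym v) cv pv !(eq_sym _ p) px py.
    move=> z; rewrite !inE => /orP[/eqP->|/or4P[]/eqP->].
    - by apply: sub yD _; subset_tac.
    - by apply: sub xD _; subset_tac.
    - by apply: sub four _; subset_tac.
    - by apply: sub cxy _; subset_tac.
    by apply: sub pxy _; subset_tac.
  exists x, y; rewrite !inE !negb_or xa xb xc ya yb yc; split=> //; split=> //.
    by apply: five; rewrite // eq_sym.
  by apply: five; rewrite // eq_sym.
have [aT bT cT] : [/\ a \in [set a; b; c], b \in [set a; b; c] & c \in [set a; b; c]].
  by rewrite !inE !eqxx !orbT.
have vT : v \notin [set a; b; c] by rewrite !inE !negb_or !(eq_sym v) av bv cv.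
apply: (light_intro (a := a) (b := b)) => //; first by rewrite eq_sym.
  by apply: sub notT _; subset_tac.
move=> F FD F5 vF aF bF.
have [x [y [xy xT yT [FE xyac xybc]]]] := Q F FD F5 vF aF bF.
have FTE : F :&: [set a; b; c] = [set a; b].
  rewrite FE; apply/setP=> z; move: xT yT vT; rewrite !inE !negb_or.
  case: (eqVneq z a) => [->|za]; rewrite ?orbT //.
  case: (eqVneq z b) => [->|zb]; rewrite ?orbT //.
  case: (eqVneq z c) => [->|zc]; rewrite ?andbF //= !orbF !(eq_sym _ c).
  by move=> /andP[_ /negPf->] /andP[_ /negPf->] /andP[_ /negPf->].
have FDE : F :\: [set a; b; c] = x |: (y |: [set v]).
  rewrite FE; apply/setP=> z; move: xT yT vT; rewrite !inE !negb_or.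
  case: (eqVneq z a) => [->|za].
    by move=> /andP[/andP[xa _] _] /andP[/andP[ya _] _] _; rewrite /= !(eq_sym a) (negPf xa) (negPf ya) (eq_sym v) (negPf av).
  case: (eqVneq z b) => [->|zb].
    by move=> /andP[/andP[_ xb] _] /andP[/andP[_ yb] _] _; rewrite /= !(eq_sym b) (negPf xb) (negPf yb) (eq_sym v) (negPf bv).
  case: (eqVneq z c) => [->|zc] /=; last by rewrite !orbF.
  by move=> /andP[_ xc] /andP[_ yc] _; rewrite !(eq_sym c) (negPf xc) (negPf yc) (eq_sym v) (negPf cv).
split=> // e eT e2; rewrite FDE.
have [z [zT ze TE]] := card_pair_compl T3 eT e2.
have eE : e = [set a; b; c] :\ z by rewrite TE setU1K.
move: zT; rewrite eE !inE -orbA => /or3P[]/eqP->.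
- apply: sub xybc _; subset_tac.
- apply: sub xyac _; subset_tac.
rewrite FE in FD; apply: sub FD _; subset_tac.
Qed.

(** A flag link gains 2 by [flag_bound]; otherwise a missing triangle gains 1 by [chord_bound], and
    if no more is gained, [chord_light] applies to it. *)
Lemma light_or_heavy : 4 * n + 1 <= m + 10 /\
  (4 * n + 2 <= m + 10 \/ exists T, light v T).
Proof.
have [a0 a0nb] : exists a, a \in nb D [set v].
  apply/card_gt0P; apply: leq_ltn_trans (nb_gt hD (face1 hD v) (N := 4) _ _) => //.
  by rewrite cards1.
case: (classic flag) => [fl|nfl].
  have h := flag_bound fl a0nb; split; last by left.
  by move: h; clear; lia.
have [a [b [c [anb abc]]]] : exists a b c, a \in nb D [set v] /\ chord a b c.
  apply: NNPP => h; apply: nfl => x y z xy xz yz xv yv zv xyD xzD yzD.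
  apply/negPn/negP => xyzD; apply: h; exists x, y, z; split.
    by rewrite nb1E xv; apply: sub xyD _; subset_tac.
  split; rewrite // nb2E ?(eq_sym _ x) ?xy ?xz ?yz ?yv ?zv /=.
  - by apply: sub xyD _; subset_tac.
  - by apply: sub xzD _; subset_tac.
  - by apply: sub yzD _; subset_tac.
have av : a != v by move: anb; rewrite nb1E => /andP[].
have ch : 0 < #|chords D v a|.
  by apply/card_gt0P; exists [set b; c]; apply: chord_in.
have h1 : 4 * n + 1 <= m + 10.
  by have := chord_bound hD anb; move: ch; clear; lia.
split=> //; case: (leqP (4 * n + 2) (m + 10)) => h2; first by left.
by right; exists [set a; b; c]; apply: chord_light anb abc h2.
Qed.

End Vertex.
End Light.

(** * Light vertices and triangles of other light vertices *)

Section LightPairs.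
Variables (V : finType) (D : {set {set V}}).
Implicit Types (s t F e T S : {set V}) (x y a b c u v w : V).
Hypothesis hD : sphere_class 2 4 D.

Let sub s t : s \in D -> t \subset s -> t \in D. Proof. exact: face_sub. Qed.
Local Notation light := (light D).

Lemma card3_split T a : #|T| = 3 -> a \in T ->
  exists b c, [/\ b != a, c != a, b != c & T = a |: [set b; c]].
Proof.
move=> T3 aT; have /cards2P[b [c [bc Ta]]] : #|T :\ a| == 2.
  by have := cardsD1 a T; rewrite aT T3 add1n => -[<-].
have bTa : b \in T :\ a by rewrite Ta !inE eqxx.
have cTa : c \in T :\ a by rewrite Ta !inE eqxx orbT.
exists b, c; split=> //; last by rewrite -Ta setD1K.
  by move: bTa; rewrite !inE => /andP[].
by move: cTa; rewrite !inE => /andP[].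
Qed.

Lemma light_swap v T s e : light v T -> s \in D -> v \in s -> e \subset T -> #|e| = 2 ->
  (s :\: T) :|: e \in D.
Proof.
move=> [_ _ _ h] sD vs eT e2; have [F [FD F5 sF]] := face_facet hD sD.
apply: sub (h F e FD F5 (subsetP sF _ vs) eT e2) _.
by apply: setSU; apply: setSD.
Qed.

Lemma light_notsub v T s : light v T -> s \in D -> v \in s -> ~~ (T \subset s).
Proof.
move=> [T3 vT h _] sD vs; apply/negP=> Ts; have [F [FD F5 sF]] := face_facet hD sD.
have := h F FD F5 (subsetP sF _ vs).
by rewrite (setIidPr (subset_trans Ts sF)) T3.
Qed.

Lemma light_pair v T e : light v T -> e \subset T -> #|e| = 2 -> v |: e \in D.
Proof.
move=> lv eT e2; have := light_swap lv (face1 hD v) (set11 v) eT e2.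
by have [_ vT _ _] := lv; rewrite (setDidPl _) // disjoints1.
Qed.

Lemma light_edge v T a : light v T -> a \in T -> [set a; v] \in D.
Proof.
move=> lv aT; have [T3 vT _ _] := lv; have [b [c [ba ca bc TE]]] := card3_split T3 aT.
have eT : [set a; b] \subset T by rewrite TE; subset_tac.
have := light_pair lv eT; rewrite cards2 eq_sym ba => /(_ (erefl _)) h.
by apply: sub h _; subset_tac.
Qed.

Lemma light_missing v T : light v T -> T \notin D.
Proof.
move=> lv; have [T3 vT _ _] := lv; apply/negP=> TD.
have : v |: T \in D.
  apply: (face_intro hD); first by rewrite cardsU1 vT T3.
  move=> x; rewrite !inE => /predU1P[->|xT]; first by rewrite setU1K.
  have -> : (v |: T) :\ x = v |: (T :\ x).
    apply/setP=> z; rewrite !inE; case: (eqVneq z v) => [->|] //=.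
    by rewrite andbT; apply: contraNneq vT => ->.
  apply: (light_pair lv); first exact: subsetDl.
  by have := cardsD1 x T; rewrite xT T3 add1n => -[<-].
move=> h; have := light_notsub lv h (setU11 _ _).
by rewrite subsetUr.
Qed.

Lemma facet_light v T F : light v T -> F \in D -> #|F| = 5 -> v \in F -> #|F :&: T| = 2.
Proof. by move=> [_ _ h _]; apply: h. Qed.

Lemma swap_parts v T F e : light v T -> F \in D -> #|F| = 5 -> v \in F ->
  e \subset T -> #|e| = 2 -> [/\ (F :\: T) :|: e \in D, #|(F :\: T) :|: e| = 5,
   ((F :\: T) :|: e) :&: T = e & ((F :\: T) :|: e) :\: T = F :\: T].
Proof.
move=> lv FD F5 vF eT e2; have [c5 cT cD] := swap_card F5 (facet_light lv FD F5 vF) eT e2.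
by split=> //; apply: light_swap lv FD vF eT e2.
Qed.

(** If a is in T but not in T', take two facets through u and v that differ only in having b or c.
    T' meets both in two vertices, which forces T' to be {w, b, c} with w common to both. Exchanging
    for bc at u yields a face through v that contains T. *)
Lemma light_agree v u T T' : light v T -> light u T' -> u != v -> [set u; v] \in D ->
  u \notin T -> v \notin T' -> T = T'.
Proof.
move=> lv lu uv uvD uT vT'; have [T3 vT _ _] := lv; have [T'3 uT' _ _] := lu.
apply/eqP; rewrite eqEcard T3 T'3 andbT; apply/negPn/negP => /subsetPn[a aT aT'].
have [b [c [ba ca bc TE]]] := card3_split T3 aT.
have [F [FD F5 uvF]] := face_facet hD uvD.
have [uF vF] : u \in F /\ v \in F by move: uvF; rewrite subUset !sub1set => /andP[].
have abT : [set a; b] \subset T by rewrite TE; subset_tac.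
have acT : [set a; c] \subset T by rewrite TE; subset_tac.
have bcT : [set b; c] \subset T by rewrite TE; subset_tac.
have ab2 : #|[set a; b]| = 2 by rewrite cards2 eq_sym ba.
have ac2 : #|[set a; c]| = 2 by rewrite cards2 eq_sym ca.
have [F1D F15 F1T F1dT] := swap_parts lv FD F5 vF abT ab2.
set F1 := (F :\: T) :|: [set a; b] in F1D F15 F1T F1dT.
have uF1 : u \in F1 by rewrite !inE uF uT.
have vF1 : v \in F1 by rewrite !inE vF vT.
have [F2D F25 F2T F2dT] := swap_parts lv FD F5 vF acT ac2.
set F2 := (F :\: T) :|: [set a; c] in F2D F25 F2T F2dT.
have uF2 : u \in F2 by rewrite !inE uF uT.
have F1T' := facet_light lu F1D F15 uF1.
have F2T' := facet_light lu F2D F25 uF2.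
have FT3 : #|F1 :\: T| = 3.
  by have := cardsID T F1; rewrite F15 F1T ab2 => -[].
have w1 : #|(F1 :\: T) :\ u :\ v| = 1.
  have e1 := cardsD1 u (F1 :\: T); have e2 := cardsD1 v ((F1 :\: T) :\ u).
  move: e1 e2; rewrite FT3 !in_setD in_set1 eq_sym uv uF1 vF1 uT vT /= !add1n.
  by move: (#|_|) (#|_|) => i j; clear; lia.
have /cards1P[w Fw] : #|(F1 :\: T) :\ u :\ v| == 1 by rewrite w1.
have sub1 : F1 :&: T' \subset [set w; b].
  apply/subsetP=> z; rewrite in_setI => /andP[zF zT'].
  have zu : z != u by apply: contraTneq zT' => ->.
  have zv : z != v by apply: contraTneq zT' => ->.
  have za : z != a by apply: contraTneq zT' => ->.
  rewrite in_set2; have [zT|zT] := boolP (z \in T).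
    have : z \in F1 :&: T by rewrite in_setI zF.
    by rewrite F1T in_set2 (negPf za) /= => ->; rewrite orbT.
  have : z \in (F1 :\: T) :\ u :\ v by rewrite !in_setD !in_set1 zF zT zu zv.
  by rewrite Fw in_set1 => ->.
have sub2 : F2 :&: T' \subset [set w; c].
  apply/subsetP=> z; rewrite in_setI => /andP[zF zT'].
  have zu : z != u by apply: contraTneq zT' => ->.
  have zv : z != v by apply: contraTneq zT' => ->.
  have za : z != a by apply: contraTneq zT' => ->.
  rewrite in_set2; have [zT|zT] := boolP (z \in T).
    have : z \in F2 :&: T by rewrite in_setI zF.
    by rewrite F2T in_set2 (negPf za) /= => ->; rewrite orbT.
  have : z \in (F2 :\: T) :\ u :\ v by rewrite !in_setD !in_set1 zF zT zu zv.
  by rewrite F2dT -F1dT Fw in_set1 => ->.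
have wP : w \in (F1 :\: T) :\ u :\ v by rewrite Fw inE.
move: wP; rewrite !in_setD !in_set1 => /and4P[wv wu wT wF1].
have wb : w != b by apply: contraNneq wT => ->; rewrite TE !inE eqxx orbT.
have wc : w != c by apply: contraNneq wT => ->; rewrite TE !inE eqxx !orbT.
have E1 : F1 :&: T' = [set w; b].
  by apply/eqP; rewrite eqEcard sub1 F1T' cards2 wb.
have E2 : F2 :&: T' = [set w; c].
  by apply/eqP; rewrite eqEcard sub2 F2T' cards2 wc.
have bT' : b \in T'.
  by have : b \in F1 :&: T' by [rewrite E1 !inE eqxx orbT]; rewrite inE => /andP[].
have cT' : c \in T'.
  by have : c \in F2 :&: T' by [rewrite E2 !inE eqxx orbT]; rewrite inE => /andP[].
have bcT' : [set b; c] \subset T' by rewrite subUset !sub1set bT'.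
have bc2 : #|[set b; c]| = 2 by rewrite cards2 bc.
have F3D := light_swap lu F1D uF1 bcT' bc2.
have vF3 : v \in (F1 :\: T') :|: [set b; c] by rewrite in_setU in_setD vF1 vT'.
have /negP := light_notsub lv F3D vF3; apply.
rewrite TE subUset sub1set in_setU in_setD aT' subsetUr andbT /=.
by rewrite /F1 in_setU set21 orbT.
Qed.

(** Let s be common and r the third vertex of T. If r is in T', lightness of a makes asr = T a face.
    If not, the facets exchanged to as and to ar cannot both meet T' in two vertices, since only the
    first gains s. *)
Lemma light_disjoint v a T T' : light v T -> light a T' -> a \in T -> [disjoint T & T'].
Proof.
move=> lv la aT; have [T3 vT _ _] := lv; have [T'3 aT' _ _] := la.
have [b [c [ba ca bc TE]]] := card3_split T3 aT.
have [bT cT] : b \in T /\ c \in T by rewrite TE !inE !eqxx !orbT.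
have avD := light_edge lv aT.
have [F [FD F5 avF]] := face_facet hD avD.
have [aF vF] : a \in F /\ v \in F by move: avF; rewrite subUset !sub1set => /andP[].
rewrite -setI_eq0; apply/eqP/setP=> s; rewrite in_setI in_set0; apply/negP=> /andP[sT sT'].
have sa : s != a by apply: contraTneq sT' => ->.
have [r rT [rs ra]] : exists2 r, r \in T & r != s /\ r != a.
  have [sb|sb] := eqVneq s b.
    by exists c => //; rewrite sb eq_sym bc ca.
  exists b => //; split=> //; by rewrite eq_sym.
have TE2 x : (x \in T) = [|| x == a, x == s | x == r].
  have : [set a; s; r] \subset T by rewrite !subUset !sub1set aT sT.
  have : #|[set a; s; r]| = 3.
    by rewrite setUC cardsU1 !inE negb_or ra rs cards2 eq_sym sa.
  move=> c3 sT3; have <- : [set a; s; r] = T.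
    by apply/eqP; rewrite eqEcard sT3 c3 T3.
  by rewrite !inE orbA.
have [asT as2] := set2_sub aT sT (ltac:(by rewrite eq_sym)).
have [arT ar2] := set2_sub aT rT (ltac:(by rewrite eq_sym)).
have [rT'|rT'] := boolP (r \in T').
  have [srT' sr2] := set2_sub sT' rT' (ltac:(by rewrite eq_sym)).
  have h := light_pair la srT' sr2.
  have := light_missing lv; rewrite (_ : T = a |: [set s; r]) ?h //.
  by apply/setP=> x; rewrite TE2 !inE.
have [F1D F15 F1T F1dT] := swap_parts lv FD F5 vF asT as2.
have [F2D F25 F2T F2dT] := swap_parts lv FD F5 vF arT ar2.
set F1 := (F :\: T) :|: [set a; s] in F1D F15 F1T F1dT.
set F2 := (F :\: T) :|: [set a; r] in F2D F25 F2T F2dT.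
have aF1 : a \in F1 by rewrite in_setU set21 orbT.
have aF2 : a \in F2 by rewrite in_setU set21 orbT.
have c1 := facet_light la F1D F15 aF1.
have c2 := facet_light la F2D F25 aF2.
have : F2 :&: T' \subset (F1 :&: T') :\ s.
  apply/subsetP=> x; rewrite in_setD1 !in_setI => /andP[xF2 xT'].
  have xa : x != a by apply: contraTneq xT' => ->.
  have xr : x != r by apply: contraTneq xT' => ->.
  have xT : x \notin T.
    apply/negP=> xT; have : x \in F2 :&: T by rewrite in_setI xF2.
    by rewrite F2T in_set2 (negPf xa) (negPf xr).
  have xs : x != s by apply: contraNneq xT => ->.
  rewrite xs xT' andbT /=; have : x \in F2 :\: T by rewrite in_setD xT.
  by rewrite F2dT -F1dT in_setD => /andP[].
move=> /subset_leq_card; rewrite c2.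
have := cardsD1 s (F1 :&: T'); rewrite c1 in_setI sT' in_setU set22 orbT /= add1n => -[<-].
by [].
Qed.

(* The join of the boundaries of T and T' with two points is a 4-sphere inside D,
   hence all of D. *)
Lemma light_cross v a T T' : light v T -> light a T' -> a \in T -> v \in T' -> #|V| <= 8.
Proof.
move=> lv la aT vT'; have [T3 vT _ _] := lv; have [T'3 aT' _ _] := la.
have [b [c [ba ca bc TE]]] := card3_split T3 aT.
have [y [z [yv zv yz T'E]]] := card3_split T'3 vT'.
have [bT cT] : b \in T /\ c \in T by rewrite TE !inE !eqxx !orbT.
have [yT' zT'] : y \in T' /\ z \in T' by rewrite T'E !inE !eqxx !orbT.
have avD := light_edge lv aT.
have av : a != v by apply: contraNneq vT => <-.
have [F [FD F5 avF]] := face_facet hD avD.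
have [aF vF] : a \in F /\ v \in F by move: avF; rewrite subUset !sub1set => /andP[].
have dis := light_disjoint lv la aT.
have disT x : x \in T -> x \notin T' by move=> xT; rewrite (disjointFr dis).
have disT' x : x \in T' -> x \notin T by move=> xT'; rewrite (disjointFl dis).
have [abT ab2] := set2_sub aT bT (ltac:(by rewrite eq_sym)).
have [acT ac2] := set2_sub aT cT (ltac:(by rewrite eq_sym)).
have [vyT' vy2] := set2_sub vT' yT' (ltac:(by rewrite eq_sym)).
have [F1D F15 F1T F1dT] := swap_parts lv FD F5 vF abT ab2.
set F1 := (F :\: T) :|: [set a; b] in F1D F15 F1T F1dT.
have aF1 : a \in F1 by rewrite in_setU set21 orbT.
have [F2D F25 F2T F2dT] := swap_parts la F1D F15 aF1 vyT' vy2.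
set F2 := (F1 :\: T') :|: [set v; y] in F2D F25 F2T F2dT.
have aF2 : a \in F2 by rewrite in_setU in_setD aF1 aT'.
have bF2 : b \in F2.
  by rewrite in_setU in_setD (disT _ bT) /F1 in_setU set22 orbT.
have vF2 : v \in F2 by rewrite in_setU set21 orbT.
have yF2 : y \in F2 by rewrite in_setU set22 orbT.
pose r := [set a; b; v; y].
have rF2 : r \subset F2 by rewrite !subUset !sub1set aF2 bF2 vF2 yF2.
have rD := sub F2D rF2.
have neq x x' : x \in T -> x' \in T' -> x != x'.
  by move=> xT; apply: contraTneq => <-; apply: disT.
have r4 : #|r| = 4.
  rewrite /r setUC cardsU1 !inE !negb_or (eq_sym y) (neq a y) // (eq_sym y) (neq b y) //.
  rewrite yv /= setUC cardsU1 !inE !negb_or (eq_sym v) (neq a v) // (eq_sym v) (neq b v) //.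
  by rewrite cards2 eq_sym ba.
have /cards2P[p [q [pq nbE]]] : #|nb D r| == 2 by rewrite ridge_nb.
have Fw w : w \in nb D r -> [/\ w |: r \in D, #|w |: r| = 5, w \notin T & w \notin T'].
  rewrite inE => /andP[wr wD].
  have c5 : #|w |: r| = 5 by rewrite cardsU1 wr r4.
  have [va vv] : a \in w |: r /\ v \in w |: r by rewrite !inE !eqxx !orbT.
  have h1 := facet_light lv wD c5 vv; have h2 := facet_light la wD c5 va.
  split=> //; apply/negP=> wT.
    have : w |: [set a; b] \subset (w |: r) :&: T.
      rewrite subsetI !subUset !sub1set wT aT bT !inE !eqxx !orbT //.
    move=> /subset_leq_card; rewrite h1 cardsU1 ab2.
    have -> // : w \notin [set a; b].
    by apply: contra wr; rewrite !inE => /orP[]->; rewrite ?orbT.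
  have : w |: [set v; y] \subset (w |: r) :&: T'.
    by rewrite subsetI !subUset !sub1set wT vT' yT' !inE !eqxx !orbT.
  move=> /subset_leq_card; rewrite h2 cardsU1 vy2.
  have -> // : w \notin [set v; y].
  by apply: contra wr; rewrite !inE => /orP[]->; rewrite ?orbT.
(* Exchanges of T need v in the face, those of T' need a. This reaches every pair e, e' with v in e'
   or a in e; the last case e = bc, e' = yz follows from [face_intro]. *)
have joinD w e e' : w \in nb D r -> e \subset T -> #|e| = 2 -> e' \subset T' -> #|e'| = 2 ->
    w |: (e :|: e') \in D.
  move=> wnb eT e2 e'T' e'2; have [wD w5 wT wT'] := Fw w wnb.
  have wx x : x \in T -> w != x by move=> xT; apply: contraNneq wT => ->.
  have wx' x : x \in T' -> w != x by move=> xT; apply: contraNneq wT' => ->.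
  have swT s e1 : s \in D -> v \in s -> e1 \subset T -> #|e1| = 2 -> (s :\: T) :|: e1 \in D.
    by apply: light_swap.
  have swT' s e1 : s \in D -> a \in s -> e1 \subset T' -> #|e1| = 2 -> (s :\: T') :|: e1 \in D.
    by apply: light_swap.
  have A (t' : V) e1 : t' \in T' -> t' != v -> e1 \subset T -> #|e1| = 2 ->
      w |: (e1 :|: [set v; t']) \in D.
    move=> t'T' t'v e1T e12; have [vtT' vt2] := set2_sub vT' t'T' (ltac:(by rewrite eq_sym)).
    have h1 : (w |: r) :\: T' :|: [set v; t'] \in D.
      by apply: swT' => //; rewrite !inE eqxx !orbT.
    have h2 := swT _ e1 h1 (ltac:(by rewrite in_setU set21 orbT)) e1T e12.
    apply: sub h2 _; apply/subsetP=> x /setU1P[->|/setUP[xe|xvt]]; apply/setUP.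
    - by left; rewrite in_setD wT in_setU in_setD wT' setU11.
    - by right.
    left; have xT' : x \in T' by move: xvt => /set2P[]->.
    by rewrite in_setD (disT' _ xT') in_setU xvt orbT.
  have B (t : V) e1 : t \in T -> t != a -> e1 \subset T' -> #|e1| = 2 ->
      w |: ([set a; t] :|: e1) \in D.
    move=> tT ta e1T e12; have [atT at2] := set2_sub aT tT (ltac:(by rewrite eq_sym)).
    have h1 := A y _ yT' yv atT at2.
    have h2 := swT' _ e1 h1 (ltac:(by rewrite !inE eqxx !orbT)) e1T e12.
    apply: sub h2 _; apply/subsetP=> x /setU1P[->|/setUP[xat|xe]]; apply/setUP.
    - by left; rewrite in_setD wT' setU11.
    - have xT : x \in T by move: xat => /set2P[]->.
      by left; rewrite in_setD (disT _ xT) in_setU1 in_setU xat orbT.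
    by right.
  have [ve|ve] := boolP (v \in e').
    have /card_gt0P[t'] : 0 < #|e' :\ v|.
      by have := cardsD1 v e'; rewrite ve e'2 add1n => -[<-].
    rewrite in_setD1 => /andP[t'v t'e'].
    suff -> : e' = [set v; t'] by apply: A; rewrite // (subsetP e'T').
    apply/esym/eqP; rewrite eqEcard subUset !sub1set ve t'e' e'2 cards2.
    by rewrite (eq_sym v) t'v.
  have e'E : e' = [set y; z].
    apply/eqP; rewrite eqEcard e'2 cards2 yz andbT; apply/subsetP=> x xe.
    have := subsetP e'T' x xe; rewrite T'E !inE => /orP[/eqP xv|//].
    by rewrite xv (negPf ve) in xe.
  have [ae|ae] := boolP (a \in e).
    have /card_gt0P[t] : 0 < #|e :\ a|.
      by have := cardsD1 a e; rewrite ae e2 add1n => -[<-].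
    rewrite in_setD1 => /andP[ta te].
    suff -> : e = [set a; t] by apply: B; rewrite // (subsetP eT).
    apply/esym/eqP; rewrite eqEcard subUset !sub1set ae te e2 cards2.
    by rewrite (eq_sym a) ta.
  have eE : e = [set b; c].
    apply/eqP; rewrite eqEcard e2 cards2 bc andbT; apply/subsetP=> x xe.
    have := subsetP eT x xe; rewrite TE !inE => /orP[/eqP xa|//].
    by rewrite xa (negPf ae) in xe.
  rewrite eE e'E.
  have [bcT bc2] := set2_sub bT cT bc; have [yzT' yz2] := set2_sub yT' zT' yz.
  have hy := A y _ yT' yv bcT bc2; have hz := A z _ zT' zv bcT bc2.
  have hb := B b _ bT ba yzT' yz2; have hc := B c _ cT ca yzT' yz2.
  have [by_ bz] := (neq b y bT yT', neq b z bT zT').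
  have [cy cz] := (neq c y cT yT', neq c z cT zT').
  have four : [set b; c] :|: [set y; z] \in D.
    apply: (face_intro hD).
      rewrite cardsU bc2 yz2 (_ : _ :&: _ = set0) ?cards0 //.
      apply/eqP; rewrite setI_eq0; apply: disjointWl bcT _; exact: disjointWr yzT' _.
    move=> x; rewrite !inE => /orP[]/orP[]/eqP->.
    - by apply: sub hc _; subset_tac.
    - by apply: sub hb _; subset_tac.
    - by apply: sub hz _; subset_tac.
    by apply: sub hy _; subset_tac.
  apply: (face_intro hD).
    rewrite cardsU1 cardsU bc2 yz2 (_ : _ :&: _ = set0) ?cards0; last first.
      apply/eqP; rewrite setI_eq0; apply: disjointWl bcT _; exact: disjointWr yzT' _.
    by rewrite leq_addl.
  move=> x; rewrite !inE -!orbA => /orP[/eqP->|/or4P[]/eqP->].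
  - by apply: sub four _; subset_tac.
  - by apply: sub hc _; subset_tac.
  - by apply: sub hb _; subset_tac.
  - by apply: sub hz _; subset_tac.
  by apply: sub hy _; subset_tac.
pose U := T :|: T' :|: nb D r.
have U8 : #|U| <= 8.
  apply: leq_trans (leq_card_setU _ _) _; rewrite ridge_nb // addn2 !ltnS.
  by apply: leq_trans (leq_card_setU _ _) _; rewrite T3 T'3.
pose G := [set F in D | [&& #|F| == 5, #|F :&: T| == 2, #|F :&: T'| == 2 & F \subset U]].
suff allG F' : F' \in D -> #|F'| = 5 -> set0 \subset F' -> F' \in G.
  rewrite -cardsT (leq_trans _ U8) //; apply/subset_leq_card/subsetP=> x _.
  have [F' [F'D F'5 xF']] := face_facet hD (face1 hD x).
  have := allG F' F'D F'5 (sub0set _); rewrite inE => /and5P[_ _ _ _ /subsetP]; apply.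
  by apply: (subsetP xF'); rewrite inE.
apply: (facets_connected hD (face0 hD)).
- by rewrite cards0.
- have pnb : p \in nb D r by rewrite nbE !inE eqxx.
  have [pD p5 _ _] := Fw p pnb; apply/set0Pn; exists (p |: r).
  have [pv pa] : v \in p |: r /\ a \in p |: r by rewrite !inE !eqxx !orbT.
  rewrite inE pD p5 (facet_light lv) // (facet_light la) //=.
  apply/subsetP=> x; rewrite /U => /setU1P[->|]; first by rewrite in_setU pnb orbT.
  rewrite !inE -!orbA => /or4P[]/eqP->; rewrite ?aT ?bT ?vT' ?yT' ?orbT //.
- by move=> {}F'; rewrite inE => /andP[F'D /andP[/eqP F'5 _]]; rewrite sub0set.
move=> {}F' x; rewrite inE => /and5P[F'D /eqP F'5 /eqP FT2 /eqP FT'2 FU] xF _.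
have [w wE] : exists w, F' = w |: ((F' :&: T) :|: (F' :&: T')) /\ w \in nb D r.
  have dFT : (F' :&: T) :&: (F' :&: T') = set0.
    apply/setP=> s; rewrite !in_setI in_set0; apply/negP=> /andP[/andP[_ sT] /andP[_ sT']].
    by rewrite (negPf (disT _ sT)) in sT'.
  have FTT : (F' :&: T) :|: (F' :&: T') \subset F' by rewrite subUset !subsetIl.
  have c4 : #|(F' :&: T) :|: (F' :&: T')| = 4 by rewrite cardsU dFT FT2 FT'2 cards0.
  have /cards1P[w wE] : #|F' :\: ((F' :&: T) :|: (F' :&: T'))| == 1.
    by rewrite cardsD (setIidPr FTT) F'5 c4.
  exists w; split.
    by rewrite -wE -{1}(setID F' ((F' :&: T) :|: (F' :&: T'))) (setIidPr FTT) setUC.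
  have : w \in F' :\: ((F' :&: T) :|: (F' :&: T')) by rewrite wE set11.
  rewrite in_setD in_setU !in_setI => /andP[+ wF]; rewrite wF /= => wTT.
  by have := subsetP FU w wF; rewrite /U 2!in_setU (negPf wTT).
case: wE => FE wnb; have [wD w5 wT wT'] := Fw w wnb.
have build w' e e' : w' \in nb D r -> e \subset T -> #|e| = 2 -> e' \subset T' -> #|e'| = 2 ->
    w' |: (e :|: e') \in G.
  move=> w'nb eT e2 e'T' e'2; have [w'D w'5 w'T w'T'] := Fw w' w'nb.
  have deT : e :&: T' = set0.
    by apply/eqP; rewrite setI_eq0; apply: disjointWl eT _.
  have deT' : e' :&: T = set0.
    by apply/eqP; rewrite setI_eq0 disjoint_sym; apply: disjointWr e'T' _.
  have w0 : [set w'] :&: T = set0 by apply/eqP; rewrite setI_eq0 disjoints1.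
  have w0' : [set w'] :&: T' = set0 by apply/eqP; rewrite setI_eq0 disjoints1.
  rewrite inE joinD // !setIUl w0 w0' deT deT' !set0U setU0 (setIidPl eT) (setIidPl e'T') e2 e'2 /=.
  have dee : e :&: e' = set0 by apply/eqP; rewrite -subset0 -deT setIS.
  rewrite cardsU1 cardsU dee e2 e'2 cards0 in_setU negb_or.
  rewrite (contra (subsetP eT w')) // (contra (subsetP e'T' w')) //=.
  rewrite !subUset sub1set /U 2!in_setU w'nb orbT /=; apply/andP; split.
    by apply: subset_trans eT _; rewrite -setUA subsetUl.
  by apply: subset_trans e'T' _; rewrite setUAC subsetUr.
have repl S e : #|S| = 3 -> e \subset S -> #|e| = 2 -> x \in e -> exists y',
    [/\ y' \in S, y' \notin e, y' |: (e :\ x) \subset S & #|y' |: (e :\ x)| = 2].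
  move=> S3 eS e2 xe; have [y' [y'S y'e SE]] := card_pair_compl S3 eS e2.
  exists y'; split=> //.
    rewrite subUset sub1set y'S; exact: subset_trans (subsetDl _ _) eS.
  by rewrite cardsU1 in_setD1 (negPf y'e) andbF; have := cardsD1 x e; rewrite xe e2 => <-.
have finish y' w' e e' : y' |: (F' :\ x) = w' |: (e :|: e') -> y' \notin F' ->
    w' \in nb D r -> e \subset T -> #|e| = 2 -> e' \subset T' -> #|e'| = 2 ->
    exists y'', [/\ y'' != x, y'' \notin F' & y'' |: (F' :\ x) \in G].
  move=> E y'F h1 h2 h3 h4 h5; exists y'; split=> //.
    by apply: contraNneq y'F => ->.
  by rewrite E; apply: build.
have [xT|xT] := boolP (x \in T).
  have xe : x \in F' :&: T by rewrite in_setI xF.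
  have [y' [y'T y'e e1 e2]] := repl T _ T3 (subsetIr F' T) FT2 xe.
  apply: (finish y' w (y' |: ((F' :&: T) :\ x)) (F' :&: T')) => //; last first.
  - exact: subsetIr.
  - by move: y'e; rewrite in_setI y'T andbT.
  rewrite {1}FE; apply/setP=> s; rewrite !inE.
  case: (eqVneq s y') => [->|_]; rewrite ?orbT //=.
  case: (eqVneq s x) => [->|_] //=.
  by rewrite (negPf (disT _ xT)) !andbF !orbF; apply/esym/negbTE; apply: contraTneq xT => ->.
have [xT'|xT'] := boolP (x \in T').
  have xe : x \in F' :&: T' by rewrite in_setI xF.
  have [y' [y'T y'e e1 e2]] := repl T' _ T'3 (subsetIr F' T') FT'2 xe.
  apply: (finish y' w (F' :&: T) (y' |: ((F' :&: T') :\ x))) => //; last first.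
  - exact: subsetIr.
  - by move: y'e; rewrite in_setI y'T andbT.
  rewrite {1}FE; apply/setP=> s; rewrite !inE.
  case: (eqVneq s y') => [->|_]; rewrite ?orbT //=.
  case: (eqVneq s x) => [->|_] //=.
  by rewrite (negPf xT) !andbF !orbF; apply/esym/negbTE; apply: contraTneq xT' => ->.
have xw : x = w.
  move: xF; rewrite FE !inE (negPf xT) (negPf xT') !andbF !orbF => /eqP//.
have [w' w'nb w'w] : exists2 w', w' \in nb D r & w' != w.
  move: (wnb); rewrite nbE !inE => /orP[]/eqP->.
    by exists q; rewrite ?inE ?eqxx ?orbT // eq_sym.
  by exists p; rewrite ?inE ?eqxx.
have [_ _ w'T w'T'] := Fw w' w'nb.
have w'F : w' \notin F'.
  by rewrite FE !inE (negPf w'w) (negPf w'T) (negPf w'T') !andbF.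
apply: (finish w' w' (F' :&: T) (F' :&: T')) => //; try exact: subsetIr.
rewrite {1}FE xw setU1K // in_setU !in_setI (negPf wT) (negPf wT') !andbF //.
Qed.

(** Move a facet at v by T to one through a, exchange T' there, and move T back; as T and T' are
    disjoint, the two exchanges do not interfere. *)
Lemma light_transfer v a T T' : light v T -> light a T' -> a \in T -> v \notin T' -> light v T'.
Proof.
move=> lv la aT vT'; have [T3 vT _ _] := lv; have [T'3 aT' _ _] := la.
have dis := light_disjoint lv la aT.
have disT x : x \in T -> x \notin T' by move=> xT; rewrite (disjointFr dis).
have disT' x : x \in T' -> x \notin T by move=> xT'; rewrite (disjointFl dis).
have [b [c [ba ca bc TE]]] := card3_split T3 aT.
have abT : [set a; b] \subset T by rewrite TE; subset_tac.
have ab2 : #|[set a; b]| = 2 by rewrite cards2 eq_sym ba.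
split=> // [F FD F5 vF|F e' FD F5 vF e'T' e'2];
  have [F1D F15 F1T F1dT] := swap_parts lv FD F5 vF abT ab2;
  set F1 := (F :\: T) :|: [set a; b] in F1D F15 F1T F1dT;
  have aF1 : a \in F1 by [rewrite in_setU set21 orbT].
  rewrite -(facet_light la F1D F15 aF1); congr #|pred_of_set _|.
  apply/setP=> x; rewrite !in_setI; have [xT'|] := boolP (x \in T'); rewrite ?andbF //.
  by have := in_setD F1 T x; rewrite F1dT in_setD (disT' _ xT') /= => <-.
have vF1 : v \in F1 by rewrite in_setU in_setD vF vT.
have F2D := light_swap la F1D aF1 e'T' e'2.
set F2 := (F1 :\: T') :|: e' in F2D.
have vF2 : v \in F2 by rewrite in_setU in_setD vF1 vT'.
have F3D := light_swap lv F2D vF2 (subsetIr F T) (facet_light lv FD F5 vF).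
apply: sub F3D _; apply/subsetP=> x /setUP[/setDP[xF xT']|xe'].
  have [xT|xT] := boolP (x \in T); first by rewrite in_setU in_setI xF xT orbT.
  by rewrite in_setU in_setD xT in_setU in_setD xT' in_setU in_setD xT xF.
have xT := disT' _ (subsetP e'T' _ xe').
by rewrite in_setU in_setD xT in_setU xe' orbT.
Qed.

Definition good v T := light v T /\ forall a T', a \in T -> ~ light a T'.

(** One replacement suffices. If T contains a light a with triangle T', then T' serves v too. A
    light w in T' with triangle T'' would give T'' = T by [light_agree], so a and w would lie in
    each other's triangles, against [light_cross]. *)
Lemma light_good v : 8 < #|V| -> (exists T, light v T) -> exists T, good v T.
Proof.
move=> V8 [T lv].
have [[a [T' [aT la]]]|h] := classic (exists a T', a \in T /\ light a T'); last first.
  by exists T; split=> // a T' aT la; apply: h; exists a, T'.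
have cross u w S S' : light u S -> light w S' -> w \in S -> u \notin S'.
  by move=> lu lw wS; apply: contraTN V8 => uS'; rewrite -leqNgt; apply: light_cross lu lw wS uS'.
have vT' := cross _ _ _ _ lv la aT.
have lvT' := light_transfer lv la aT vT'; have dis := light_disjoint lv la aT.
exists T'; split=> // w T'' wT' lw.
have vT'' := cross _ _ _ _ lvT' lw wT'.
have wT : w \notin T by rewrite (disjointFl dis).
have [_ vnT' _ _] := lvT'.
have wv : w != v by apply: contraNneq vnT' => <-.
have TE := light_agree lv lw wv (light_edge lvT' wT') wT vT''.
have aw := cross _ _ _ _ la lw wT'.
by rewrite -TE aT in aw.
Qed.
End LightPairs.

(** * Face numbers *)

Section FaceNumbers.
Variables (V : finType) (D : {set {set V}}).
Implicit Types (s t F e T S : {set V}) (x y a b c u v w : V).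
Hypothesis hD : sphere_class 2 4 D.
Local Notation light := (light D).
Let sub s t : s \in D -> t \subset s -> t \in D. Proof. exact: face_sub. Qed.

Lemma nb0 : nb D set0 = setT.
Proof. by apply/setP=> x; rewrite !inE setU0 (face1 hD). Qed.

Lemma sum_up k : \sum_x #|up D [set x] k| = k.+1 * #|up D set0 k.+1|.
Proof.
rewrite -(double_count sub) nb0. apply: eq_big => [x|x _]; first by rewrite inE.
by rewrite setU0.
Qed.

Lemma vertex_up v : #|up D [set v] 3| + 2 * #|nb D [set v]| = 2 * #|up D [set v] 2| /\
  2 * #|up D [set v] 4| = #|up D [set v] 3|.
Proof.
have ed x : x \in nb D [set v] -> 3 * #|up D (x |: [set v]) 3| = 2 * #|up D (x |: [set v]) 2| /\
    #|up D (x |: [set v]) 2| + 6 = 3 * #|up D (x |: [set v]) 1|.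
  rewrite !inE => /andP[xv xD].
  by rewrite (up1 sub) //; apply: euler2 => //; rewrite cardsU1 inE xv cards1.
have h1 : 3 * (4 * #|up D [set v] 4|) = 2 * (3 * #|up D [set v] 3|).
  by rewrite -!(double_count sub) !big_distrr /=; apply: eq_bigr => x /ed[].
have h2 : 3 * #|up D [set v] 3| + 6 * #|nb D [set v]| = 3 * (2 * #|up D [set v] 2|).
  rewrite -!(double_count sub) big_distrr /= mulnC -sum_nat_const -big_split /=.
  by apply: eq_bigr => x /ed[].
by split; lia.
Qed.

(** The Dehn-Sommerville relation f_2 = 4 f_1 - 10 f_0 + 20, obtained from the relations in the
    vertex links and Euler's relation for D. *)
Lemma euler_f3 : #|up D set0 3| + 10 * #|V| = 4 * #|up D set0 2| + 20.
Proof.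
have s1 := sum_up 1; have s2 := sum_up 2; have s3 := sum_up 3; have s4 := sum_up 4.
have e1 : \sum_x #|up D [set x] 1| = \sum_x #|nb D [set x]|.
  by apply: eq_bigr => x _; rewrite (up1 sub) // (face1 hD).
have e2 : \sum_x #|up D [set x] 3| + 2 * \sum_x #|nb D [set x]| = 2 * \sum_x #|up D [set x] 2|.
  by rewrite !big_distrr -big_split /=; apply: eq_bigr => x _; have [] := vertex_up x.
have e3 : 2 * \sum_x #|up D [set x] 4| = \sum_x #|up D [set x] 3|.
  by rewrite big_distrr /=; apply: eq_bigr => x _; have [] := vertex_up x.
have := euler_link (N := 5) hD (face0 hD); rewrite cards0 => /(_ (erefl _)).
rewrite !big_ord_recl big_ord0 /= /bump /= (up0 (face0 hD)) (up1 sub (face0 hD)) nb0 cardsT.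
move: s1 s2 s3 s4 e1 e2 e3; clear.
move: (#|V|) (#|up D set0 2|) (#|up D set0 3|) (#|up D set0 4|) (#|up D set0 5|).
move: (\sum_x _) (\sum_x _) (\sum_x _) (\sum_x _) (\sum_x _).
move=> i1 i2 i3 i4 i5 F1 F2 F3 F4 F5.
rewrite !exprS expr0; lia.
Qed.

(** Summed over v, m - 4n + 10 gives 3 f_2 - 8 f_1 + 10 f_0, which [euler_f3] turns into 4 f_1 - 20
    f_0 + 60, that is 4 g_2. *)
Lemma heavy_sum (L : {set V}) :
  (forall v, v \notin L -> 4 * #|nb D [set v]| + 2 <= #|up D [set v] 2| + 10) ->
  22 * #|V| <= 4 * #|up D set0 2| + 60 + #|L|.
Proof.
move=> heavy; have s1 := sum_up 1; have s2 := sum_up 2; have f3 := euler_f3.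
have e1 : \sum_x #|up D [set x] 1| = \sum_x #|nb D [set x]|.
  by apply: eq_bigr => x _; rewrite (up1 sub) // (face1 hD).
have : \sum_x (4 * #|nb D [set x]| + 2) <= \sum_x (#|up D [set x] 2| + 10 + (x \in L)).
  apply: leq_sum => x _; have [h _] := light_or_heavy hD x.
  by case: (boolP (x \in L)) => [_|/heavy]; move: h; clear; lia.
have e4 : \sum_x 4 * #|nb D [set x]| = 4 * \sum_x #|nb D [set x]| by rewrite big_distrr.
have eL : \sum_x (x \in L) = #|L| by rewrite -big_mkcond sum1_card.
have eR : \sum_x (#|up D [set x] 2| + 10 + (x \in L)) =
    \sum_x #|up D [set x] 2| + #|V| * 10 + #|L|.
  by rewrite -eL -sum_nat_const -!big_split.
have eQ : \sum_x (4 * #|nb D [set x]| + 2) = \sum_x 4 * #|nb D [set x]| + #|V| * 2.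
  by rewrite -sum_nat_const -big_split.
rewrite eR eQ e4 -e1 s1 s2.
by move: f3; clear; move: (#|V|) (#|up D set0 2|) (#|up D set0 3|) (#|L|); lia.
Qed.

End FaceNumbers.

(** The chain w plus the cone from c over its boundary. At ridges through c the sum vanishes because
    the boundary of w is itself a cycle. *)
Lemma cone_cyc (V : finType) d (w : {set V} -> bool) (c : V) :
  (forall t : {set V}, w t -> #|t| = d /\ c \notin t) ->
  cyc d [set t : {set V} | (#|t| == d) && (if c \in t then bd w (t :\ c) else w t)].
Proof.
move=> wd; split=> [t|r rd]; first by rewrite inE => /andP[/eqP].
have size x : x \notin r -> #|x |: r| == d by move=> xr; rewrite cardsU1 xr add1n rd.
have [cr|cr] := boolP (c \in r); last first.
  rewrite (bd1 _ cr) inE (size c cr) setU11 setU1K //=.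
  rewrite (bd1 _ cr) (_ : w (c |: r) = false) /=; last first.
    by apply/negP=> /wd[_]; rewrite setU11.
  set A := \big[_/_]_(_ | _) _; set B := \big[_/_]_(_ | _) _.
  suff -> : A = B by rewrite addbb.
  apply: eq_bigr => y /andP[yr yc]; rewrite inE (size y yr) in_setU1 eq_sym (negPf yc) (negPf cr).
  by [].
pose r' := r :\ c.
have cr' : c \notin r' by rewrite setD11.
have rE : r = c |: r' by rewrite setD1K.
have inr' y : (y \notin r') = (y \notin r) || (y == c).
  by rewrite in_setD1 negb_and negbK orbC.
transitivity (\big[addb/false]_(x | x \notin r') \big[addb/false]_(y | (y \notin r') && (y != x))
    w (y |: (x |: r'))); last first.
  by apply: big_addb_sym => x y; rewrite setUCA.
rewrite [RHS](bigD1 c) //= [X in _ = X (+) _]big1 ?addFb; last first.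
  move=> y /andP[yr yc]; apply/negP=> /wd[_]; rewrite !inE eqxx orbT //.
rewrite /bd; apply: eq_big => [x|x xr].
  by rewrite inr'; case: (eqVneq x c) => [->|]; rewrite ?cr ?orbF ?andbT.
have xc : x != c by apply: contraNneq xr => ->.
rewrite inE (size x xr) in_setU1 cr orbT /=.
have -> : (x |: r) :\ c = x |: r' by rewrite /r' setDUl (setDidPl _) // disjoints1 inE.
by apply: eq_bigl => y; rewrite in_setU1 negb_or andbC.
Qed.

(** * The exceptional case: D is a join with the boundary of T *)

Section Exceptional.
Variables (V : finType) (D : {set {set V}}).
Implicit Types (s t F e T S : {set V}) (x y a b c u v w : V).
Hypothesis hD : sphere_class 2 4 D.
Local Notation light := (light D).
Let sub s t : s \in D -> t \subset s -> t \in D. Proof. exact: face_sub. Qed.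

Section Pair.
Variables (T : {set V}) (a b c v : V).
Hypotheses (lv : light v T) (TE : T = c |: [set a; b]) (ab : a != b) (ca : c != a) (cb : c != b).
Let s := [set a; b].
Let S := skel (link D s) 3.

Lemma pair_facts : [/\ s \in D, #|s| = 2, c \notin nb D s & v \in nb D s].
Proof.
have sT : s \subset T by rewrite TE subsetUr.
have s2 : #|s| = 2 by rewrite cards2 ab.
have vsD := light_pair hD lv sT s2.
have [_ vT _ _] := lv; split=> //.
- by apply: sub vsD _; rewrite subsetUr.
- by rewrite inE negb_and -TE (light_missing hD lv) orbT.
by rewrite inE vsD andbT; apply: contra vT; apply: (subsetP sT).
Qed.

Lemma link_tri t : t \in S -> [/\ #|t| = 3, t :|: s \in D & [disjoint t & T]].
Proof.
rewrite inE (in_link sub) => /andP[/andP[tD dis] /eqP t3]; split=> //.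
have [_ _ cn _] := pair_facts.
suff ct : c \notin t.
  rewrite TE disjoint_sym disjoints_subset subUset sub1set in_setC ct -disjoints_subset.
  by rewrite disjoint_sym.
apply: contra cn => ct.
rewrite inE; apply/andP; split; first by rewrite !inE negb_or ca cb.
by apply: sub tD _; apply: setSU; rewrite sub1set.
Qed.

Lemma tri_swap t w e : t \in S -> w \in t -> light w T -> e \subset T -> #|e| = 2 ->
  t :|: e \in D.
Proof.
move=> tS wt lw eT e2; have [t3 tD dis] := link_tri tS.
have h := light_swap hD lw tD (subsetP (subsetUl _ _) _ wt) eT e2.
apply: sub h _; apply: setSU; apply/subsetP=> x xt.
by rewrite in_setD (disjointFr dis xt) in_setU xt.
Qed.

Hypothesis meets : forall t, t \in S -> exists2 w, w \in t & light w T.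

(** Each triangle t of S contains a vertex that is light with triangle T, so every pair e of T
    completes t to a facet. These facets are closed under crossing ridges, hence are all facets. *)
Lemma exceptional_facet F : F \in D -> #|F| = 5 -> #|F :&: T| = 2 /\ F :\: T \in S.
Proof.
move=> FD F5; have [sD s2 cn vn] := pair_facts; have [T3 vT _ _] := lv.
have sT : s \subset T by rewrite TE subsetUr.
pose G := [set F in D | [&& #|F| == 5, #|F :&: T| == 2 & F :\: T \in S]].
suff : F \in G by rewrite inE => /and4P[_ _ /eqP].
apply: (facets_connected hD (face0 hD) (G := G)); rewrite ?sub0set ?cards0 //.
- have [F0 [F0D F05 sF0]] := face_facet hD sD; apply/set0Pn; exists F0.
  have cF0 : c \notin F0.
    apply: contra (light_missing hD lv) => cF0; apply: sub F0D _.
    by rewrite TE subUset sub1set cF0.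
  have FT : F0 :&: T = s.
    by rewrite TE setIUr (setIidPr sF0) (_ : _ :&: _ = set0) ?set0U //; apply/eqP;
      rewrite setI_eq0 disjoint_sym disjoints1.
  have F0T : F0 :\: T :|: s = F0 by rewrite -FT setUC setID.
  have F0T3 : #|F0 :\: T| = 3 by rewrite cardsD FT F05 s2.
  rewrite inE F0D F05 FT s2 eqxx /= inE (in_link sub) F0T F0D F0T3 eqxx andbT /=.
  by rewrite disjoint_sym disjoints_subset; apply/subsetP=> x xs; rewrite !inE (subsetP sT).
- by move=> F'; rewrite inE => /and4P[-> /eqP-> _ _]; rewrite sub0set.
move=> F' x; rewrite inE => /and4P[F'D /eqP F'5 /eqP F'2 F'S] xF _.
have [t3 tD tdis] := link_tri F'S.
have build t e : t \in S -> e \subset T -> #|e| = 2 -> t :|: e \in G.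
  move=> tS eT e2; have [w wt lw] := meets tS; have [t3' _ tdis'] := link_tri tS.
  have tT : t :&: T = set0 by apply/eqP; rewrite setI_eq0.
  rewrite inE (tri_swap tS wt lw eT e2) setIUl tT set0U (setIidPl eT) e2 eqxx /=.
  rewrite setDUl (_ : e :\: T = set0) ?setU0 ?(setDidPl tdis') ?tS ?andbT; last first.
    by apply/eqP; rewrite setD_eq0.
  rewrite cardsU t3' e2 (_ : t :&: e = set0) ?cards0 //.
  by apply/eqP; rewrite -subset0 -tT; apply: setIS.
have F'E : F' = (F' :\: T) :|: (F' :&: T) by rewrite setUC setID.
have [xT|xT] := boolP (x \in T).
  have [y [yT yF TE']] := card_pair_compl T3 (subsetIr F' T) F'2.
  have yF' : y \notin F' by move: yF; rewrite in_setI yT andbT.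
  have yx : y != x by apply: contraNneq yF' => ->.
  exists y; split=> //.
  have -> : y |: (F' :\ x) = (F' :\: T) :|: (y |: ((F' :&: T) :\ x)).
    apply/setP=> z; rewrite !inE; case: (eqVneq z y) => [->|_]; rewrite ?orbT //=.
    by case: (eqVneq z x) => [->|_]; rewrite /= ?xT //; case: (z \in T); rewrite ?andbT ?andbF ?orbF.
  apply: build => //.
    by rewrite subUset sub1set yT (subset_trans (subsetDl _ _)) ?subsetIr.
  rewrite cardsU1 in_setD1 (negPf yF) andbF.
  by have := cardsD1 x (F' :&: T); rewrite F'2 in_setI xF xT => <-.
have xFT : x \in F' :\: T by rewrite in_setD xT.
have s5 : #|s| + 3 = 5 by rewrite s2.
have [y [yx yF yS]] := skel_link_adj hD s5 F'S xFT.
have [_ _ ydis] := link_tri yS.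
have yT : y \notin T by rewrite (disjointFr ydis) ?setU11.
exists y; split=> //; first by move: yF; rewrite in_setD yT.
have -> : y |: (F' :\ x) = (y |: ((F' :\: T) :\ x)) :|: (F' :&: T).
  apply/setP=> z; rewrite !inE; case: (eqVneq z y) => [->|_] //=.
  by case: (eqVneq z x) => [->|_]; rewrite /= ?(negPf xT) ?andbF //; case: (z \in T);
    rewrite ?andbT ?andbF ?orbF.
by apply: build => //; apply: subsetIr.
Qed.

Lemma exceptional_cover : #|V| <= #|nb D s| + 3.
Proof.
have [sD s2 cn vn] := pair_facts; have [T3 vT _ _] := lv.
rewrite -T3 -cardsT; apply: leq_trans (leq_card_setU _ _); apply/subset_leq_card/subsetP=> x _.
have [F [FD F5 xF]] := face_facet hD (face1 hD x); rewrite sub1set in xF.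
have [_ FS] := exceptional_facet FD F5; have [xT|xT] := boolP (x \in T).
  by rewrite in_setU xT orbT.
rewrite in_setU -(link_cover hD (N := 3)) ?s2 //; apply/orP; left; apply/bigcupP.
by exists (F :\: T); rewrite // in_setD xT.
Qed.

(** In the join of the boundary of T with a 2-sphere on k vertices there are 3 + 3k + (3k - 6)
    edges. *)
Lemma exceptional_edges : 6 * #|nb D s| <= #|up D set0 2| + 3.
Proof.
have [sD s2 cn vn] := pair_facts; have [T3 vT _ _] := lv.
have nbP x : x \in nb D s -> exists t, t \in S /\ x \in t.
  rewrite -(link_cover hD (N := 3)) ?s2 // => /bigcupP[t tS xt].
  by exists t.
have nbT x : x \in nb D s -> x \notin T.
  by move=> /nbP[t [tS xt]]; have [_ _ dis] := link_tri tS; rewrite (disjointFr dis).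
pose A := [set e : {set V} | (e \subset T) && (#|e| == 2)].
pose B := [set [set p.1; p.2] | p in setX (nb D s) T].
pose C := skel (link D s) 2.
have cC : #|C| + 6 = 3 * #|nb D s|.
  by rewrite (card_skel_link sub); have [] := euler2 hD sD s2.
have cA : #|A| = 3 by rewrite cards_draws T3.
have inj : {in setX (nb D s) T &, injective (fun p : V * V => [set p.1; p.2])}.
  move=> [x y] [x' y']; rewrite !in_setX /= => /andP[/nbT xT yT] /andP[/nbT x'T y'T] E.
  have xx : x = x'.
    have : x \in [set x'; y'] by rewrite -E set21.
    by rewrite in_set2 => /orP[/eqP//|/eqP xy]; rewrite xy y'T in xT.
  have yy : y = y'.
    have : y \in [set x'; y'] by rewrite -E set22.
    by rewrite in_set2 => /orP[/eqP xy|/eqP//]; rewrite xy (negPf x'T) in yT.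
  by rewrite xx yy.
have cB : #|B| = 3 * #|nb D s| by rewrite card_in_imset // cardsX T3 mulnC.
have AT e : e \in A -> #|e :&: T| = 2.
  by rewrite inE => /andP[/setIidPl-> /eqP].
have BT e : e \in B -> #|e :&: T| = 1.
  case/imsetP=> -[x y]; rewrite in_setX /= => /andP[/nbT xT yT] ->.
  rewrite (_ : _ :&: _ = [set y]) ?cards1 //; apply/setP=> z; rewrite !inE.
  case: (eqVneq z x) => [->|_]; first rewrite (negPf xT) /=.
    by apply/esym/negbTE; apply: contraNneq xT => ->.
  by case: (eqVneq z y) => [->|].
have CT e : e \in C -> #|e :&: T| = 0.
  move=> eC; apply/eqP; rewrite cards_eq0 -subset0; apply/subsetP=> z; rewrite in_setI => /andP[ze].
  have : z \in nb D s.
    move: eC; rewrite inE (in_link sub) => /andP[/andP[eD dis] _].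
    rewrite inE (disjointFr dis ze) /=; apply: sub eD _.
    by apply: setSU; rewrite sub1set.
  by move=> /nbT/negPf->.
have dAB : A :&: B = set0.
  by apply/setP=> e; rewrite !in_set0 in_setI; apply/negP=> /andP[/AT + /BT] => ->.
have dABC : (A :|: B) :&: C = set0.
  apply/setP=> e; rewrite !in_set0 in_setI in_setU; apply/negP.
  by move=> /andP[/orP[/AT|/BT] + /CT] => ->.
have cAll : #|A :|: B :|: C| + 3 = 6 * #|nb D s|.
  rewrite cardsU dABC cardsU dAB !cards0 cA cB.
  by move: cC; clear; move: (#|C|) (#|_|); lia.
rewrite -cAll leq_add2r; apply/subset_leq_card/subsetP=> e.
suff h : e \in A :|: B :|: C -> (e \in D) && (#|e| == 2).
  by move=> /h; rewrite [in X in _ -> X]inE sub0set cards0.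
move=> /setUP[/setUP[]|].
- rewrite inE => /andP[eT e2]; rewrite e2 andbT.
  by apply: sub (light_pair hD lv eT (eqP e2)) _; apply: subsetUr.
- case/imsetP=> -[x y]; rewrite in_setX /= => /andP[xn yT] ->.
  have [t [tS xt]] := nbP x xn; have [w wt lw] := meets tS.
  have [y' [y'y [_ y'T]]] : exists y', y' != y /\ (y \in T /\ y' \in T).
    have [b' [c' [b'y _ _ TE']]] := card3_split T3 yT.
    by exists b'; rewrite b'y yT TE' !inE eqxx orbT.
  have yyT : [set y; y'] \subset T by rewrite subUset !sub1set yT.
  have yy2 : #|[set y; y']| = 2 by rewrite cards2 eq_sym y'y.
  have h := tri_swap tS wt lw yyT yy2; apply/andP; split.
    by apply: sub h _; rewrite subUset !sub1set !inE xt eqxx !orbT.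
  rewrite cards2 (_ : x != y) //; apply: contraNneq (nbT x xn) => ->.
  exact: yT.
rewrite inE (in_link sub) => /andP[/andP[eD _] ->]; rewrite andbT.
by apply: sub eD _; apply: subsetUl.
Qed.

(** The two counts give f_1 >= 6 f_0 - 21, which is enough for f_0 >= 8; for smaller f_0,
    [heavy_sum] with every vertex in L is enough. *)
Lemma exceptional_bound : 27 * #|V| <= 5 * #|up D set0 2| + 81.
Proof.
have := exceptional_cover; have := exceptional_edges.
have := heavy_sum hD (L := setT); rewrite cardsT => /(_ _)/=.
move=> h1 h2 h3; have {}h1 := h1 (fun v : V => ltac:(by rewrite inE)).
by move: h1 h2 h3; clear; move: (#|V|) (#|_|) (#|_|) => i j k; lia.
Qed.
End Pair.
End Exceptional.

(** * Deleting the spokes *)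

Section Deletion.
Variables (V : finType) (D : {set {set V}}).
Implicit Types (s t F e T S : {set V}) (x y a b c u v w : V).
Hypothesis hD : sphere_class 2 4 D.
Local Notation light := (light D).
Let sub s t : s \in D -> t \subset s -> t \in D. Proof. exact: face_sub. Qed.

Variables (L : {set V}) (tau : V -> {set V}) (kap : {set V} -> V).
Hypotheses (Ll : forall v, v \in L -> light v (tau v))
  (Lt : forall v x, v \in L -> x \in tau v -> x \notin L)
  (Lk : forall v, v \in L -> kap (tau v) \in tau v).

(** Since [kap] depends on the triangle alone, all vertices of L with the same triangle lose their
    edge to the same vertex. *)
Definition spokes : {set {set V}} := [set [set kap (tau v); v] | v in L].

Lemma spokesP x y : [set x; y] \in spokes ->
  (y \in L /\ x = kap (tau y)) \/ (x \in L /\ y = kap (tau x)).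
Proof.
case/imsetP=> v vL E.
have kL : kap (tau v) \notin L by apply: Lt (Lk vL).
have kv : kap (tau v) != v by apply: contraNneq kL => ->.
have xE : x \in [set kap (tau v); v] by rewrite -E set21.
have yE : y \in [set kap (tau v); v] by rewrite -E set22.
have kE : kap (tau v) \in [set x; y] by rewrite E set21.
have vE : v \in [set x; y] by rewrite E set22.
case/set2P: xE => xE; case/set2P: yE => yE.
- by move: vE; rewrite xE yE !inE orbb eq_sym (negPf kv).
- by left; rewrite yE.
- by right; rewrite xE.
by move: kE; rewrite xE yE !inE orbb (negPf kv).
Qed.

Lemma card_spokes : #|spokes| = #|L|.
Proof.
apply: card_in_imset => v v' vL v'L E.
have kL : kap (tau v') \notin L by apply: Lt (Lk v'L).
have : v \in [set kap (tau v'); v'] by rewrite -E set22.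
by rewrite in_set2 => /orP[/eqP k|/eqP//]; rewrite -k vL in kL.
Qed.

Local Notation G := (skel (link D set0) 2).

Lemma inG x y : ([set x; y] \in G) = (x != y) && ([set x; y] \in D).
Proof.
rewrite inE (in_link sub) setU0 disjoint_sym disjoints_subset sub0set andbT cards2 andbC.
by case: (x != y).
Qed.

Section Key.
Variables (T : {set V}) (a b c v : V).
Hypotheses (vL : v \in L) (Tv : tau v = T) (TE : T = c |: [set a; b]) (ab : a != b)
  (ca : c != a) (cb : c != b) (kc : kap T = c).
Let s := [set a; b].
Let S := skel (link D s) 3.
Let K := [set u in L | tau u == T].
Hypothesis miss : exists2 t, t \in S & [disjoint t & K].

Let lv : light v T. Proof. by rewrite -Tv; apply: Ll. Qed.
Let DK := [set t in S | ~~ [disjoint t & K]].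
Let w t := t \in DK.
(** [DK] closed up to a 2-cycle by the cone from c over its boundary. The vertices of [K] are
    interior to [DK], so no triangle of Z joins them to c. *)
Let Z := [set t : {set V} | (#|t| == 3) && (if c \in t then bd w (t :\ c) else w t)].

Lemma TL x : x \in T -> x \notin L. Proof. by rewrite -Tv; apply: Lt. Qed.

Lemma DKP t : t \in DK -> t \in S /\ exists2 u, u \in t & u \in K.
Proof.
rewrite inE => /andP[tS]; rewrite -setI_eq0 => /set0Pn[u]; rewrite in_setI => /andP[ut uK].
by split=> //; exists u.
Qed.

Lemma in_DK t u : t \in S -> u \in t -> u \in K -> t \in DK.
Proof.
move=> tS ut uK; rewrite inE tS -setI_eq0; apply/set0Pn; exists u.
by rewrite in_setI ut.
Qed.

Lemma KP u : u \in K -> [/\ u \in L, tau u = T & light u T].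
Proof. by rewrite inE => /andP[uL /eqP e]; split; rewrite // -e; apply: Ll. Qed.

Lemma link_tri' t : t \in S -> [/\ #|t| = 3, t :|: s \in D & [disjoint t & T]].
Proof. exact: (link_tri hD lv TE ab ca cb). Qed.

(** Such an x is equal or adjacent to a vertex of [K], so [light_agree] gives it the triangle T. Its
    deleted edge therefore goes to c, and no edge within [DK] is a spoke. *)
Lemma DK_light t x : t \in DK -> x \in t -> x \in L -> x \in K.
Proof.
move=> /DKP[tS [u ut uK]] xt xL; have [uL tu lu] := KP uK.
have [xu|xu] := eqVneq x u; first by rewrite xu.
have [_ tD _] := link_tri' tS.
rewrite inE xL; apply/eqP/esym; apply: (light_agree hD lu (Ll xL) xu).
- by apply: sub tD _; rewrite subUset !sub1set !in_setU xt ut.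
- by apply: contraTN xL; apply: TL.
by apply: contraTN uL; apply: Lt.
Qed.

Lemma c_notin t : t \in S -> c \notin t.
Proof. by move=> /link_tri'[_ _ dis]; rewrite (disjointFl dis) // TE setU11. Qed.

Lemma Z_cyc : cyc 3 Z.
Proof.
apply: cone_cyc => t /DKP[tS _]; split; last exact: c_notin.
by have [] := link_tri' tS.
Qed.

(** All triangles of [S] around a vertex u of [K] belong to [DK]; an edge of [S] through u is thus
    not on the boundary of [DK], and no cone triangle contains u. *)
Lemma ZP t : t \in Z -> (c \notin t -> t \in DK) /\
  (c \in t -> [disjoint t & K] /\ exists2 z, z \notin t & z |: (t :\ c) \in DK).
Proof.
rewrite inE => /andP[/eqP t3]; case: ifP => ct bt; split=> // _.
have g2 : #|t :\ c|.+1 = 3 by have := cardsD1 c t; rewrite ct t3 add1n => <-.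
have [z zg zDK] := bdP bt; have [zS _] := DKP zDK.
split; last first.
  exists z => //; apply: contra zg => zt; rewrite in_setD1 zt andbT.
  by apply: contraNneq (c_notin zS) => <-; apply: setU11.
rewrite -setI_eq0; apply/eqP/setP=> u; rewrite in_setI in_set0; apply/negP=> /andP[ut uK].
have uc : u != c.
  have [uL _ _] := KP uK; apply: contraTneq uL => ->; apply: TL; rewrite TE; exact: setU11.
have [[_ cS] _ _] : min_cyc 3 S by apply: link_min_cyc => //; [case: (pair_facts hD lv TE ab) | rewrite cards2 ab].
suff e : bd (fun t => t \in S) (t :\ c) = bd w (t :\ c) by have := cS _ g2; rewrite e bt.
rewrite /bd; apply: eq_bigr => x xg; apply/idP/idP => [h|]; last by case/DKP.
by apply: in_DK h _ uK; rewrite in_setU1 in_setD1 uc ut orbT.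
Qed.

Lemma Z_vertex t x : t \in Z -> x \in t -> x != c -> exists2 t', t' \in DK & x \in t'.
Proof.
move=> tZ xt xc; have [h1 h2] := ZP tZ.
have [ct|ct] := boolP (c \in t); last by exists t; first exact: h1.
by have [_ [z _ zDK]] := h2 ct; exists (z |: (t :\ c)); rewrite // in_setU1 in_setD1 xc xt orbT.
Qed.

Lemma DK_cone t x e : t \in DK -> x \in t -> e \subset T -> #|e| = 2 -> x |: e \in D.
Proof.
move=> /DKP[tS [u ut uK]] xt eT e2; have [_ _ lu] := KP uK.
apply: sub (tri_swap hD lv TE ab ca cb tS ut lu eT e2) _.
by apply: setSU; rewrite sub1set.
Qed.

Lemma inGF x y : x != y -> [set x; y] \in D ->
  (x \in L -> y != kap (tau x)) -> (y \in L -> x != kap (tau y)) -> [set x; y] \in G :\: spokes.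
Proof.
move=> xy xyD hx hy; rewrite in_setD inG xy xyD !andbT; apply/negP.
by case/spokesP=> -[h e]; [move: (hy h)|move: (hx h)]; rewrite e eqxx.
Qed.

Lemma DK_edge t x y : t \in DK -> x \in t -> y \in t -> x != y -> [set x; y] \in G :\: spokes.
Proof.
move=> tDK xt yt xy; have [tS _] := DKP tDK; have [_ tD _] := link_tri' tS.
have nc z : z \in t -> z != c by apply: contraTneq => ->; apply: c_notin.
apply: inGF => //.
- by apply: sub tD _; rewrite subUset !sub1set !in_setU xt yt.
- by move=> /(DK_light tDK xt)/KP[_ -> _]; rewrite kc nc.
by move=> /(DK_light tDK yt)/KP[_ -> _]; rewrite kc nc.
Qed.

Lemma TT_edge x y : x \in T -> y \in T -> x != y -> [set x; y] \in G :\: spokes.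
Proof.
move=> xT yT xy; apply: inGF => //.
- have eT : [set x; y] \subset T by rewrite subUset !sub1set xT.
  have e2 : #|[set x; y]| = 2 by rewrite cards2 xy.
  by apply: sub (light_pair hD lv eT e2) _; apply: subsetUr.
- by move/negP: (TL xT).
by move/negP: (TL yT).
Qed.

Lemma DK_T_edge t x y : t \in DK -> x \in t -> y \in T -> (x \in L -> y != c) ->
  [set x; y] \in G :\: spokes.
Proof.
move=> tDK xt yT yc; have [tS _] := DKP tDK; have [_ tD dis] := link_tri' tS.
have xT : x \notin T by rewrite (disjointFr dis).
have [T3 _ _ _] := lv.
have [y' [c' [y'y _ _ TE']]] := card3_split T3 yT.
have eT : [set y; y'] \subset T by rewrite subUset !sub1set yT TE' !inE eqxx orbT.
have e2 : #|[set y; y']| = 2 by rewrite cards2 eq_sym y'y.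
apply: inGF.
- by apply: contraNneq xT => ->.
- by apply: sub (DK_cone tDK xt eT e2) _; subset_tac.
- by move=> xL; have [_ -> _] := KP (DK_light tDK xt xL); rewrite kc yc.
by move/negP: (TL yT).
Qed.

Lemma Z_edge t x y : t \in Z -> x \in t -> y \in t -> x != y -> [set x; y] \in G :\: spokes.
Proof.
move=> tZ xt yt xy; have [h1 h2] := ZP tZ.
have [ct|/h1 tDK] := boolP (c \in t); last exact: DK_edge tDK xt yt xy.
have [dis [z _ zDK]] := h2 ct.
have inz u : u \in t -> u != c -> u \in z |: (t :\ c).
  by move=> ut uc; rewrite in_setU1 in_setD1 uc ut orbT.
have cT : c \in T by rewrite TE setU11.
have notL u : u \in t -> u != c -> u \notin L.
  move=> ut uc; apply/negP=> /(DK_light zDK (inz u ut uc)) uK.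
  by rewrite (disjointFr dis ut) in uK.
have [xc|xc] := eqVneq x c.
  have yc : y != c by rewrite -xc eq_sym.
  rewrite xc setUC; apply: (DK_T_edge zDK (inz y yt yc) cT).
  by move=> yL; rewrite (negPf (notL y yt yc)) in yL.
have [yc|yc] := eqVneq y c; last exact: DK_edge zDK (inz x xt xc) (inz y yt yc) xy.
rewrite yc; apply: (DK_T_edge zDK (inz x xt xc) cT).
by move=> xL; rewrite (negPf (notL x xt xc)) in xL.
Qed.

(** A minimal cycle Y of [Z] through v must contain c: otherwise it is a cycle inside [S], hence
    [S], against [miss]. Y is rigid in dimension 3, and coning with a and then b makes it rigid in
    dimension 5 without any spoke. *)
Lemma key (f : V -> 'rV[rat]_5) : generic f ->
  exists W : {set V}, [/\ v \in W, c \in W & rigid f (G :\: spokes) W].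
Proof.
move=> gf; have V5 := card_gt5 hD.
have V3 : 3 < #|V| by apply: leq_trans V5.
have V4 : 4 < #|V| by apply: leq_trans V5.
have [sD s2 cn vn] := pair_facts hD lv TE ab.
have s5 : #|s| + 3 = 5 by rewrite s2.
have vK : v \in K by rewrite inE vL Tv eqxx.
have [t0 t0S vt0] : exists2 t0, t0 \in S & v \in t0.
  by move: vn; rewrite -(link_cover hD s5) // => /bigcupP.
have t0DK := in_DK t0S vt0 vK.
have t0Z : t0 \in Z.
  have w0 : w t0 := t0DK; rewrite in_set (negPf (c_notin t0S)) w0 andbT.
  by have [->] := link_tri' t0S.
have [Y [mY YZ t0Y]] := min_cyc_ex Z_cyc t0Z.
have cY : c \in cover Y.
  apply/negPn/negP=> cY.
  have YDK : Y \subset DK.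
    apply/subsetP=> t tY; have [h _] := ZP (subsetP YZ t tY); apply: h.
    by apply: contra cY => ct; apply/bigcupP; exists t.
  have YS : Y \subset S by apply: subset_trans YDK _; apply/subsetP=> t /DKP[].
  have [_ _ mS] := link_min_cyc hD sD s5 (isT : 0 < 3).
  have [cycY Y0 _] := mY.
  have [t tS dis] := miss; have : t \in DK by apply: (subsetP YDK); rewrite (mS Y YS cycY Y0).
  by rewrite inE dis andbF.
have t0U : t0 \subset cover Y by apply: (bigcup_sup t0).
have U3 : 3 <= #|cover Y|.
  by have [<- _ _] := link_tri' t0S; apply: subset_leq_card.
have UP x : x \in cover Y -> x = c \/ exists2 t, t \in DK & x \in t.
  case/bigcupP=> t tY xt; have [->|xc] := eqVneq x c; first by left.
  by right; apply: (Z_vertex (subsetP YZ t tY) xt xc).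
have UT x : x \in cover Y -> x \in T -> x = c.
  move=> /UP[//|[t /DKP[tS _] xt] xT]; have [_ _ dis] := link_tri' tS.
  by rewrite (disjointFr dis xt) in xT.
have [aT bT] : a \in T /\ b \in T by rewrite TE !inE !eqxx !orbT.
have aU : a \notin cover Y by apply: contraNN ca => aU; rewrite (UT a aU aT).
have bU : b \notin a |: cover Y.
  rewrite in_setU1 negb_or eq_sym ab; apply: contraNN cb => bU; by rewrite (UT b bU bT).
have [f3 g3] := generic_exists V 3; have [f4 g4] := generic_exists V (1 + 3).
have r3 : rigid f3 (edges Y) (cover Y) by apply: min_cyc_rigid.
have sp3 : spanning f3 (cover Y) by apply: generic_spanning.
have i3 := edges_inside (Z := Y).
have r4 := rigid_cone g4 V4 U3 aU i3 sp3 r3.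
set E4 := _ :|: _ in r4.
have i4 : inside E4 (a |: cover Y).
  move=> e /setUP[/i3/subset_trans->//|/imsetP[x xU ->]]; first exact: subsetUr.
  by rewrite subUset !sub1set !inE xU eqxx orbT.
have U4 : 4 <= #|a |: cover Y| by rewrite cardsU1 aU.
have sp4 : spanning f4 (a |: cover Y) by apply: generic_spanning.
have r5 := rigid_cone (d := 4) gf V5 U4 bU i4 sp4 r4.
exists (b |: (a |: cover Y)); split.
- by rewrite 2!in_setU1 (subsetP t0U) ?orbT.
- by rewrite 2!in_setU1 cY !orbT.
apply: rigidS r5 => //; apply/subsetP=> e.
have side x y : x \in cover Y -> y \in T -> y != c -> [set x; y] \in G :\: spokes.
  move=> /UP[->|[t tDK xt]] yT yc; last exact: DK_T_edge tDK xt yT _.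
  by apply: TT_edge; rewrite // ?TE ?setU11 // eq_sym.
case/setUP=> [/setUP[eY|/imsetP[x xU ->]]|/imsetP[x xU ->]].
- have := eY; rewrite inE => /andP[/cards2P[x [y [xy eE]]] _].
  rewrite eE in eY *; have [t tY /andP[xt yt]] := edge_ex xy eY.
  exact: Z_edge (subsetP YZ t tY) xt yt xy.
- by apply: side; rewrite // eq_sym.
have [->|xa] := eqVneq x a; first exact: TT_edge.
by apply: side; rewrite // 1?eq_sym //; move: xU; rewrite in_setU1 (negPf xa).
Qed.
End Key.

(** The ends of each spoke lie in a set that is rigid without spokes, so every motion of the
    remaining graph satisfies the deleted conditions too, and rigidity of the whole graph is
    inherited. The number 15 is the dimension of the symmetric 5 x 5 matrices. *)
Lemma deletion_bound :
  (forall v, v \in L -> exists a b c, [/\ tau v = c |: [set a; b], a != b, c != a & c != b] /\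
     kap (tau v) = c /\
     exists2 t, t \in skel (link D [set a; b]) 3 & [disjoint t & [set u in L | tau u == tau v]]) ->
  5 * #|V| + #|L| <= #|up D set0 2| + 15.
Proof.
move=> h; have [f gf] := generic_exists V 5.
have N5 : #|@set0 V| + 5 = 5 by rewrite cards0.
have [rG _] := link_rigid hD (face0 hD) N5 (isT : 2 < 5) gf.
have rGF : rigid f (G :\: spokes) [set: V].
  move=> m mot; rewrite (nb0 hD) in rG; apply: rG => x y xy xyG.
  have [|xyF] := boolP ([set x; y] \in spokes); last first.
    by apply: mot; rewrite // in_setD xyF.
  have spoke u : u \in L -> dot (f u) (m (kap (tau u))) = dot (f (kap (tau u))) (m u).
    move=> uL; have [a [b [c [[TE ab ca cb] [kc miss]]]]] := h u uL.
    have [W [uW cW rW]] := key uL (erefl _) TE ab ca cb kc miss gf.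
    have [S symS mS] := rW m mot.
    by rewrite kc !mS //; apply: dot_sym.
  by case/spokesP=> -[uL ->]; rewrite spoke.
have := rigid_count (fun e _ => subsetT e) rGF.
have sub_spokes : spokes \subset G.
  apply/subsetP=> _ /imsetP[v vL ->]; have lv := Ll vL; have [_ vT _ _] := lv.
  rewrite inG (light_edge hD lv (Lk vL)) andbT.
  by apply: contraNneq vT => e; rewrite -{1}e; apply: Lk.
have := cardsID spokes G; rewrite (setIidPr sub_spokes) card_spokes (card_skel_link sub).
have t15 : tdim 5 <= 15.
  apply: leq_trans (tdim_le 5) _.
  have -> : #|[set p : 'I_5 * 'I_5 | p.1 <= p.2]| = \sum_(i < 5) \sum_(j < 5) (i <= j).
    rewrite pair_bigA /= -sum1_card big_mkcond; apply: eq_bigr => p _.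
    by rewrite inE; case: (p.1 <= p.2).
  by rewrite !big_ord_recl !big_ord0.
rewrite cardsT; move: t15; clear; move: (tdim 5) (#|_|) (#|_|) (#|_|) (#|_|); lia.
Qed.
End Deletion.

(** * The inequality between the numbers of edges and vertices *)

Lemma edge_bound (V : finType) (D : {set {set V}}) : sphere_class 2 4 D ->
  27 * #|V| <= 5 * #|up D set0 2| + 81.
Proof.
move=> hD; have all_heavy := heavy_sum hD (L := setT) (fun v => ltac:(by rewrite inE)).
(* With every vertex in L the sum reads 4 g_2 >= f_0, and 5 f_0 / 4 >= 2 f_0 - 6 holds exactly for
   f_0 <= 8. *)
rewrite cardsT in all_heavy; have [V8|V8] := leqP #|V| 8.
  by move: all_heavy V8; clear; move: (#|V|) (#|_|); lia.
have [x0 _] : exists x : V, x \in V by apply/card_gt0P; apply: leq_trans V8.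
have ex v : exists p : bool * {set V},
    if p.1 then good D v p.2 else forall T, ~ light D v T.
  have [lv|nl] := classic (exists T, light D v T).
    by have [T gT] := light_good hD V8 lv; exists (true, T).
  by exists (false, set0) => T lT; apply: nl; exists T.
have [F FP] := fin_all_exists ex.
have ek (T : {set V}) : exists x, T != set0 -> x \in T.
  have [->|[x xT]] := set_0Vmem T; first by exists x0; rewrite eqxx.
  by exists x.
have [kap kapP] := fin_all_exists ek.
pose L := [set v | (F v).1]; pose tau v := (F v).2.
have LP v : v \in L -> good D v (tau v) by rewrite inE => vL; have := FP v; rewrite vL.
have LN v T : v \notin L -> ~ light D v T by rewrite inE => /negPf vL; have := FP v; rewrite vL; apply.
have Ll v : v \in L -> light D v (tau v) by case/LP.
have Lt v x : v \in L -> x \in tau v -> x \notin L.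
  by move=> /LP[_ h] xT; apply/negP=> /Ll; apply: h.
have Lk v : v \in L -> kap (tau v) \in tau v.
  move=> vL; apply: kapP; have [T3 _ _ _] := Ll v vL.
  by rewrite -card_gt0 T3.
have split3 v : v \in L -> exists a b c,
    [/\ tau v = c |: [set a; b], a != b, c != a & c != b] /\ kap (tau v) = c.
  move=> vL; have [T3 _ _ _] := Ll v vL.
  have [a [b [ac bc ab TE]]] := card3_split T3 (Lk v vL).
  by exists a, b, (kap (tau v)); split=> //; split; rewrite // eq_sym.
have hsum := heavy_sum hD (L := L).
have {}hsum : 22 * #|V| <= 4 * #|up D set0 2| + 60 + #|L|.
  apply: hsum => v vL; have [_ [//|[T lT]]] := light_or_heavy hD v.
  by case: (LN v T vL lT).
(* Exceptional: the light vertices with this triangle meet every triangle of the link of ab. If this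
   never happens, [deletion_bound] added to [hsum] gives 27 f_0 <= 5 f_1 + 75. *)
have [[v [a [b [c [vL [TE ab ca cb] exc]]]]]|nexc] := classic (exists v a b c,
    [/\ v \in L, [/\ tau v = c |: [set a; b], a != b, c != a & c != b] &
    forall t, t \in skel (link D [set a; b]) 3 -> exists2 w, w \in t & light D w (tau v)]).
  exact: (exceptional_bound hD (Ll v vL) TE ab ca cb exc).
have := @deletion_bound V D hD L tau kap Ll Lt Lk.
suff h : forall v, v \in L -> exists a b c, [/\ tau v = c |: [set a; b], a != b, c != a & c != b] /\
     kap (tau v) = c /\
     exists2 t, t \in skel (link D [set a; b]) 3 & [disjoint t & [set u in L | tau u == tau v]].
  by move=> /(_ h); move: hsum; clear; move: (#|V|) (#|_|) (#|_|); lia.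
move=> v vL; have [a [b [c [TE kc]]]] := split3 v vL.
exists a, b, c; split=> //; split=> //; apply: NNPP => nt; apply: nexc; exists v, a, b, c.
split=> // t tS; apply: NNPP => nw; apply: nt; exists t => //.
rewrite -setI_eq0; apply/eqP/setP=> u; rewrite in_setI !inE; apply/negP=> /and3P[ut uL /eqP tu].
by apply: nw; exists u; rewrite // -tu; apply: Ll; rewrite inE.
Qed.

Local Open Scope ring_scope.

(** * From face numbers to g-numbers *)

Lemma coef_XB1 (n k : nat) : (('X - 1 : {poly int}) ^+ n.+1)`_k =
  (if k is k'.+1 then (('X - 1 : {poly int}) ^+ n)`_k' else 0) - (('X - 1 : {poly int}) ^+ n)`_k.
Proof. by rewrite exprSr mulrBr mulr1 coefB coefMX; case: k. Qed.

Section GNumbers.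
Variables (V : finType) (D : {set {set V}}).
Hypothesis hD : sphere_class 2 4 D.

Lemma complex_rank_eq : complex_rank D = 5%N.
Proof.
apply/eqP; rewrite eqn_leq; apply/andP; split.
  by apply/bigmax_leqP => s sD; apply: face_card hD _ sD.
have [F [FD F5 _]] := face_facet hD (face0 hD).
by rewrite -F5 /complex_rank; apply: (leq_bigmax_cond (F := fun s : {set V} => #|s|)).
Qed.

Lemma fnum0 : fnum D 0 = #|V|.
Proof.
rewrite /fnum (_ : 0 = 1%N%:Z - 1) // facesE.
suff -> : skel D 1 = [set [set x] | x in [set: V]] by rewrite card_imset ?cardsT //; apply: set1_inj.
apply/setP=> s; rewrite inE; apply/andP/imsetP => [[_ /cards1P[x ->]]|[x _ ->]].
  by exists x.
by rewrite cards1 (face1 hD).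
Qed.

Lemma fnum1 : fnum D 1 = #|up D set0 2|.
Proof.
rewrite /fnum (_ : 1 = 2%N%:Z - 1) // facesE; congr #|pred_of_set _|.
by apply/setP=> s; rewrite !inE sub0set cards0.
Qed.

Lemma fnumN1 : fnum D (-1) = 1%N.
Proof.
rewrite /fnum (_ : -1 = 0%N%:Z - 1) // facesE; apply/eqP/cards1P; exists set0.
apply/setP=> s; rewrite !inE cards_eq0; case: eqP => [->|]; rewrite ?andbF //.
by rewrite (face0 hD).
Qed.

Lemma gnumE : gnum D 1 = #|V|%:Z - 6 /\ gnum D 2 = #|up D set0 2|%:Z - 5 * #|V|%:Z + 15.
Proof.
rewrite /gnum /hnum /hpoly complex_rank_eq !coef_sum !big_ord_recl !big_ord0 /= /bump /=.
rewrite !coefZ; do !rewrite coef_XB1 /=; rewrite !expr0 !coef1 /=.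
rewrite (_ : 0%:Z - 1 = -1) // (_ : 1%:Z - 1 = 0) // (_ : 2%:Z - 1 = 1) //.
rewrite fnumN1 fnum0 fnum1; split; ring.
Qed.

End GNumbers.

Theorem theorem4p7 (V : finType) (D : {set {set V}}) (hD : sphere_class 2 4 D) :
  (gnum D 2)%:~R >= 2 / 5 * (fnum D 0)%:R - 6 / 5 :> rat /\
  2 / 5 * (fnum D 0)%:R - 6 / 5
    = 2 / 5 * (gnum D 1)%:~R + 6 / 5 * (gnum D 0)%:~R :> rat.
Proof.
have [g1 g2] := gnumE hD; have := edge_bound hD.
rewrite g1 g2 fnum0 // -(ler_nat rat) !(natrD, natrM, intrD, intrM, rmorphN) /=.
rewrite -!pmulrn; split; lra.
Qed.
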